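(* Let $\mathbb{A}=\{\mathbf{a}_1,\dots,\mathbf{a}_d\}$ be a linearly independent set of vectors in $\mathbb{R}^d$, let $A$ be the $d\times d$ real matrix whose $k$-th row is $\mathbf{a}_k^\top$, let $S=\mathcal{D}'_{\mathbb{A}}(\mathbb{R}^{d+1})$, and let $p\in\mathbb{C}[X_1,\dots,X_d,T]$. Then $N_S(p)=\{0\}$ if and only if for every $\mathbf{v}\in A^{-1}2\pi\mathbb{Z}^d$ there exists $t\in\mathbb{C}$ such that $p(i\mathbf{v},t)\neq 0$.
   Context: For $\mathbf{a}\in\mathbb{R}^d$ the translation $\mathbf{S}_{\mathbf{a}}$ on $\mathcal{D}'(\mathbb{R}^d)$ is $\langle\mathbf{S}_{\mathbf{a}}T,\varphi\rangle=\langle T,\varphi(\cdot+\mathbf{a})\rangle$, and $\mathcal{D}'_{\mathbb{A}}(\mathbb{R}^d)=\{T\in\mathcal{D}'(\mathbb{R}^d):\mathbf{S}_{\mathbf{a}_k}T=T,\ k=1,\dots,d\}$. For $u\in\mathcal{D}'(\mathbb{R}^{d+1})$ (coordinates $(\mathbf{x},t)$), let $\vec{u}:\mathcal{D}(\mathbb{R})\to\mathcal{D}'(\mathbb{R}^d)$ be given by $\langle\vec{u}(\varphi),\psi\rangle=\langle u,\psi\otimes\varphi\rangle$ for $\varphi\in\mathcal{D}(\mathbb{R})$, $\psi\in\mathcal{D}(\mathbb{R}^d)$. Then $\mathcal{D}'_{\mathbb{A}}(\mathbb{R}^{d+1})=\{u\in\mathcal{D}'(\mathbb{R}^{d+1}):\vec{u}(\varphi)\in\mathcal{D}'_{\mathbb{A}}(\mathbb{R}^d)\text{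 for all }\varphi\in\mathcal{D}(\mathbb{R})\}$. $D_p=p\left(\frac{\partial}{\partial x_1},\dots,\frac{\partial}{\partial x_d},\frac{\partial}{\partial t}\right)$; $N_S(p)=\{u\in S: D_pu=0,\ u|_{t<0}=0\}$, where $u|_{t<0}$ is the restriction to $\{t<0\}$. *)

(* Defs.v *)
From HB Require Import structures.
From mathcomp Require Import all_boot all_order all_algebra.
From mathcomp Require Import all_classical all_reals all_analysis.
From mathcomp Require Import complex.
From mathcomp Require mpoly.
Set Implicit Arguments. Unset Strict Implicit. Unset Printing Implicit Defensive.
Import Order.TTheory GRing.Theory Num.Theory.
Import numFieldNormedType.Exports.
Local Open Scope classical_set_scope.
Local Open Scope ring_scope.

Section Distributions.
Variable R : realType.

Definition ebasis (n : nat) (i : 'I_n) : 'rV[R]_n := delta_mx 0 i.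

Fixpoint pder (n : nat) (s : seq 'I_n) (f : 'rV[R]_n -> R) : 'rV[R]_n -> R :=
  match s with
  | [::] => f
  | i :: s' => fun x => derive (pder s' f) x (ebasis i)
  end.

Definition smooth (n : nat) (f : 'rV[R]_n -> R) : Prop :=
  forall s : seq 'I_n, continuous (pder s f) /\
    forall (x : 'rV[R]_n) (i : 'I_n), derivable (pder s f) x (ebasis i).

Definition fsupport (n : nat) (f : 'rV[R]_n -> R) : set 'rV[R]_n :=
  closure [set x | f x != 0].

(* test functions D(R^n) (real-valued; a complex test function is a pair of
   these, and a complex distribution is determined by its R-linear action on
   real test functions) *)
Definition test_fun (n : nat) (f : 'rV[R]_n -> R) : Prop :=
  smooth f /\ compact (fsupport f).

(* partial derivative of multi-index m : d^m = prod_i d_i^(m i) *)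
Definition mi_seq (n : nat) (m : 'I_n -> nat) : seq 'I_n :=
  flatten [seq nseq (m i) i | i <- enum 'I_n].

Definition distribution (n : nat) (T : ('rV[R]_n -> R) -> complex R) : Prop :=
  (forall (a : R) (f g : 'rV[R]_n -> R), test_fun f -> test_fun g ->
      T (fun x => a * f x + g x) = (a%:C)%C * T f + T g) /\
  (forall (phi : nat -> 'rV[R]_n -> R) (K : set 'rV[R]_n),
      compact K ->
      (forall j, test_fun (phi j)) ->
      (forall j, fsupport (phi j) `<=` K) ->
      (forall (s : seq 'I_n) (e : R), 0 < e ->
          \forall j \near \oo, forall x, `|pder s (phi j) x| < e) ->
      forall e : R, 0 < e -> \forall j \near \oo, `|T (phi j)| < (e%:C)%C).

Definition xpart (d : nat) (z : 'rV[R]_d.+1) : 'rV[R]_d :=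
  \row_(i < d) z 0 (widen_ord (leqnSn d) i).
Definition tpart (d : nat) (z : 'rV[R]_d.+1) : R := z 0 ord_max.

Definition tensor (d : nat) (psi : 'rV[R]_d -> R) (phi : 'rV[R]_1 -> R)
  : 'rV[R]_d.+1 -> R :=
  fun z => psi (xpart z) * phi (const_mx (tpart z)).

(* D'_A(R^(d+1)) : for every test phi in t, vec u(phi) is invariant under the
   translations S_{a_k}, a_k = k-th row of A. *)
Definition periodic_dist (d : nat) (A : 'M[R]_d)
    (u : ('rV[R]_d.+1 -> R) -> complex R) : Prop :=
  forall (k : 'I_d) (phi : 'rV[R]_1 -> R) (psi : 'rV[R]_d -> R),
    test_fun phi -> test_fun psi ->
    u (tensor (fun x => psi (x + row k A)) phi) = u (tensor psi phi).

(* the operator D_p acting on distributions on R^(d+1):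
   <d^m u, f> = (-1)^|m| <u, d^m f> *)
Definition Dp (d : nat) (p : mpoly.mpoly d.+1 (complex R))
    (u : ('rV[R]_d.+1 -> R) -> complex R) : ('rV[R]_d.+1 -> R) -> complex R :=
  fun f => \sum_(m <- mpoly.msupp p)
     mpoly.mcoeff m p * (-1) ^+ (mpoly.mdeg m) * u (pder (mi_seq (mpoly.fun_of_multinom m)) f).

Definition vanishes_on_neg_t (d : nat) (u : ('rV[R]_d.+1 -> R) -> complex R)
  : Prop :=
  forall f, test_fun f -> fsupport f `<=` [set z | tpart z < 0] -> u f = 0.

Definition NS_trivial (d : nat) (A : 'M[R]_d) (p : mpoly.mpoly d.+1 (complex R))
  : Prop :=
  forall u, distribution u -> periodic_dist A u ->
    (forall f, test_fun f -> Dp p u f = 0) -> vanishes_on_neg_t u ->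
    forall f, test_fun f -> u f = 0.

Definition ivt (d : nat) (v : 'cV[R]_d) (t : complex R) : 'I_d.+1 -> complex R :=
  fun j => match unlift ord_max j with
           | Some i => 'i%C * ((v i 0)%:C)%C
           | None => t
           end.

End Distributions.

(* Main.v *)
(* Write e_v for exp(i v.x).  Both directions rest on Riemann sums instead of integrals.

   Uniqueness.  Let chi be a smooth partition of unity over Z and F_N the Fejér kernel.
   Every test function f is the limit in D of Riemann sums of its convolution with
   prod_i chi(x_i) F_N(x_i): discrete integration by parts moves the derivatives from the
   kernel to f.  So a distribution vanishing on all translates of these product kernels
   is 0.  This first extends the lattice invariance of u from tensor products to all test
   functions.  Then, in lattice coordinates, the kernels are combinations of the functions
   e_{-v} chi phi, chi depending on x - y and phi on t, so it suffices that
   w(phi) = <u, e_{-v} chi phi> vanishes.  Since chi(s) = step(s + 1) - step(s), the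
   derivatives of chi are differences of lattice translates, invisible to u e_{-v}; hence
   D_p u = 0 becomes p(iv, d/dt) w = 0, and w = 0 on t < 0 forces w = 0 by factoring the
   nonzero polynomial p(iv, T) over C.

   Nonuniqueness.  If p(iv, T) = 0 then e_v(x) step(t) is a nonzero solution; pairing with
   it is the limit of Riemann sums along an ultrafilter, and the same discrete integration
   by parts shows that this limit kills derivatives and is translation invariant. *)
Require Import Defs.
From HB Require Import structures.
From mathcomp Require Import all_boot all_order all_algebra.
From mathcomp Require Import all_classical all_reals all_analysis.
From mathcomp Require Import complex ring lra zify.
From mathcomp Require mpoly.
Set Implicit Arguments. Unset Strict Implicit. Unset Printing Implicit Defensive.
Import Order.TTheory GRing.Theory Num.Theory.
Import numFieldNormedType.Exports.
Local Open Scope classical_set_scope.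
Local Open Scope ring_scope.

(** * Smooth functions of one variable *)

Section Smooth1.
Variable R : realType.
Implicit Types (f g : R -> R) (x y s t : R).

(** The number w(phi) acts as the v-th Fourier coefficient of [u] in x: [chi] is a smooth substitute
    for the indicator of a fundamental cell, and w is obtained from [u] by multiplication and
    pairing only. The kernel has to satisfy two demands at once. It must be a finite combination of
    characters once [chi] is split off, so that it can be paired with [u] term by term; and it must
    be nonnegative with mass 1, so that one moment controls its concentration. The Fejér kernel
    meets both, whereas the Dirichlet kernel changes sign. Its sums over a grid of mesh 1/M are
    exact as soon as M exceeds the degree, since they are sums over roots of unity. The derivatives
    of the kernel grow with N, which is why they must be moved to f before anything is estimated:
    for each N the mesh is refined until the error of this transfer is small. Test functions are
    real while [u] is complex, so every exponential is carried as a cosine and a sine. *)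

Definition smooth1 f := forall n x, derivable (derive1n n f) x 1.

Lemma smooth1_derive f : smooth1 f -> smooth1 (derive1 f).
Proof. by move=> sf n x; rewrite -derive1Sn. Qed.

Lemma smooth1_is_derive f x : smooth1 f -> is_derive x 1 f ((derive1 f) x).
Proof. by move=> /(_ 0 x) df; rewrite derive1E; exact: derivableP. Qed.

Lemma smooth1_continuous f : smooth1 f -> continuous f.
Proof.
move=> /(_ 0) df x.
by apply/differentiable_continuous/derivable1_diffP; exact: df.
Qed.

(* Smoothness by coinduction: it suffices to exhibit a class closed under derivation. *)
Lemma smooth1_coind (S : (R -> R) -> Prop) :
  (forall f, S f -> exists2 g, S g & forall x, is_derive x 1 f (g x)) ->
  forall f, S f -> smooth1 f.
Proof.
move=> dS f Sf n; suff: S (derive1n n f).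
  by move=> /dS[g _ dg] x; have [] := dg x.
elim: n => [//|n /dS[g Sg dg]]; rewrite derive1nS.
suff -> : derive1 (derive1n n f) = g by [].
by apply/funext => x; rewrite derive1E; have [_ ->] := dg x.
Qed.

(** Stable under derivation, so a single coinduction yields all closure properties. Composition and
    inversion are restricted to smooth arguments [f]: their derivatives are then again products of
    constructors. *)
Inductive smooth1_alg : (R -> R) -> Prop :=
| Salg_base f of smooth1 f : smooth1_alg f
| Salg_cst (c : R) : smooth1_alg (fun=> c)
| Salg_comp f (a b : R) of smooth1 f : smooth1_alg (fun s => f (a * s + b))
| Salg_inv f of smooth1 f & (forall s, f s != 0) : smooth1_alg (fun s => (f s)^-1)
| Salg_add f g of smooth1_alg f & smooth1_alg g : smooth1_alg (fun s => f s + g s)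
| Salg_mul f g of smooth1_alg f & smooth1_alg g : smooth1_alg (fun s => f s * g s).

Lemma smooth1_algP f : smooth1_alg f -> smooth1 f.
Proof.
move: f; apply: smooth1_coind => f; elim=> {f}.
- move=> f sf; exists (derive1 f); first exact/Salg_base/smooth1_derive.
  by move=> x; exact: smooth1_is_derive.
- by move=> c; exists (fun=> 0); [exact: Salg_cst|move=> x; exact: is_derive_cst].
- move=> f a b sf; exists (fun s => (derive1 f) (a * s + b) * a).
    apply: Salg_mul; last exact: Salg_cst.
    exact/(@Salg_comp (derive1 f))/smooth1_derive.
  move=> x; apply: (@is_derive1_comp _ f (fun s => a * s + b)).
    exact: smooth1_is_derive.
  apply: (@is_derive_eq _ _ _ (fun s => a * s + b)).
  by rewrite /GRing.scale /=; ring.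
- move=> f sf f0; exists (fun s => (- 1) * ((f s)^-1 * (f s)^-1) * (derive1 f) s).
    apply: Salg_mul; last exact/Salg_base/smooth1_derive.
    apply: Salg_mul; first exact: Salg_cst.
    by apply: Salg_mul; exact: Salg_inv.
  move=> x; apply: is_derive_eq.
    by apply: is_deriveV => //; exact: smooth1_is_derive.
  by rewrite /GRing.scale /= -expr2 exprVn mulN1r.
- move=> f g _ [f' Sf' df] _ [g' Sg' dg]; exists (fun s => f' s + g' s).
    exact: Salg_add.
  by move=> x; exact: (@is_deriveD _ _ _ f g).
- move=> f g Sf [f' Sf' df] Sg [g' Sg' dg].
  exists (fun s => f s * g' s + g s * f' s).
    by apply: Salg_add; apply: Salg_mul.
  by move=> x; exact: (@is_deriveM _ _ f g).
Qed.

Lemma smooth1_cst c : smooth1 (fun=> c).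
Proof. exact/smooth1_algP/Salg_cst. Qed.
Lemma smooth1_comp f a b : smooth1 f -> smooth1 (fun s => f (a * s + b)).
Proof. by move=> ?; exact/smooth1_algP/Salg_comp. Qed.
Lemma smooth1V f : smooth1 f -> (forall s, f s != 0) -> smooth1 (fun s => (f s)^-1).
Proof. by move=> *; exact/smooth1_algP/Salg_inv. Qed.
Lemma smooth1D f g : smooth1 f -> smooth1 g -> smooth1 (fun s => f s + g s).
Proof. by move=> *; apply/smooth1_algP/Salg_add; exact: Salg_base. Qed.
Lemma smooth1M f g : smooth1 f -> smooth1 g -> smooth1 (fun s => f s * g s).
Proof. by move=> *; apply/smooth1_algP/Salg_mul; exact: Salg_base. Qed.
Lemma smooth1N f : smooth1 f -> smooth1 (fun s => - f s).
Proof.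
move=> sf; under eq_fun do rewrite -mulN1r.
exact: (smooth1M (@smooth1_cst (-1)) sf).
Qed.
Lemma smooth1B f g : smooth1 f -> smooth1 g -> smooth1 (fun s => f s - g s).
Proof. by move=> sf sg; exact: (smooth1D sf (smooth1N sg)). Qed.
Lemma smooth1_shift f b : smooth1 f -> smooth1 (fun s => f (s - b)).
Proof.
by move=> /(@smooth1_comp f 1 (- b)); under eq_fun do rewrite mul1r.
Qed.

Lemma smooth1_cos : smooth1 cos.
Proof.
pose S f := exists a b : R, f = (fun s => a * cos s + b * sin s).
apply: (@smooth1_coind S); last first.
  by exists 1, 0; apply/funext => s; rewrite mul1r mul0r addr0.
move=> _ [a [b ->]]; exists (fun s => b * cos s + (- a) * sin s); first by exists b, (- a).
move=> x; apply: (@is_derive_eq _ _ _ (fun s => a * cos s + b * sin s)).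
by rewrite /GRing.scale /=; ring.
Qed.

Lemma smooth1_sin : smooth1 sin.
Proof.
have := @smooth1_comp cos 1 (- (pi / 2)) smooth1_cos.
by under eq_fun do rewrite mul1r cosBpihalf.
Qed.

(** The exponent [n] closes the family under derivation up to linear combinations: the derivative of
    [flat n] is [flat (n+2) - n flat (n+1)], also at 0. [flat 0] is the classical exp(-1/s) extended
    by 0. *)
Definition flat n s : R := if 0 < s then s ^- n * expR (- s^-1) else 0.

(** One term of the exponential series suffices: exp(1/s) is at least (1/s)^(n+2) / (n+2)!. A
    quadratic bound makes the difference quotient at 0 tend to 0. *)
Lemma flat_le n s : `|flat n s| <= n.+2`!%:R * s ^+ 2.
Proof.
rewrite /flat; case: ifPn => [s0|_]; last first.
  by rewrite normr0 mulr_ge0// ?sqr_ge0// ler0n.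
have e0 := expR_gt0 (- s^-1).
rewrite ger0_norm; last by rewrite mulr_ge0 ?invr_ge0 ?exprn_ge0 ?(ltW e0) ?(ltW s0).
have := @expR_ge1Dxn _ s^-1 n.+1; rewrite invr_ge0 (ltW s0) => /(_ isT) h.
have {}h : s^-1 ^+ n.+2 / (n.+2)`!%:R <= expR s^-1 by apply: le_trans h; rewrite lerDr.
rewrite expRN ler_pdivrMr ?expR_gt0//.
apply: (@le_trans _ _ (n.+2`!%:R * s ^+ 2 * (s^-1 ^+ n.+2 / (n.+2)`!%:R))); last first.
  by apply: ler_wpM2l h; rewrite mulr_ge0// ?ler0n// sqr_ge0.
rewrite le_eqVlt; apply/orP; left; apply/eqP.
have f0 : (n.+2)`!%:R != 0 :> R by rewrite pnatr_eq0 -lt0n fact_gt0.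
have s1 : s != 0 by rewrite gt_eqF.
rewrite exprVn -addn2 exprD invfM.
rewrite [RHS](_ : _ = s ^- n * ((n + 2)`!%:R / (n + 2)`!%:R) * (s ^+ 2 / s ^+ 2)); last by ring.
by rewrite !divff ?mulr1// ?expf_neq0// addn2.
Qed.

Lemma is_derive_flat n s : is_derive s 1 (flat n) (flat n.+2 s - n%:R * flat n.+1 s).
Proof.
have powV k t : ((fun t : R => t^-1) ^+ k) t = t ^- k.
  by elim: k => [|k IH]; rewrite ?expr0 ?invr1// exprS mulrfctE IH exprS invfM.
have [s0|s0|->] := ltgtP s 0.
- apply: (@near_eq_is_derive _ _ _ (cst 0)); last first.
    apply: is_derive_eq.
    by rewrite /flat ltNge (ltW s0)/= mulr0 subr0.
  near=> t; rewrite /flat ltNge ltW//; near: t.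
  exact: lt_nbhsl.
- apply: (@near_eq_is_derive _ _ _ ((fun t => t^-1) ^+ n * (fun t : R => expR (- t^-1)))).
    near=> t; rewrite /flat /= ifT; last by near: t; exact: lt_nbhsr.
    by rewrite mulrfctE powV.
  have sV : is_derive s 1 (fun t : R => t^-1) (- s ^- 2).
    apply: is_derive_eq; first by apply: (@is_deriveV _ id) => /=; rewrite gt_eqF.
    by rewrite /GRing.scale /= mulr1.
  have dE : is_derive s 1 (fun t : R => expR (- t^-1)) (expR (- s^-1) * s ^- 2).
    apply: (@is_derive1_comp _ expR (fun t => - t^-1)).
    by rewrite -[X in is_derive _ _ _ X]opprK; exact: (@is_deriveN _ _ _ (fun t => t^-1)).
  apply: is_derive_eq.
  rewrite /flat s0 /GRing.scale /=.
  rewrite powV.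
  have s1 : s != 0 by rewrite gt_eqF.
  case: n => [|n]; rewrite /= ?mul0r ?mulr0 ?addr0 ?subr0.
    by rewrite expr0 invr1 mul1r mulrC.
  rewrite !exprVn (exprS _ n.+2) (exprS _ n.+1) (exprS _ n) !expr2 !invfM.
  by ring.
- rewrite /flat ltxx mulr0 subr0.
  suff h : (fun h : R => h^-1 *: (flat n (h *: 1 + 0) - flat n 0)) @ 0^' --> (0 : R).
    by apply: DeriveDef; [apply/cvg_ex; exists 0|exact: cvg_lim].
  apply/cvgrPdist_le => e e0.
  have c0 : 0 < n.+2`!%:R :> R by rewrite ltr0n fact_gt0.
  near=> h.
  have h0 : h != 0 by near: h; exact: nbhs_dnbhs_neq.
  rewrite addr0 [h *: _]mulr1 [flat n 0]/flat ltxx subr0 sub0r normrN.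
  rewrite /GRing.scale /= normrM normfV ler_pdivrMl ?normr_gt0//.
  apply: le_trans (flat_le _ _) _.
  rewrite -real_normK ?num_real// expr2 mulrCA ler_wpM2l// -ler_pdivlMl//.
  near: h; apply: dnbhs0_le; by rewrite mulr_gt0 ?invr_gt0.
Unshelve. all: by end_near. Qed.

Lemma smooth1_flat n : smooth1 (flat n).
Proof.
pose S (f : R -> R) := exists (k : nat) (c : 'I_k -> R) (m : 'I_k -> nat),
  f = fun s => \sum_(i < k) c i * flat (m i) s.
have S2 (f g : R -> R) : S f -> S g -> S (fun s => f s + g s).
  move=> [k [c [m ->]]] [k' [c' [m' ->]]]; exists (k + k')%N.
  exists (fun i => match fintype.split i with inl i => c i | inr i => c' i end).
  exists (fun i => match fintype.split i with inl i => m i | inr i => m' i end).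
  apply/funext => s; rewrite big_split_ord /=; congr (_ + _); apply: eq_bigr => i _.
    by rewrite (unsplitK (inl _ i)).
  by rewrite (unsplitK (inr _ i)).
have S1 c k : S (fun s => c * flat k s).
  by exists 1%N, (fun=> c), (fun=> k); apply/funext => s; rewrite big_ord1.
apply: (@smooth1_coind S); last by have := S1 1 n; under eq_fun do rewrite mul1r.
move=> _ [k [c [m ->]]].
exists (fun s => \sum_(i < k) c i * (flat (m i).+2 s - (m i)%:R * flat (m i).+1 s)).
  elim: k c m => [|k IH] c m.
    by exists 0, c, m; apply/funext => s; rewrite !big_ord0.
  under eq_fun do rewrite big_ord_recl.
  refine (S2 (fun s => c ord0 * (flat (m ord0).+2 s - (m ord0)%:R * flat (m ord0).+1 s))
    _ _ (IH _ _)).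
  under eq_fun do rewrite mulrBr mulrA -mulNr.
  exact: (S2 _ _ (S1 _ _) (S1 _ _)).
move=> x.
have -> : (fun s => \sum_(i < k) c i * flat (m i) s) =
    \sum_(i < k) (fun s => c i * flat (m i) s).
  by apply/funext => s; rewrite fct_sumE.
apply: is_derive_sum => i; have := is_derive_flat (m i) x.
exact: (@is_deriveZ _ _ _ (flat (m i)) (c i)).
Qed.

End Smooth1.

(** * A smooth partition of unity and localized Fejér kernels *)

Section Kernel.
Variable R : realType.
Implicit Types (f g P : R -> R) (x y s t : R).

Lemma derive1_near_cst f c s : (\forall t \near s, f t = c) -> derive1 f s = 0.
Proof.
move=> fc; rewrite derive1E (@near_eq_derive _ _ _ _ (cst c))//.
exact: derive_cst.
Qed.

Definition test1 f := smooth1 f /\ exists r : R, forall s, r < `|s| -> f s = 0.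

Lemma test1_derive f : test1 f -> test1 (derive1 f).
Proof.
move=> [sf [r fr]]; split; first exact: smooth1_derive.
exists r => s rs; apply: (@derive1_near_cst _ 0); near=> t; apply: fr.
near: t; apply: (cvgr_gt `|s|) => //; exact: norm_continuous.
Unshelve. all: by end_near. Qed.

Lemma test1_derive1n f n : test1 f -> test1 (derive1n n f).
Proof. by elim: n => [//|n IH] tf; rewrite derive1nS; exact/test1_derive/IH. Qed.

Lemma test1_shift f b : test1 f -> test1 (fun s => f (s - b)).
Proof.
move=> [sf [r fr]]; split; first exact: smooth1_shift.
exists (r + `|b|) => s rs; apply: fr; rewrite ltNge; apply/negP => h.
have := ler_normD (s - b) b; rewrite subrK => h'; move: rs; rewrite ltNge => /negP; apply.
by apply: le_trans h' _; rewrite lerD2r.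
Qed.

Lemma test1M f g : test1 f -> smooth1 g -> test1 (fun s => f s * g s).
Proof.
move=> [sf [r fr]] sg; split; first exact: smooth1M.
by exists r => s rs; rewrite fr// mul0r.
Qed.

(** The two terms vanish on the disjoint half-lines s <= 1/4 and s >= 3/4, so their sum is a
    positive denominator and [step] climbs from 0 to 1 between these points. *)
Let stepd s : R := flat 0 (s - 1/4) + flat 0 (3/4 - s).

Lemma flat_ge0 n s : 0 <= flat n s.
Proof.
rewrite /flat; case: ifPn => // s0.
by rewrite mulr_ge0 ?invr_ge0 ?exprn_ge0 ?expR_ge0// ltW.
Qed.

Lemma flat_gt0 n s : 0 < s -> 0 < flat n s.
Proof. by move=> s0; rewrite /flat s0 mulr_gt0 ?invr_gt0 ?exprn_gt0 ?expR_gt0. Qed.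

Lemma flat_eq0 n s : s <= 0 -> flat n s = 0.
Proof. by rewrite /flat ltNge => ->. Qed.

Let stepd_gt0 s : 0 < stepd s.
Proof.
rewrite /stepd; have [h|h] := ltP (1/4) s.
  by rewrite ltr_pwDl ?flat_ge0// flat_gt0// subr_gt0.
by rewrite ltr_pwDr ?flat_ge0// flat_gt0//; lra.
Qed.

Definition step s : R := flat 0 (s - 1/4) / stepd s.

Lemma smooth1_step : smooth1 step.
Proof.
have s1 : smooth1 (fun s : R => flat 0 (s - 1/4)) by apply: smooth1_shift; exact: smooth1_flat.
have s2 : smooth1 (fun s : R => flat 0 (3/4 - s)).
  have := @smooth1_comp _ (flat 0) (-1) (3/4) (@smooth1_flat R 0).
  by under eq_fun do rewrite mulN1r addrC.
apply: (smooth1M s1); apply: (smooth1V (smooth1D s1 s2)) => s.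
by rewrite gt_eqF// stepd_gt0.
Qed.

Lemma step_eq0 s : s <= 1/4 -> step s = 0.
Proof. by move=> h; rewrite /step flat_eq0 ?mul0r// subr_le0. Qed.

Lemma step_eq1 s : 3/4 <= s -> step s = 1.
Proof.
move=> h; rewrite /step /stepd (@flat_eq0 0 (3/4 - s)) ?subr_le0// addr0 divff//.
by rewrite gt_eqF// flat_gt0//; lra.
Qed.

Lemma step_ge0 s : 0 <= step s.
Proof. by rewrite /step divr_ge0 ?flat_ge0// ltW. Qed.

Lemma step_le1 s : step s <= 1.
Proof. by rewrite /step ler_pdivrMr// [leRHS]mul1r /stepd lerDl flat_ge0. Qed.

Lemma test1_dstep : test1 (derive1 step).
Proof.
split; first exact/smooth1_derive/smooth1_step.
exists 1 => s; rewrite ltr_normr => /orP[s1|s1].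
  apply: (@derive1_near_cst _ 1); near=> t; apply: step_eq1.
  apply: ltW; near: t; apply: lt_nbhsr => //; lra.
apply: (@derive1_near_cst _ 0); near=> t; apply: step_eq0; apply: ltW.
by near: t; apply: lt_nbhsl => //; lra.
Unshelve. all: by end_near. Qed.

(** The plateaus of [step] start at 1/4 and 3/4 rather than 0 and 1 so that [chi] vanishes for |s|
    >= 3/4: on its support, 0 is the only zero of 1 - cos(2 pi s). *)
Definition chi s : R := step (s + 1) - step s.

Lemma chi_ge0 s : 0 <= chi s.
Proof.
rewrite /chi; have [h|h] := lerP (3/4) (s + 1).
  by rewrite step_eq1// subr_ge0 step_le1.
by rewrite (@step_eq0 s) ?subr0 ?step_ge0//; lra.
Qed.

Lemma chi_eq0 s : 3/4 <= `|s| -> chi s = 0.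
Proof.
rewrite /chi ler_normr => /orP[h|h].
  by rewrite !step_eq1 ?subrr//; lra.
by rewrite !step_eq0 ?subrr//; lra.
Qed.

Lemma test1_chi : test1 chi.
Proof.
split.
  apply: smooth1B; last exact: smooth1_step.
  by have := @smooth1_comp _ _ 1 1 smooth1_step; under eq_fun do rewrite mul1r.
by exists (3/4) => s /ltW; exact: chi_eq0.
Qed.

Lemma derive1_chi s : derive1 chi s = derive1 step (s + 1) - derive1 step s.
Proof.
have d t := smooth1_is_derive t smooth1_step.
rewrite derive1E; apply: (@derive_val _ _ _ _ _ chi).
have h : is_derive s 1 (fun t => step (t + 1)) (derive1 step (s + 1)).
  rewrite -[derive1 step _]mulr1; apply: (@is_derive1_comp _ step (fun t => t + 1)).
  by apply: (@is_derive_eq _ _ _ (fun t => t + 1)); rewrite addr0.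
exact: (@is_deriveB _ _ _ (fun t => step (t + 1)) step s 1 _ _ h (d s)).
Qed.

(** Orthogonality of the characters of Z/M, on a grid shifted by s. Multiplied by sin(pi k/M), which
    is nonzero for 0 < |k| < M, the sum telescopes to a difference over full periods. *)
Lemma sum_cos_grid (k : int) (M : nat) s : (`|k| < M)%N ->
  \sum_(r < M) cos (2 * pi * k%:~R * (s - r%:R / M%:R)) = (k == 0)%:R * M%:R :> R.
Proof.
move=> kM; have M0 : M%:R != 0 :> R by rewrite pnatr_eq0 -lt0n (leq_trans _ kM).
have [->|k0] := eqVneq k 0.
  rewrite mulr0z mulr0 mul1r; under eq_bigr do rewrite mul0r cos0.
  by rewrite sumr_const card_ord.
rewrite mul0r.
pose b : R := 2 * pi * k%:~R / M%:R; pose a := 2 * pi * k%:~R * s.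
have sb : sin (b / 2) != 0.
  have -> : b / 2 = pi * (k%:~R / M%:R) by rewrite /b; field.
  wlog k1 : k kM k0 {a b} / 0 <= k => [hw|].
    have [/hw|k1] := lerP 0 k; first exact.
    have := hw (- k); rewrite abszN oppr_eq0 oppr_ge0 (ltW k1) => /(_ kM k0 isT).
    by rewrite mulrNz mulNr mulrN sinN oppr_eq0.
  rewrite gt_eqF// sin_gt0_pi//.
  have k2 : 0 < k by rewrite lt_neqAle eq_sym k0.
  rewrite mulr_gt0 ?pi_gt0 ?divr_gt0 ?ltr0z ?ltr0n//=; last by rewrite (leq_trans _ kM).
  rewrite gtr_pMr ?pi_gt0// ltr_pdivrMr ?ltr0n ?(leq_trans _ kM)// mul1r.
  by rewrite -[M%:R]/(M%:~R) ltr_int -(gez0_abs k1) ltz_nat.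
apply: (mulfI sb); rewrite mulr0 mulr_sumr.
pose F (r : nat) := sin (a - r%:R * b + b / 2) / 2.
rewrite (eq_bigr (fun r : 'I_M => F r - F r.+1)); last first.
  move=> r _; rewrite /F.
  have -> : 2 * pi * k%:~R * (s - r%:R / M%:R) = a - r%:R * b.
    by rewrite /a /b; field.
  have -> : a - r.+1%:R * b + b / 2 = a - r%:R * b - b / 2 by rewrite -natr1; field.
  by rewrite sinB sinD; field.
rewrite -(big_mkord xpredT (fun r => F r - F r.+1)).
under eq_bigr do rewrite -opprB.
rewrite sumrN telescope_sumr// /F mul0r subr0.
have -> : a - M%:R * b + b / 2 = a + b / 2 - 2 * pi * k%:~R by rewrite /b; field.
suff -> : forall (j : int) (x : R), sin (x - 2 * pi * j%:~R) = sin x by rewrite subrr oppr0.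
move=> {}j x; have h (n : nat) (y : R) : sin (y - 2 * pi * n%:R) = sin y.
  rewrite -{2}(subrK (2 * pi * n%:R) y).
  by rewrite -(periodicn (@sinD2pi R) n (y - _)) mulr_natr -(mulr_natl pi 2).
case: j => n; first exact: h.
rewrite NegzE mulrNz mulrN opprK -(h n.+1) /=; congr sin.
by rewrite -[n.+1%:~R]/(n.+1%:R); ring.
Qed.

(** The double sum is |sum_j exp(2 pi i j s)|^2 / (N+1): a sum of two squares, hence nonnegative,
    whose grid sums reduce to [sum_cos_grid] term by term. *)
Definition fejer (N : nat) s : R :=
  (N.+1%:R)^-1 * \sum_(j < N.+1) \sum_(l < N.+1) cos (2 * pi * (j%:Z - l%:Z)%:~R * s).

Lemma fejer_ge0 N s : 0 <= fejer N s.
Proof.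
rewrite /fejer mulr_ge0 ?invr_ge0 ?ler0n//.
have -> : \sum_(j < N.+1) \sum_(l < N.+1) cos (2 * pi * (j%:Z - l%:Z)%:~R * s) =
  (\sum_(j < N.+1) cos (2 * pi * j%:R * s)) ^+ 2 +
  (\sum_(j < N.+1) sin (2 * pi * j%:R * s)) ^+ 2 :> R.
  rewrite !expr2 !mulr_suml -big_split /=; apply: eq_bigr => j _.
  rewrite !mulr_sumr -big_split /=; apply: eq_bigr => l _.
  by rewrite -cosB intrB; congr cos; ring.
by rewrite addr_ge0 ?sqr_ge0.
Qed.

Lemma cos_int_periodic (k : int) (n : nat) (x : R) :
  cos (2 * pi * k%:~R * (x - n%:R)) = cos (2 * pi * k%:~R * x).
Proof.
have h (m : nat) (y : R) : cos (y - 2 * pi * m%:R) = cos y.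
  rewrite -{2}(subrK (2 * pi * m%:R) y).
  by rewrite -(periodicn (@cosD2pi R) m (y - _)) mulr_natr -(mulr_natl pi 2).
have h2 (m : nat) : cos (2 * pi * m%:R * (x - n%:R)) = cos (2 * pi * m%:R * x).
  by rewrite -[RHS](h (m * n)%N) natrM; congr cos; ring.
case: k => m; first exact: h2.
by rewrite NegzE mulrNz -[m.+1%:~R]/(m.+1%:R) !mulrN !mulNr !cosN.
Qed.

Lemma fejer_periodic N n s : fejer N (s - n%:R) = fejer N s.
Proof.
by rewrite /fejer; congr (_ * _); apply: eq_bigr => j _; apply: eq_bigr => l _;
   rewrite cos_int_periodic.
Qed.

(** Only the N+1 diagonal terms survive; all frequencies are at most N < M in absolute value. *)
Lemma sum_fejer N M s : (N < M)%N -> \sum_(r < M) fejer N (s - r%:R / M%:R) = M%:R.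
Proof.
move=> NM; rewrite /fejer -mulr_sumr exchange_big /=.
under eq_bigr => j _ do rewrite exchange_big /=.
rewrite (eq_bigr (fun=> M%:R));
  first by rewrite sumr_const card_ord -[M%:R *+ _]mulr_natl mulKf// pnatr_eq0.
move=> j _; rewrite (bigD1 j)//= sum_cos_grid; last by rewrite subrr; lia.
rewrite subrr eqxx mul1r big1 ?addr0// => l lj; rewrite sum_cos_grid.
  rewrite (_ : _ == 0 = false) ?mul0r//; apply/negbTE; rewrite subr_eq0; apply: contra lj.
  by rewrite eqz_nat => /eqP/val_inj ->.
by have := ltn_ord j; have := ltn_ord l; lia.
Qed.

(** The first Fourier coefficient. The extra cosine shifts frequencies by one, hence N+1 < M; the
    surviving pairs are the N with l = j+1 and the N with j = l+1, each worth M/2. *)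
Lemma sum_fejer_cos N M s : (N.+1 < M)%N ->
  \sum_(r < M) fejer N (s - r%:R / M%:R) * cos (2 * pi * (s - r%:R / M%:R)) =
  M%:R * (N%:R / N.+1%:R).
Proof.
move=> NM.
have Mn : M%:R * (N%:R / N.+1%:R) = (N.+1%:R)^-1 * (N%:R * M%:R) :> R by ring.
rewrite Mn /fejer; under eq_bigr do rewrite -[_^-1 * _ * _]mulrA mulr_suml.
rewrite -mulr_sumr exchange_big /=; congr (_ * _).
under eq_bigr => j _ do (under eq_bigr do rewrite mulr_suml; rewrite exchange_big /=).
have E (j l : 'I_N.+1) : \sum_(r < M) cos (2 * pi * (j%:Z - l%:Z)%:~R * (s - r%:R / M%:R)) *
    cos (2 * pi * (s - r%:R / M%:R)) =
    ((j.+1 == l)%:R + (l.+1 == j)%:R) * (M%:R / 2) :> R.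
  have := @sum_cos_grid (j%:Z - l%:Z + 1) M s; have := @sum_cos_grid (j%:Z - l%:Z - 1) M s.
  have h1 : (`|(j%:Z - l%:Z - 1)%R| < M)%N by have := ltn_ord j; have := ltn_ord l; lia.
  have h2 : (`|(j%:Z - l%:Z + 1)%R| < M)%N by have := ltn_ord j; have := ltn_ord l; lia.
  move=> /(_ h1) e1 /(_ h2) e2.
  have -> : (j.+1 == l) = (j%:Z - l%:Z + 1 == 0) by lia.
  have -> : (l.+1 == j) = (j%:Z - l%:Z - 1 == 0) by lia.
  rewrite [RHS](_ : _ = ((j%:Z - l%:Z + 1 == 0)%:R * M%:R +
    (j%:Z - l%:Z - 1 == 0)%:R * M%:R) / 2); last by ring.
  rewrite -e1 -e2 -big_split /= mulr_suml; apply: eq_bigr => r _.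
  have -> : (j%:Z - l%:Z + 1)%:~R = (j%:Z - l%:Z)%:~R + 1 :> R by rewrite intrD.
  have -> : (j%:Z - l%:Z - 1)%:~R = (j%:Z - l%:Z)%:~R - 1 :> R by rewrite (intrB _ _ 1).
  move: (_%:~R) (s - _) => k t.
  have -> : 2 * pi * (k + 1) * t = 2 * pi * k * t + 2 * pi * t by ring.
  have -> : 2 * pi * (k - 1) * t = 2 * pi * k * t - 2 * pi * t by ring.
  by rewrite cosD cosB; field.
under eq_bigr => j _ do under eq_bigr => l _ do rewrite E.
under eq_bigr do rewrite -mulr_suml big_split /=.
rewrite -mulr_suml big_split /= [X in _ + X]exchange_big /= -mulr2n -[_ *+ 2]mulr_natr -mulrA.
rewrite [2%:R * _]mulrC mulrVK ?unitfE ?pnatr_eq0//; congr (_ * _).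
rewrite (eq_bigr (fun j : 'I_N.+1 => (j < N)%N%:R)); last first.
  move=> j _; have [jN|jN] := ltnP j N.
    rewrite (bigD1 (Ordinal (jN : j.+1 < N.+1)%N))//= eqxx big1 ?addr0// => l lj.
    rewrite (_ : _ == _ = false)//; apply/negbTE; apply: contra lj => /eqP e.
    by apply/eqP/val_inj; rewrite /= e.
  rewrite big1// => l _; rewrite (_ : _ == _ = false)//; have := ltn_ord l; lia.
rewrite big_ord_recr /= ltnn addr0 (eq_bigr (fun=> 1)) ?sumr_const ?card_ord//.
by move=> j _; rewrite ltn_ord.
Qed.

Lemma big_ord_muln (F : nat -> R) (a b : nat) :
  \sum_(q < a * b) F q = \sum_(m < a) \sum_(r < b) F (m * b + r)%N.
Proof.
elim: a => [|a IH]; first by rewrite mul0n !big_ord0.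
rewrite big_ord_recr /= -IH mulSnr -(big_mkord xpredT F) (big_cat_nat _ (n := (a * b)%N))//=;
  last first.
  by rewrite leq_addr.
rewrite big_mkord; congr (_ + _).
by rewrite -{1}[(a * b)%N]add0n big_addn addKn big_mkord; apply: eq_bigr => r _; rewrite addnC.
Qed.

Definition gpt (L M q : nat) : R := - L%:R + q%:R / M%:R.

(** With q = m M + r, the sum over m runs over unit translates of [chi] and telescopes. The bound
    |s| <= L - 1 puts both ends on the plateaus of [step]. *)
Lemma sum_chi_periodic P L M s : (0 < M)%N -> `|s| <= L%:R - 1 ->
  (forall n t, P (t - n%:R) = P t) ->
  \sum_(q < (2 * L) * M) chi (s - gpt L M q) * P (s - gpt L M q) =
  \sum_(r < M) P (s - r%:R / M%:R).
Proof.
move=> M0 sL Pper; have MM : M%:R != 0 :> R by rewrite pnatr_eq0 -lt0n.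
rewrite (big_ord_muln (fun q => chi (s - gpt L M q) * P (s - gpt L M q))) exchange_big /=.
apply: eq_bigr => r _; pose s' : R := s + L%:R - r%:R / M%:R.
have E (m : nat) : s - gpt L M (m * M + r)%N = s' - m%:R.
  by rewrite /gpt /s' natrD natrM; field.
under eq_bigr => m _ do rewrite E Pper.
have -> : P s' = P (s - r%:R / M%:R).
  by rewrite -(Pper L) /s'; congr P; ring.
rewrite -mulr_suml -[RHS]mul1r; congr (_ * _).
rewrite (eq_bigr (fun m : 'I_(2 * L) => step (s' + 1 - m%:R) - step (s' + 1 - m.+1%:R)));
  last first.
  by move=> m _; rewrite /chi -natr1; congr (step _ - step _); ring.
rewrite -(big_mkord xpredT (fun m => step (s' + 1 - m%:R) - step (s' + 1 - m.+1%:R))).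
under eq_bigr do rewrite -opprB.
rewrite sumrN (telescope_sumr (fun m => step (s' + 1 - m%:R)))// opprB subr0.
have /andP[l1 l2] : 0 <= (r%:R / M%:R : R) <= 1.
  rewrite divr_ge0//= ler_pdivrMr ?ltr0n// mul1r ler_nat ltnW//.
move: sL; rewrite ler_norml => /andP[sL1 sL2].
rewrite step_eq1 ?step_eq0 ?subr0// /s' ?natrM; lra.
Qed.

(* [chi] localizes the periodic kernel without changing its sums over a grid of step 1/M. *)
Definition kern N s := chi s * fejer N s.

Lemma kern_ge0 N s : 0 <= kern N s.
Proof. by rewrite mulr_ge0 ?chi_ge0 ?fejer_ge0. Qed.

Lemma kern_eq0 N s : 3/4 <= `|s| -> kern N s = 0.
Proof. by move=> h; rewrite /kern chi_eq0// mul0r. Qed.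

Lemma kern_mass N L M s : (N < M)%N -> `|s| <= L%:R - 1 ->
  M%:R^-1 * \sum_(q < (2 * L) * M) kern N (s - gpt L M q) = 1.
Proof.
move=> NM sL; rewrite sum_chi_periodic// ?(leq_trans _ NM)//;
  last by move=> *; exact: fejer_periodic.
by rewrite sum_fejer// mulVf// pnatr_eq0 -lt0n (leq_trans _ NM).
Qed.

(* Korovkin's argument: the moment against [1 - cos (2 * pi * s)], which controls the
   distance to 0 on the support of [chi], is explicit and of order 1/N. *)
Lemma kern_concentrated (e : R) : 0 < e -> exists N0 : nat,
  forall N L M s, (N0 <= N)%N -> (N.+1 < M)%N -> `|s| <= L%:R - 1 ->
  M%:R^-1 * \sum_(q < (2 * L) * M) `|s - gpt L M q| * kern N (s - gpt L M q) <= e.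
Proof.
move=> e0; pose d := e / 2; have d0 : 0 < d by rewrite divr_gt0.
(* A positive lower bound of 1 - cos(2 pi t) on the part of the support of [chi] away from 0; it
   exists because 3/4 < 1. *)
have [c c0 hc] : exists2 c : R, 0 < c & forall t, d <= `|t| -> `|t| <= 3/4 ->
    c <= 1 - cos (2 * pi * t).
  have [d1|d1] := lerP d (3/4); last first.
    by exists 1 => // t h1 h2; have := le_trans h1 h2; rewrite leNgt d1.
  have cc : {within `[d, 3/4], continuous (fun t : R => 1 - cos (2 * pi * t))}.
    apply: continuous_subspaceT => t.
    apply: cvgB; first exact: cvg_cst.
    apply: continuous_comp; last exact: continuous_cos.
    by apply: cvgM; [exact: cvg_cst|exact: cvg_id].
  have [t0 t0I tmin] := EVT_min d1 cc.
  exists (1 - cos (2 * pi * t0)).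
    move: t0I; rewrite in_itv /= => /andP[t01 t02].
    have -> : 2 * pi * t0 = (pi * t0) *+ 2 by ring.
    rewrite cos_mulr2n cos2sin2.
    have s0 : 0 < sin (pi * t0).
      apply: sin_gt0_pi; have p0 := @pi_gt0 R; rewrite mulr_gt0//=; last exact: lt_le_trans t01.
      by rewrite gtr_pMr//; lra.
    have := mulr_gt0 s0 s0; rewrite expr2; lra.
  move=> t h1 h2; have := tmin `|t|; rewrite in_itv /= h1 h2 => /(_ isT).
  suff -> : cos (2 * pi * `|t|) = cos (2 * pi * t) by [].
  rewrite -[RHS]cos_norm normrM ger0_norm//.
  by rewrite mulr_ge0// pi_ge0.
have ec : 0 < e * c by rewrite mulr_gt0.
(* This [N0] makes 1/(c (N+1)), the excess left by [sum_fejer_cos], at most e/2. *)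
exists (Num.truncn (2 / (e * c))).+1 => N L M s N0 NM sL.
have M0 : 0 < M%:R :> R by rewrite ltr0n; lia.
have NN : 0 < N.+1%:R :> R by rewrite ltr0n.
(* On the support of [chi], |t| <= d + (1 - cos(2 pi t))/c. The bound is written as [chi] times a
   periodic function so that [sum_chi_periodic] applies. *)
apply: (@le_trans _ _ (M%:R^-1 * \sum_(q < (2 * L) * M)
   chi (s - gpt L M q) * ((d + c^-1) * fejer N (s - gpt L M q) -
     c^-1 * (fejer N (s - gpt L M q) * cos (2 * pi * (s - gpt L M q)))))).
  apply: ler_wpM2l; first by rewrite invr_ge0 ltW.
  apply: ler_sum => q _; move: (s - _) => t.
  have [h|h] := lerP (3/4) `|t|; first by rewrite kern_eq0// chi_eq0// mul0r mulr0.
  have -> : chi t * ((d + c^-1) * fejer N t - c^-1 * (fejer N t * cos (2 * pi * t))) =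
     (d + c^-1 * (1 - cos (2 * pi * t))) * kern N t by rewrite /kern; ring.
  apply: ler_wpM2r; first exact: kern_ge0.
  have c1 : 0 <= 1 - cos (2 * pi * t) by rewrite subr_ge0 cos_le1.
  have [h1|h1] := lerP `|t| d.
    by apply: le_trans h1 _; rewrite lerDl mulr_ge0// invr_ge0 ltW.
  have : 1 <= c^-1 * (1 - cos (2 * pi * t)).
    by rewrite ler_pdivlMl// mulr1; apply: hc; exact: ltW.
  by lra.
rewrite (sum_chi_periodic (P := fun t => (d + c^-1) * fejer N t -
     c^-1 * (fejer N t * cos (2 * pi * t))))//; first last.
- move=> n t; rewrite fejer_periodic; congr (_ - _ * (_ * _)).
  by have := cos_int_periodic 1 n t; rewrite mulr1.
- by lia.
rewrite sumrB -[X in X - _]mulr_sumr -[X in _ - X]mulr_sumr sum_fejer_cos// sum_fejer; last by lia.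
have -> : M%:R^-1 * ((d + c^-1) * M%:R - c^-1 * (M%:R * (N%:R / N.+1%:R))) =
  d + (c * N.+1%:R)^-1 :> R.
  rewrite -natr1; field; rewrite natr1 !gt_eqF//.
have -> : e = d + e / 2 by rewrite /d; field.
rewrite lerD2l -[leRHS]invrK lef_pV2 ?posrE ?invr_gt0 ?mulr_gt0 ?divr_gt0//.
rewrite invf_div -ler_pdivrMl// mulrC -mulrA -invfM.
have h := @truncnS_gt R (2 / (e * c)).
apply: le_trans (ltW h) _; rewrite ler_nat; exact: leqW.
Qed.

Lemma test1_kern N : test1 (kern N).
Proof.
apply: test1M; first exact: test1_chi.
apply: smooth1M; first exact: smooth1_cst.
have hsum n (F : 'I_n -> R -> R) : (forall i, smooth1 (F i)) ->
  smooth1 (fun s => \sum_(i < n) F i s).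
  elim: n F => [|n IH] F sF.
    by under eq_fun do rewrite big_ord0; exact: smooth1_cst.
  under eq_fun do rewrite big_ord_recr /=.
  by apply: smooth1D => //; exact: IH.
have h (j l : nat) : smooth1 (fun s : R => cos (2 * pi * (j%:Z - l%:Z)%:~R * s)).
  have := @smooth1_comp _ cos (2 * pi * (j%:Z - l%:Z)%:~R) 0 (@smooth1_cos R).
  by under eq_fun do rewrite addr0.
apply: (hsum _ (fun (j : 'I_N.+1) s => \sum_(l < N.+1) cos (2 * pi * (j%:Z - l%:Z)%:~R * s))) => j.
exact: (hsum _ (fun (l : 'I_N.+1) s => cos (2 * pi * (j%:Z - l%:Z)%:~R * s))).
Qed.

End Kernel.

(** * Smooth functions of several variables *)

Section Calculus.
Variable R : realType.

Lemma rV_norm_coord n (z : 'rV[R]_n) i : `|z 0 i| <= `|z|.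
Proof.
rewrite [X in _ <= X]mx_normrE.
exact: (@le_bigmax _ _ _ 0 (fun k : 'I_1 * 'I_n => `|z k.1 k.2|) (0, i)).
Qed.

Lemma rV_norm_le n (z : 'rV[R]_n) C : 0 <= C -> (forall i, `|z 0 i| <= C) -> `|z| <= C.
Proof.
move=> C0 h; rewrite [X in X <= _]mx_normrE; apply/bigmax_leP; split=> // -[k i] _ /=.
by rewrite ord1.
Qed.

Lemma rV_continuous (T : topologicalType) n (g : T -> 'rV[R]_n) :
  (forall i, continuous (fun x => g x 0 i)) -> continuous g.
Proof.
move=> gc x; apply/cvgrPdist_le => e e0.
have : \forall t \near x, forall i, `|g x 0 i - g t 0 i| <= e.
  apply: filter_forall => i; have /cvgrPdist_le := gc i x; exact.
apply: filterS => t h; apply: rV_norm_le; first exact: ltW.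
by move=> i; rewrite !mxE.
Qed.

Lemma add_continuous (T : topologicalType) (f g : T -> R) :
  continuous f -> continuous g -> continuous (fun x => f x + g x).
Proof. by move=> fc gc x; apply: cvgD; [exact: fc|exact: gc]. Qed.

Lemma mul_continuous (T : topologicalType) (f g : T -> R) :
  continuous f -> continuous g -> continuous (fun x => f x * g x).
Proof. by move=> fc gc x; apply: cvgM; [exact: fc|exact: gc]. Qed.

Lemma cvg_sumr (T : Type) (F : set_system T) (FF : Filter F) (I : Type) (r : seq I)
    (f : I -> T -> R) (l : I -> R) : (forall i, f i x @[x --> F] --> l i) ->
  \sum_(i <- r) f i x @[x --> F] --> \sum_(i <- r) l i.
Proof.
move=> fl; elim: r => [|i r IH].
  by under eq_fun do rewrite big_nil; rewrite big_nil; exact: cvg_cst.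
by under eq_fun do rewrite big_cons; rewrite big_cons; exact: cvgD.
Qed.

Lemma sum_continuous (T : topologicalType) (I : Type) (r : seq I) (F : I -> T -> R) :
  (forall i, continuous (F i)) -> continuous (fun x => \sum_(i <- r) F i x).
Proof.
move=> Fc; elim: r => [|i r IH].
  by under eq_fun do rewrite big_nil; exact: cst_continuous.
under eq_fun do rewrite big_cons.
by move=> x; apply: cvgD; [exact: Fc|exact: IH].
Qed.

Lemma affine_continuous n m (c : 'rV[R]_m) (B : 'M[R]_(n, m)) :
  continuous (fun z : 'rV[R]_n => c + z *m B).
Proof.
apply: rV_continuous => i.
have -> : (fun z : 'rV[R]_n => (c + z *m B) 0 i) = (fun z => c 0 i + \sum_j z 0 j * B j i).
  by apply/funext => z; rewrite !mxE.
apply: add_continuous; first exact: cst_continuous.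
apply: sum_continuous => j; apply: mul_continuous; last exact: cst_continuous.
exact: coord_continuous.
Qed.

Lemma is_deriveE (V : normedModType R) (f : V -> R) x v df :
  is_derive x v f df -> 'D_v f x = df.
Proof. by case. Qed.

Lemma is_derive_line n (f : 'rV[R]_n -> R) x v df :
  is_derive (0 : R) 1 (fun h : R => f (x + h *: v)) df -> is_derive x v f df.
Proof.
have E : (fun h : R => h^-1 *: (((fun h : R => f (x + h *: v)) \o shift 0) (h *: 1) -
  f (x + (0 : R) *: v)))
  = (fun h => h^-1 *: ((f \o shift x) (h *: v) - f x)).
  apply/funext => h /=; rewrite addr0 scale0r addr0 [h%:A]mulr1; congr (_ *: (f _ - _)).
  by rewrite addrC.
by move=> d; have [] := d; rewrite /derivable /derive E => fd <-; exact: DeriveDef.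
Qed.

Lemma derive_line n (f : 'rV[R]_n -> R) x v (t : R) :
  derivable f (x + t *: v) v ->
  is_derive t 1 (fun h : R => f (x + h *: v)) ('D_v f (x + t *: v)).
Proof.
move=> fd.
have E : (fun h : R => h^-1 *: (((fun h : R => f (x + h *: v)) \o shift t) (h *: 1) -
  f (x + t *: v)))
  = (fun h => h^-1 *: ((f \o shift (x + t *: v)) (h *: v) - f (x + t *: v))).
  apply/funext => h /=; rewrite [h%:A]mulr1; congr (_ *: (f _ - _)).
  by rewrite scalerDl addrCA.
apply: DeriveDef; first by rewrite /derivable E.
by rewrite /derive E.
Qed.

(** The increment [s] may have either sign, because the [th] returned by one use is fed into the
    next; hence only |th| is controlled. *)
Lemma mvt_line n (f : 'rV[R]_n -> R) z v s : (forall x, derivable f x v) ->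
  exists2 th, `|th| <= `|s| & f (z + s *: v) - f z = s * 'D_v f (z + th *: v).
Proof.
move=> fd; pose g (h : R) := f (z + h *: v); pose dg (h : R) := 'D_v f (z + h *: v).
have gd (h : R) : is_derive h 1 g (dg h) by exact: derive_line.
have gc a b : {within `[a, b], continuous g}.
  apply: continuous_subspaceT => h; apply/differentiable_continuous/derivable1_diffP.
  by have [] := gd h.
have [s0|/ltW s0] := lerP 0 s.
  have [c cI E] := @MVT_segment R g dg 0 s s0 (fun x _ => gd x) (gc _ _).
  exists c; last by move: E; rewrite /g scale0r addr0 subr0 mulrC.
  by move: cI; rewrite in_itv /= => /andP[c0 cs]; rewrite !ger0_norm.
have [c cI E] := @MVT_segment R g dg s 0 s0 (fun x _ => gd x) (gc _ _).
exists c; first by move: cI; rewrite in_itv /= => /andP[c0 cs]; rewrite !ler0_norm// lerN2.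
by move: E; rewrite /g scale0r addr0 sub0r -opprB mulrN => /oppr_inj ->; rewrite mulrC.
Qed.

Lemma ebasis_norm n (i : 'I_n) : `|ebasis R i| <= 1.
Proof.
apply: rV_norm_le => // j; rewrite /ebasis mxE eqxx /=.
by case: (j == i); rewrite ?normr1 ?normr0.
Qed.

(** The increment is split along a staircase: [p k] keeps the first k coordinates of v, the mean
    value theorem applies on each edge, and continuity of the partial derivatives brings the
    intermediate points back to x. *)
Lemma is_derive_dir n (f : 'rV[R]_n -> R) x v :
  (forall i y, derivable f y (ebasis R i)) ->
  (forall i, continuous (fun y => 'D_(ebasis R i) f y)) ->
  is_derive x v f (\sum_i v 0 i * 'D_(ebasis R i) f x).
Proof.
move=> fd fc.
pose p (k : nat) : 'rV[R]_n := \row_i (if (i < k)%N then v 0 i else 0).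
have pS (i : 'I_n) : p i.+1 = p i + v 0 i *: ebasis R i.
  apply/rowP => j; rewrite !mxE eqxx /= ltnS leq_eqVlt.
  have [->|ji] := eqVneq j i; first by rewrite eqxx ltnn mulr1 add0r.
  by rewrite (_ : (j == i :> nat) = false) ?mulr0 ?addr0//; apply/negbTE.
have p0 : p 0 = 0 by apply/rowP => j; rewrite !mxE ltn0.
have pn : p n = v by apply/rowP => j; rewrite !mxE ltn_ord.
have mv h (i : 'I_n) : exists th : R, `|th| <= `|h * v 0 i| /\
   f (x + h *: p i.+1) - f (x + h *: p i) =
   h * v 0 i * 'D_(ebasis R i) f (x + h *: p i + th *: ebasis R i).
  have [th h1 h2] := @mvt_line n f (x + h *: p i) (ebasis R i) (h * v 0 i) (fd i).
  by exists th; split=> //; rewrite -h2 pS scalerDr scalerA addrA.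
pose th h i := sval (cid (mv h i)).
have thP h i := svalP (cid (mv h i)).
apply: is_derive_line.
suff L : (fun h : R => h^-1 *: (((fun h : R => f (x + h *: v)) \o shift 0) (h *: 1) -
  f (x + (0 : R) *: v))) @ 0^'
    --> \sum_i v 0 i * 'D_(ebasis R i) f x.
  by apply: DeriveDef; [apply/cvg_ex; eexists; exact: L|exact: cvg_lim L].
have E : {near 0^', (fun h : R =>
  \sum_i v 0 i * 'D_(ebasis R i) f (x + h *: p i + th h i *: ebasis R i)) =1
  (fun h : R => h^-1 *: (((fun h : R => f (x + h *: v)) \o shift 0) (h *: 1) -
    f (x + (0 : R) *: v)))}.
  near=> h; have h0 : h != 0 by near: h; exact: nbhs_dnbhs_neq.
  have T : f (x + h *: v) - f (x + (0 : R) *: v) =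
    \sum_(i < n) (f (x + h *: p i.+1) - f (x + h *: p i)).
    rewrite -(big_mkord xpredT (fun i => f (x + h *: p i.+1) - f (x + h *: p i))).
    by rewrite (telescope_sumr (fun i => f (x + h *: p i)))// p0 pn scaler0 scale0r.
  rewrite /= addr0 [h%:A]mulr1 T /GRing.scale /= mulr_sumr; apply: eq_bigr => i _.
  by rewrite (thP h i).2 mulrA mulKf.
apply: cvg_trans; first by apply: near_eq_cvg; exact: E.
have main i : (fun h : R => v 0 i * 'D_(ebasis R i) f (x + h *: p i + th h i *: ebasis R i)) @ 0^'
   --> v 0 i * 'D_(ebasis R i) f x.
  apply: cvgM; first exact: cvg_cst.
  have w : (fun h : R => x + h *: p i + th h i *: ebasis R i) @ 0^' --> x.
    apply/cvgrPdist_le => e e0; near=> h.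
    rewrite -addrA opprD addNKr normrN.
    have C0 : 0 < `|p i| + `|v 0 i| + 1 by rewrite ltr_wpDl// addr_ge0.
    apply: (@le_trans _ _ (`|h| * (`|p i| + `|v 0 i| + 1))).
      apply: le_trans (ler_normD _ _) _; rewrite -addrA mulrDr lerD//.
        by rewrite normrZ.
      rewrite normrZ; apply: le_trans (ler_wpM2l (normr_ge0 _) (ebasis_norm i)) _.
      rewrite mulr1; apply: le_trans (thP h i).1 _.
      by rewrite normrM ler_wpM2l// lerDl.
    rewrite -ler_pdivlMr//; near: h; apply: dnbhs0_le.
    by rewrite divr_gt0.
  exact: (cvg_comp _ _ w (fc i x)).
exact: cvg_sumr.
Unshelve. all: by end_near. Qed.

(** The last index of the list acts first, so induction from the right lets the Leibniz and chain
    rules act on the function itself before the other derivatives. *)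
Lemma pder_rcons n (s : seq 'I_n) i (f : 'rV[R]_n -> R) :
  pder (rcons s i) f = pder s (pder [:: i] f).
Proof. by elim: s => //= j s ->. Qed.

Lemma pder_cat n (s1 s2 : seq 'I_n) (f : 'rV[R]_n -> R) :
  pder (s1 ++ s2) f = pder s1 (pder s2 f).
Proof. by elim: s1 => //= j s ->. Qed.

Lemma smooth_pder n s (f : 'rV[R]_n -> R) : smooth f -> smooth (pder s f).
Proof. by move=> sf s'; rewrite -pder_cat; exact: sf. Qed.

Lemma smooth_is_derive n (f : 'rV[R]_n -> R) x i : smooth f ->
  is_derive x (ebasis R i) f (pder [:: i] f x).
Proof. by move=> /(_ [::])[_ fd]; exact/derivableP. Qed.

Lemma smooth_continuous n (f : 'rV[R]_n -> R) : smooth f -> continuous f.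
Proof. by move=> /(_ [::])[]. Qed.

Lemma smooth_is_derive_dir n (f : 'rV[R]_n -> R) x v : smooth f ->
  is_derive x v f (\sum_i v 0 i * pder [:: i] f x).
Proof.
move=> sf; apply: is_derive_dir.
  by move=> i y; have [_ fd] := sf [::]; exact: fd.
by move=> i; have [] := sf [:: i].
Qed.

Lemma derive1_cos : derive1 (@cos R) = (fun x => - sin x).
Proof. by apply/funext => x; rewrite derive1E; apply: is_deriveE. Qed.

Lemma derive1_sin : derive1 (@sin R) = cos.
Proof. by apply/funext => x; rewrite derive1E; apply: is_deriveE. Qed.

Lemma smooth_coind n (S : ('rV[R]_n -> R) -> Prop) :
  (forall f, S f -> continuous f /\ forall i, exists2 g, S g &
     forall x, is_derive x (ebasis R i) f (g x)) ->
  forall f, S f -> smooth f.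
Proof.
move=> dS f Sf s; suff: S (pder s f).
  by move=> /dS[fc fd]; split=> // x i; have [g _ /(_ x)[]] := fd i.
elim: s => //= i s /dS[_ /(_ i)[g Sg dg]].
suff -> : (fun x => 'D_(ebasis R i) (pder s f) x) = g by [].
by apply/funext => x; have [_ ->] := dg x.
Qed.

(** Again a class stable under derivation. The affine and ridge constructors carry the chain rule:
    their derivatives are derivatives composed with the same map, weighted by matrix entries. *)
Inductive smooth_alg n : ('rV[R]_n -> R) -> Prop :=
| Alg_base f of smooth f : smooth_alg f
| Alg_cst (c : R) : smooth_alg (fun=> c)
| Alg_affine m f (c : 'rV[R]_m) (B : 'M[R]_(n, m)) of smooth f :
    smooth_alg (fun z => f (c + z *m B))
| Alg_ridge phi (w : 'cV[R]_n) of smooth1 phi : smooth_alg (fun z => phi ((z *m w) 0 0))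
| Alg_add f g of smooth_alg f & smooth_alg g : smooth_alg (fun z => f z + g z)
| Alg_mul f g of smooth_alg f & smooth_alg g : smooth_alg (fun z => f z * g z).

Lemma ebasis_mul n m (i : 'I_n) (B : 'M[R]_(n, m)) : ebasis R i *m B = row i B.
Proof. by rewrite /ebasis -rowE. Qed.

Lemma is_derive_affine n m (f : 'rV[R]_m -> R) (c : 'rV[R]_m) (B : 'M[R]_(n, m)) x i :
  smooth f ->
  is_derive x (ebasis R i) (fun z => f (c + z *m B)) (\sum_j B i j * pder [:: j] f (c + x *m B)).
Proof.
move=> sf; apply: is_derive_line.
have -> : (fun h : R => f (c + (x + h *: ebasis R i) *m B)) =
   (fun h : R => f ((c + x *m B) + h *: row i B)).
  by apply/funext => h; rewrite mulmxDl -scalemxAl ebasis_mul addrA.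
have d := @smooth_is_derive_dir m f (c + x *m B + 0 *: row i B) (row i B) sf.
apply: is_derive_eq; first by apply: derive_line; case: d.
rewrite (is_deriveE (d)) scale0r addr0.
by apply: eq_bigr => j _; rewrite mxE.
Qed.

Lemma is_derive_ridge n (phi : R -> R) (w : 'cV[R]_n) x i : smooth1 phi ->
  is_derive x (ebasis R i) (fun z => phi ((z *m w) 0 0)) (derive1 phi ((x *m w) 0 0) * w i 0).
Proof.
move=> sphi; apply: is_derive_line.
have -> : (fun h : R => phi (((x + h *: ebasis R i) *m w) 0 0)) =
   (fun h : R => phi ((x *m w) 0 0 + h * w i 0)).
  apply/funext => h; congr phi.
  by rewrite mulmxDl -scalemxAl ebasis_mul !mxE.
apply: (@is_derive1_comp _ phi (fun h : R => (x *m w) 0 0 + h * w i 0)).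
  by rewrite mul0r addr0; exact: smooth1_is_derive.
apply: (@is_derive_eq _ _ _ (fun h : R => (x *m w) 0 0 + h * w i 0)).
by rewrite /GRing.scale /=; ring.
Qed.

Lemma smooth_algP n (f : 'rV[R]_n -> R) : smooth_alg f -> smooth f.
Proof.
have Ssum (I : Type) (r : seq I) (F : I -> 'rV[R]_n -> R) :
    (forall i, smooth_alg (F i)) -> smooth_alg (fun z => \sum_(i <- r) F i z).
  move=> SF; elim: r => [|i r IH].
    by under eq_fun do rewrite big_nil; exact: Alg_cst.
  under eq_fun do rewrite big_cons; exact: Alg_add.
move: f; apply: smooth_coind => f; elim=> {f}.
- move=> f sf; split; first exact: smooth_continuous.
  move=> i; exists (pder [:: i] f); first exact/Alg_base/smooth_pder.
  by move=> x; exact: smooth_is_derive.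
- move=> c; split; first exact: cst_continuous.
  by move=> i; exists (fun=> 0); [exact: Alg_cst|move=> x; exact: is_derive_cst].
- move=> m f c B sf; split.
    move=> z; apply: (@continuous_comp 'rV[R]_n 'rV[R]_m R (fun z => c + z *m B) f).
      exact: affine_continuous.
    exact: smooth_continuous.
  move=> i; exists (fun z => \sum_j B i j * pder [:: j] f (c + z *m B)).
    apply: Ssum => j; apply: Alg_mul; first exact: Alg_cst.
    exact/(Alg_affine (f := pder [:: j] f))/smooth_pder.
  by move=> x; exact: is_derive_affine.
- move=> phi w sphi; split.
    move=> z; apply: (@continuous_comp _ _ _ (fun z : 'rV[R]_n => (z *m w) 0 0) phi).
      have -> : (fun z : 'rV[R]_n => (z *m w) 0 0) = (fun z => (0 + z *m w) 0 0).
        by apply/funext => y; rewrite add0r.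
      apply: (@continuous_comp 'rV[R]_n 'rV[R]_1 R (fun z => 0 + z *m w) (fun y => y 0 0));
        first exact: affine_continuous.
      exact: coord_continuous.
    exact: smooth1_continuous.
  move=> i; exists (fun z => derive1 phi ((z *m w) 0 0) * w i 0).
    apply: Alg_mul; last exact: Alg_cst.
    exact/(Alg_ridge (phi := derive1 phi))/smooth1_derive.
  by move=> x; exact: is_derive_ridge.
- move=> f g Sf [fc fd] Sg [gc gd]; split.
    exact: add_continuous.
  move=> i; have [f' Sf' df] := fd i; have [g' Sg' dg] := gd i.
  exists (fun s => f' s + g' s); first exact: Alg_add.
  by move=> x; exact: (@is_deriveD _ _ _ f g).
- move=> f g Sf [fc fd] Sg [gc gd]; split.
    exact: mul_continuous.
  move=> i; have [f' Sf' df] := fd i; have [g' Sg' dg] := gd i.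
  exists (fun s => f s * g' s + g s * f' s).
    by apply: Alg_add; apply: Alg_mul.
  by move=> x; exact: (@is_deriveM _ _ f g).
Qed.

Lemma smooth_cst n (c : R) : smooth (fun _ : 'rV[R]_n => c).
Proof. exact/smooth_algP/Alg_cst. Qed.

Lemma smooth_affine n m f (c : 'rV[R]_m) (B : 'M[R]_(n, m)) :
  smooth f -> smooth (fun z => f (c + z *m B)).
Proof. by move=> sf; exact/smooth_algP/Alg_affine. Qed.

Lemma smooth_ridge n phi (w : 'cV[R]_n) :
  smooth1 phi -> smooth (fun z => phi ((z *m w) 0 0)).
Proof. by move=> sf; exact/smooth_algP/Alg_ridge. Qed.

Lemma smoothD n (f g : 'rV[R]_n -> R) :
  smooth f -> smooth g -> smooth (fun z => f z + g z).
Proof. by move=> sf sg; apply/smooth_algP/Alg_add; exact: Alg_base. Qed.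

Lemma smoothM n (f g : 'rV[R]_n -> R) :
  smooth f -> smooth g -> smooth (fun z => f z * g z).
Proof. by move=> sf sg; apply/smooth_algP/Alg_mul; exact: Alg_base. Qed.

Lemma smoothZ n a (f : 'rV[R]_n -> R) : smooth f -> smooth (fun z => a * f z).
Proof. by move=> sf; exact: (smoothM (@smooth_cst n a) sf). Qed.

Lemma smooth_sum n (I : Type) (r : seq I) (F : I -> 'rV[R]_n -> R) :
  (forall i, smooth (F i)) -> smooth (fun z => \sum_(i <- r) F i z).
Proof.
move=> SF; elim: r => [|i r IH].
  by under eq_fun do rewrite big_nil; exact: smooth_cst.
by under eq_fun do rewrite big_cons; exact: smoothD.
Qed.

Lemma pder1D n i (f g : 'rV[R]_n -> R) : smooth f -> smooth g ->
  pder [:: i] (fun z => f z + g z) = (fun z => pder [:: i] f z + pder [:: i] g z).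
Proof.
move=> sf sg; apply/funext => x.
have df := smooth_is_derive x i sf; have dg := smooth_is_derive x i sg.
exact: (is_deriveE (@is_deriveD _ _ _ f g x _ _ _ df dg)).
Qed.

Lemma pder1M n i (f g : 'rV[R]_n -> R) : smooth f -> smooth g ->
  pder [:: i] (fun z => f z * g z) = (fun z => pder [:: i] f z * g z + f z * pder [:: i] g z).
Proof.
move=> sf sg; apply/funext => x.
have df := smooth_is_derive x i sf; have dg := smooth_is_derive x i sg.
rewrite -[LHS]/('D_(ebasis R i) (f * g) x).
rewrite (is_deriveE (@is_deriveM _ _ f g x _ _ _ df dg)) addrC /GRing.scale /=.
by rewrite mulrC.
Qed.

Lemma pder1_affine n m i (f : 'rV[R]_m -> R) (c : 'rV[R]_m) (B : 'M[R]_(n, m)) : smooth f ->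
  pder [:: i] (fun z => f (c + z *m B)) =
  (fun z => \sum_j B i j * pder [:: j] f (c + z *m B)).
Proof.
move=> sf; apply/funext => x.
exact: (is_deriveE (@is_derive_affine _ _ f c B x i sf)).
Qed.

Lemma pder1_ridge n i phi (w : 'cV[R]_n) : smooth1 phi ->
  pder [:: i] (fun z => phi ((z *m w) 0 0)) = (fun z => w i 0 * derive1 phi ((z *m w) 0 0)).
Proof.
move=> sf; apply/funext => x; rewrite mulrC.
exact: (is_deriveE (@is_derive_ridge _ phi w x i sf)).
Qed.

Lemma pder_cst n i s c : pder (rcons s i) (fun _ : 'rV[R]_n => c) = (fun=> 0).
Proof.
have h j c' : pder [:: j] (fun _ : 'rV[R]_n => c') = (fun=> 0).
  by apply/funext => x; exact: derive_cst.
rewrite pder_rcons h; elim: s => //= j s ->; exact: (h j 0).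
Qed.

Lemma pderD n s (f g : 'rV[R]_n -> R) : smooth f -> smooth g ->
  pder s (fun z => f z + g z) = (fun z => pder s f z + pder s g z).
Proof.
move=> sf sg; elim: s => //= i s ->.
exact: (@pder1D n i (pder s f) (pder s g) (smooth_pder s sf) (smooth_pder s sg)).
Qed.

Lemma pderZ n s a (f : 'rV[R]_n -> R) : smooth f ->
  pder s (fun z => a * f z) = (fun z => a * pder s f z).
Proof.
move=> sf; elim: s => //= i s ->.
rewrite -[LHS]/(pder [:: i] (fun z => a * pder s f z)) pder1M;
  [|exact: smooth_cst|exact: smooth_pder].
by apply/funext => x; rewrite (@pder_cst n i [::] a) mul0r add0r.
Qed.

Lemma pder_sum n s (I : Type) (r : seq I) (F : I -> 'rV[R]_n -> R) :
  (forall i, smooth (F i)) ->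
  pder s (fun z => \sum_(i <- r) F i z) = (fun z => \sum_(i <- r) pder s (F i) z).
Proof.
move=> SF; elim: r => [|i r IH].
  transitivity (pder s (fun _ : 'rV[R]_n => 0 : R)).
    by congr pder; apply/funext => z; rewrite big_nil.
  apply/funext => z; rewrite big_nil; case/lastP: s => // s i.
  by rewrite pder_cst.
transitivity (pder s (fun z => F i z + \sum_(i <- r) F i z)).
  by congr pder; apply/funext => z; rewrite big_cons.
rewrite pderD ?IH//; last exact: smooth_sum.
by apply/funext => z; rewrite big_cons.
Qed.

Lemma pder_shift n s (f : 'rV[R]_n -> R) c : smooth f ->
  pder s (fun z => f (z + c)) = (fun z => pder s f (z + c)).
Proof.
move=> sf; elim: s => //= i s ->; apply/funext => x.
have sg := smooth_pder s sf.
have h : (fun z => pder s f (z + c)) = (fun z => pder s f (c + z *m 1%:M)).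
  by apply/funext => z; rewrite mulmx1 addrC.
rewrite h -[LHS]/(pder [:: i] (fun z => pder s f (c + z *m 1%:M)) x) pder1_affine//.
rewrite (bigD1 i)//= mxE eqxx mul1r big1 ?addr0 ?mulmx1 1?addrC// => j ji.
by rewrite mxE eq_sym (negbTE ji) mul0r.
Qed.

Lemma smooth_shift n (f : 'rV[R]_n -> R) c : smooth f -> smooth (fun z => f (z + c)).
Proof.
move=> /(@smooth_affine n n f c 1%:M).
by under eq_fun do rewrite mulmx1 addrC.
Qed.

End Calculus.

(** * Test functions and distributions *)

Section TestFunctions.
Variable R : realType.
Local Notation C := (complex R).

(** Bounded support with an explicit radius for the sup norm: derivation preserves the radius, and a
    single one can serve a whole sequence. *)
Definition bsupp n (r : R) (f : 'rV[R]_n -> R) := forall z, r < `|z| -> f z = 0.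

Lemma bsupp_fsupport n (f : 'rV[R]_n -> R) (r : R) :
  bsupp r f -> fsupport f `<=` [set z | `|z| <= r].
Proof.
move=> fr z zf.
have cl : closed [set z : 'rV[R]_n | `|z| <= r].
  have := @preimage_closed _ _ (fun z : 'rV[R]_n => `|z|) [set x | x <= r].
  by apply; [move=> y _; exact: norm_continuous|exact: closed_le].
have h : closure [set x | f x != 0] `<=` closure [set z : 'rV[R]_n | `|z| <= r].
  apply: closureS => y /= fy; rewrite leNgt; apply/negP => /fr fy0.
  by rewrite fy0 eqxx in fy.
by have := h _ zf; rewrite -((closure_id _).1 cl).
Qed.

Lemma closed_ball_compact n (r : R) : compact [set z : 'rV[R]_n | `|z| <= r].
Proof.
apply: bounded_closed_compact.
  exists r; split; first exact: num_real.
  by move=> x rx z /= zr; apply: le_trans zr (ltW rx).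
have := @preimage_closed _ _ (fun z : 'rV[R]_n => `|z|) [set x | x <= r].
by apply; [move=> y _; exact: norm_continuous|exact: closed_le].
Qed.

Lemma test_funP n (f : 'rV[R]_n -> R) :
  test_fun f <-> smooth f /\ exists r, bsupp r f.
Proof.
split=> -[sf].
  move=> /compact_bounded[r [_ rb]]; split=> //; exists (r + 1) => z rz.
  apply/eqP/negPn/negP => fz; have zf : (fsupport f) z by exact: subset_closure.
  have : `|z| <= r + 1 by apply: (rb (r + 1)) => //; rewrite ltrDl.
  by rewrite leNgt rz.
move=> [r fr]; split=> //.
apply: (subclosed_compact _ (@closed_ball_compact n r)); first exact: closed_closure.
exact: bsupp_fsupport.
Qed.

Lemma near_norm_gt n (z : 'rV[R]_n) (r : R) : r < `|z| -> \forall y \near z, r < `|y|.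
Proof.
move=> rz; have /cvgrPdist_lt := @norm_continuous R 'rV[R]_n z.
move=> /(_ (`|z| - r)); rewrite subr_gt0 => /(_ rz); apply: filterS => y h.
by have := le_lt_trans (ler_norm _) h; lra.
Qed.

Lemma bsupp_pder n s (f : 'rV[R]_n -> R) r : bsupp r f -> bsupp r (pder s f).
Proof.
move=> fr; elim: s => //= i s IH z rz.
rewrite (@near_eq_derive _ _ _ _ (cst 0)); first exact: derive_cst.
by apply: filterS (near_norm_gt rz) => y; exact: IH.
Qed.

Lemma test_fun_smooth n (f : 'rV[R]_n -> R) : test_fun f -> smooth f.
Proof. by case. Qed.

Lemma test_fun_pder n s (f : 'rV[R]_n -> R) : test_fun f -> test_fun (pder s f).
Proof.
move=> /test_funP[sf [r fr]]; apply/test_funP; split; first exact: smooth_pder.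
by exists r; exact: bsupp_pder.
Qed.

Lemma test_funM n (f g : 'rV[R]_n -> R) : test_fun f -> smooth g ->
  test_fun (fun z => f z * g z).
Proof.
move=> /test_funP[sf [r fr]] sg; apply/test_funP; split; first exact: smoothM.
by exists r => z rz; rewrite fr// mul0r.
Qed.

Lemma test_funZ n a (f : 'rV[R]_n -> R) : test_fun f -> test_fun (fun z => a * f z).
Proof.
move=> /test_funP[sf [r fr]]; apply/test_funP; split; first exact: smoothZ.
by exists r => z rz; rewrite fr// mulr0.
Qed.

Lemma test_fun0 n : test_fun (fun _ : 'rV[R]_n => 0 : R).
Proof. by apply/test_funP; split; [exact: smooth_cst|exists 0]. Qed.

Lemma test_funD n (f g : 'rV[R]_n -> R) : test_fun f -> test_fun g ->
  test_fun (fun z => f z + g z).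
Proof.
move=> /test_funP[sf [r fr]] /test_funP[sg [r' gr]]; apply/test_funP.
split; first exact: smoothD.
by exists (Num.max r r') => z; rewrite gt_max => /andP[rz rz']; rewrite fr// gr// addr0.
Qed.

Lemma test_fun_sum n (I : Type) (r : seq I) (F : I -> 'rV[R]_n -> R) :
  (forall i, test_fun (F i)) -> test_fun (fun z => \sum_(i <- r) F i z).
Proof.
move=> SF; elim: r => [|i r IH].
  by under eq_fun do rewrite big_nil; exact: test_fun0.
by under eq_fun do rewrite big_cons; exact: test_funD.
Qed.

Lemma mulmx_norm n m (z : 'rV[R]_n) (B : 'M[R]_(n, m)) :
  `|z *m B| <= `|z| * \sum_i \sum_j `|B i j|.
Proof.
apply: rV_norm_le => [|j].
  by rewrite mulr_ge0// sumr_ge0// => i _; rewrite sumr_ge0.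
rewrite mxE; apply: le_trans (ler_norm_sum _ _ _) _.
rewrite mulr_sumr; apply: ler_sum => i _; rewrite normrM ler_pM ?rV_norm_coord//.
by rewrite (bigD1 j)//= lerDl sumr_ge0.
Qed.

Lemma bsupp_affine n (B : 'M[R]_n) (c : 'rV[R]_n) (r : R) : B \in unitmx ->
  exists r', forall f, bsupp r f -> bsupp r' (fun z : 'rV[R]_n => f (c + z *m B)).
Proof.
move=> uB; pose K := \sum_i \sum_j `|(invmx B) i j|.
have K0 : 0 <= K by rewrite sumr_ge0// => i _; rewrite sumr_ge0.
exists ((r + `|c|) * K) => f fr z rz; apply: fr; rewrite ltNge; apply/negP => h.
move: rz; rewrite ltNge => /negP; apply.
rewrite -{1}(mulmxK uB z); apply: le_trans (mulmx_norm _ _) _.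
apply: ler_wpM2r => //.
have -> : z *m B = (c + z *m B) - c by rewrite addrC addKr.
by apply: le_trans (ler_normB _ _) _; rewrite lerD2r.
Qed.

Lemma test_fun_affine n (B : 'M[R]_n) (c : 'rV[R]_n) f : B \in unitmx ->
  test_fun f -> test_fun (fun z => f (c + z *m B)).
Proof.
move=> uB /test_funP[sf [r fr]]; apply/test_funP; split; first exact: smooth_affine.
by have [r' h] := bsupp_affine c r uB; exists r'; exact: h.
Qed.

Lemma test_fun_shift n (c : 'rV[R]_n) f : test_fun f -> test_fun (fun z => f (z + c)).
Proof.
move=> /(@test_fun_affine n 1%:M c f (unitmx1 _ _)).
by under eq_fun do rewrite mulmx1 addrC.
Qed.

Lemma continuous_bounded n (f : 'rV[R]_n -> R) (r : R) : continuous f ->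
  exists2 K, 0 <= K & forall z, `|z| <= r -> `|f z| <= K.
Proof.
move=> fc.
have /compact_bounded[K [_ Kb]] : compact (f @` [set z | `|z| <= r]).
  apply: continuous_compact; last exact: closed_ball_compact.
  exact: continuous_subspaceT.
exists (`|K| + 1); first by rewrite addr_ge0.
move=> z zr; apply: (Kb (`|K| + 1)); last by exists z.
by rewrite (le_lt_trans (ler_norm K))// ltrDl.
Qed.

Lemma test_fun_bounded n (f : 'rV[R]_n -> R) : test_fun f ->
  exists2 K, 0 <= K & forall z, `|f z| <= K.
Proof.
move=> /test_funP[sf [r fr]].
have [K K0 h] := continuous_bounded r (smooth_continuous sf).
exists K => // z; have [zr|zr] := lerP `|z| r; first exact: h.
by rewrite fr// normr0.
Qed.

Definition uniform0 n (g : nat -> 'rV[R]_n -> R) := forall e : R, 0 < e ->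
  \forall j \near \oo, forall x, `|g j x| < e.

Lemma uniform0D n (g h : nat -> 'rV[R]_n -> R) : uniform0 g -> uniform0 h ->
  uniform0 (fun j z => g j z + h j z).
Proof.
move=> g0 h0 e e0; have e2 : 0 < e / 2 by rewrite divr_gt0.
near=> j => x; apply: le_lt_trans (ler_normD _ _) _; rewrite (splitr e) ltrD//; move: x; near: j.
  exact: g0.
exact: h0.
Unshelve. all: by end_near. Qed.

Lemma uniform0M n (g : nat -> 'rV[R]_n -> R) (c : 'rV[R]_n -> R) K :
  (forall j z, g j z != 0 -> `|c z| <= K) -> uniform0 g ->
  uniform0 (fun j z => g j z * c z).
Proof.
move=> cK g0 e e0.
have K1 : 0 < `|K| + 1 by rewrite ltr_wpDl.
have := g0 (e / (`|K| + 1)); rewrite divr_gt0// => /(_ isT).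
apply: filterS => j h x.
have [->|gx] := eqVneq (g j x) 0; first by rewrite mul0r normr0.
rewrite normrM (@le_lt_trans _ _ (`|g j x| * (`|K| + 1)))//.
  apply: ler_wpM2l => //; apply: le_trans (cK _ _ gx) _.
  by apply: le_trans (ler_norm _) _; rewrite lerDl.
by rewrite -ltr_pdivlMr.
Qed.

Lemma uniform0Z n (g : nat -> 'rV[R]_n -> R) a : uniform0 g ->
  uniform0 (fun j z => a * g j z).
Proof.
move=> g0; under [X in uniform0 X]eq_fun do under eq_fun do rewrite mulrC.
by apply: (@uniform0M _ _ (fun=> a) `|a|).
Qed.

Lemma uniform0_sum n (I : Type) (r : seq I) (g : I -> nat -> 'rV[R]_n -> R) :
  (forall i, uniform0 (g i)) -> uniform0 (fun j z => \sum_(i <- r) g i j z).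
Proof.
move=> g0; elim: r => [|i r IH] e e0.
  by apply: nearW => j x; rewrite big_nil normr0.
have := uniform0D (g0 i) IH e0; apply: filterS => j h x.
by rewrite big_cons; exact: h.
Qed.

(** Convergence to 0 in D, with the common compact set replaced by a common ball. *)
Definition null_seq n (phi : nat -> 'rV[R]_n -> R) :=
  [/\ forall j, smooth (phi j), exists r, forall j, bsupp r (phi j) &
      forall s, uniform0 (fun j => pder s (phi j))].

Lemma null_seq_pder n i (phi : nat -> 'rV[R]_n -> R) : null_seq phi ->
  null_seq (fun j => pder [:: i] (phi j)).
Proof.
move=> [sphi [r br] u0]; split.
- by move=> j; exact: smooth_pder.
- by exists r => j; exact: bsupp_pder.
- move=> s; have := u0 (rcons s i).
  by under [X in uniform0 X]eq_fun do rewrite pder_rcons.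
Qed.

(** Right induction on the derivatives, generalized over both factors: Leibniz on the innermost
    derivative gives two products of a null sequence and a smooth function. *)
Lemma null_seqM n (phi : nat -> 'rV[R]_n -> R) c : null_seq phi -> smooth c ->
  null_seq (fun j z => phi j z * c z).
Proof.
move=> nphi sc; have [sphi [r br] u0] := nphi; split.
- by move=> j; exact: (smoothM (sphi j) sc).
- by exists r => j z rz; rewrite br// mul0r.
- move=> s; elim/last_ind: s phi c nphi sc {sphi r br u0} => [|s i IH] phi c nphi sc.
    have [sphi [r br] u0] := nphi.
    have [K K0 hK] := continuous_bounded r (smooth_continuous sc).
    apply: (@uniform0M _ _ _ K); last exact: (u0 [::]).
    move=> j z h; apply: hK; rewrite leNgt; apply/negP => /(br j).
    by apply/eqP.
  have [sphi _ _] := nphi.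
  have n1 : null_seq (fun j => pder [:: i] (phi j)) by exact: null_seq_pder.
  have -> : (fun j => pder (rcons s i) (fun z => phi j z * c z)) =
      (fun j z => pder s (fun z => pder [:: i] (phi j) z * c z) z +
                  pder s (fun z => phi j z * pder [:: i] c z) z).
    apply/funext => j; rewrite pder_rcons pder1M//.
    exact: (pderD _ (smoothM (smooth_pder [:: i] (sphi j)) sc)
                    (smoothM (sphi j) (smooth_pder [:: i] sc))).
  exact: (uniform0D (IH _ _ n1 sc) (IH _ _ nphi (smooth_pder [:: i] sc))).
Qed.

Lemma null_seq_affine n (phi : nat -> 'rV[R]_n -> R) (c : 'rV[R]_n) (B : 'M[R]_n) :
  B \in unitmx -> null_seq phi -> null_seq (fun j z => phi j (c + z *m B)).
Proof.
move=> uB nphi; have [sphi [r br] u0] := nphi; split.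
- by move=> j; exact: smooth_affine.
- by have [r' h] := bsupp_affine c r uB; exists r' => j; exact: h.
- move=> s; elim/last_ind: s phi nphi {sphi r br u0} => [|s i IH] phi nphi.
    have [_ _ u0] := nphi; move=> e /(u0 [::]); apply: filterS => j h x; exact: h.
  have [sphi _ _] := nphi.
  under [X in uniform0 X]eq_fun => j.
    rewrite pder_rcons pder1_affine// pder_sum; last first.
      by move=> k; apply/smoothZ/smooth_affine/smooth_pder.
    over.
  apply: uniform0_sum => k.
  under [X in uniform0 X]eq_fun => j.
    rewrite pderZ; last exact/smooth_affine/smooth_pder.
    over.
  by apply: uniform0Z; apply: (IH (fun j => pder [:: k] (phi j))); exact: null_seq_pder.
Qed.

(** * The complex modulus as a real number, and sequential continuity *)

Definition cnorm (z : C) : R := complex.Re `|z|.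

Lemma cnormE z : `|z| = ((cnorm z)%:C)%C.
Proof. by rewrite /cnorm normc_def. Qed.

Lemma cnorm_ge0 z : 0 <= cnorm z.
Proof. by rewrite /cnorm normc_def /= sqrtr_ge0. Qed.

Lemma cnormD x y : cnorm (x + y) <= cnorm x + cnorm y.
Proof. by rewrite -lecR rmorphD /= -!cnormE ler_normD. Qed.

Lemma cnormM x y : cnorm (x * y) = cnorm x * cnorm y.
Proof. by apply: (@complexI R); rewrite rmorphM /= -!cnormE normrM. Qed.

Lemma cnorm_real x : cnorm ((x%:C)%C) = `|x|.
Proof. by rewrite /cnorm normc_def /= expr0n /= addr0 sqrtr_sqr. Qed.

Lemma cnorm_Re z : `|complex.Re z| <= cnorm z.
Proof. by rewrite -lecR -cnormE normc_ge_Re. Qed.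

Lemma cnorm_Im z : `|complex.Im z| <= cnorm z.
Proof.
by rewrite /cnorm normc_def /= -sqrtr_sqr ler_wsqrtr// lerDr sqr_ge0.
Qed.

Lemma cnorm_eq0 z : cnorm z = 0 -> z = 0.
Proof. by move=> h; apply/normr0_eq0; rewrite cnormE h. Qed.

Definition climit0 (u : nat -> C) := forall e : R, 0 < e ->
  \forall j \near \oo, cnorm (u j) < e.

Lemma distributionP n (T : ('rV[R]_n -> R) -> C) :
  Defs.distribution T <->
  (forall a f g, test_fun f -> test_fun g ->
     T (fun x => a * f x + g x) = (a%:C)%C * T f + T g) /\
  (forall phi, null_seq phi -> climit0 (fun j => T (phi j))).
Proof.
split=> -[lT cT]; split=> //.
  move=> phi [sphi [r br] u0] e e0.
  have := @cT phi [set z | `|z| <= r] (@closed_ball_compact n r).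
  have tphi j : test_fun (phi j) by apply/test_funP; split=> //; exists r.
  move=> /(_ tphi (fun j => bsupp_fsupport (br j)) u0 e e0).
  by apply: filterS => j; rewrite cnormE ltcR.
move=> phi K /compact_bounded[r [_ rb]] tphi Kphi u0 e e0.
have nphi : null_seq phi.
  split=> //; first by move=> j; have [] := tphi j.
  exists (r + 1) => j z rz; apply/eqP/negPn/negP => fz.
  have zK : K z by apply: (Kphi j); exact: subset_closure.
  have : `|z| <= r + 1 by apply: (rb (r + 1)) => //; rewrite ltrDl.
  by rewrite leNgt rz.
by have := cT _ nphi e e0; apply: filterS => j; rewrite cnormE ltcR.
Qed.

(** * Linearity and operations on a distribution *)

Section DistLemmas.
Variables (n : nat) (T : ('rV[R]_n -> R) -> C).
Hypothesis dT : Defs.distribution T.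

Lemma dist0 : T (fun=> 0) = 0.
Proof.
have [lT _] := dT; have := lT 1 _ _ (test_fun0 n) (test_fun0 n).
rewrite rmorph1 !mul1r (_ : (fun x : 'rV[R]_n => 0 + 0) = (fun=> 0)); last first.
  by apply/funext => x; rewrite addr0.
by move=> /esym/eqP; rewrite -subr_eq0 addrK => /eqP.
Qed.

Lemma distZ a f : test_fun f -> T (fun x => a * f x) = (a%:C)%C * T f.
Proof.
move=> tf; have [lT _] := dT; rewrite -[RHS]addr0 -dist0 -lT//; last exact: test_fun0.
by congr T; apply/funext => x; rewrite addr0.
Qed.

Lemma distD f g : test_fun f -> test_fun g -> T (fun x => f x + g x) = T f + T g.
Proof.
move=> tf tg; have [lT _] := dT; have := lT 1 _ _ tf tg.
by rewrite rmorph1 mul1r => <-; congr T; apply/funext => x; rewrite mul1r.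
Qed.

Lemma distN f : test_fun f -> T (fun x => - f x) = - T f.
Proof.
move=> tf; rewrite -mulN1r -(rmorphN1 (real_complex R)) -distZ//.
by congr T; apply/funext => x; rewrite mulN1r.
Qed.

Lemma distB f g : test_fun f -> test_fun g -> T (fun x => f x - g x) = T f - T g.
Proof.
move=> tf tg; rewrite -distN// -distD//.
by have := test_funZ (-1) tg; under eq_fun do rewrite mulN1r.
Qed.

Lemma dist_sum (I : Type) (r : seq I) (F : I -> 'rV[R]_n -> R) :
  (forall i, test_fun (F i)) -> T (fun z => \sum_(i <- r) F i z) = \sum_(i <- r) T (F i).
Proof.
move=> tF; elim: r => [|i r IH].
  by under eq_fun do rewrite big_nil; rewrite big_nil dist0.
under eq_fun do rewrite big_cons.
by rewrite big_cons -IH distD//; exact: test_fun_sum.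
Qed.

Lemma dist_affine c (B : 'M[R]_n) : B \in unitmx ->
  Defs.distribution (fun f => T (fun z => f (c + z *m B))).
Proof.
move=> uB; have /distributionP[lT cT] := dT; apply/distributionP; split.
  by move=> a f g tf tg; rewrite lT//; exact: test_fun_affine.
by move=> phi nphi; apply: cT; exact: null_seq_affine.
Qed.

Lemma dist_shift c : Defs.distribution (fun f => T (fun z => f (z + c))).
Proof.
have := @dist_affine c 1%:M (unitmx1 _ _).
by under eq_fun do under eq_fun do rewrite mulmx1 addrC.
Qed.

Lemma dist_mul c : smooth c -> Defs.distribution (fun f => T (fun z => f z * c z)).
Proof.
move=> sc; have /distributionP[lT cT] := dT; apply/distributionP; split.
  move=> a f g tf tg; rewrite -(lT a _ _ (test_funM tf sc) (test_funM tg sc)).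
  by congr T; apply/funext => z; rewrite mulrDl mulrA.
by move=> phi nphi; apply: cT; exact: null_seqM.
Qed.

Lemma dist_pder i : Defs.distribution (fun f => T (pder [:: i] f)).
Proof.
have /distributionP[lT cT] := dT; apply/distributionP; split.
  move=> a f g tf tg; rewrite -lT//; try exact: test_fun_pder.
  congr T; rewrite pder1D; [|exact/smoothZ/test_fun_smooth|exact: test_fun_smooth].
  by rewrite (@pderZ _ _ [:: i] a f)//; exact: test_fun_smooth.
by move=> phi nphi; apply: cT; exact: null_seq_pder.
Qed.

End DistLemmas.

Lemma dist_comb n (T1 T2 : ('rV[R]_n -> R) -> C) (a b : C) :
  Defs.distribution T1 -> Defs.distribution T2 -> Defs.distribution (fun f => a * T1 f + b * T2 f).
Proof.
move=> /distributionP[l1 c1] /distributionP[l2 c2]; apply/distributionP; split.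
  by move=> x f g tf tg; rewrite l1// l2//; ring.
move=> phi nphi e e0.
have K0 c : 0 < cnorm c + 1 by rewrite ltr_wpDl// cnorm_ge0.
have ec (c : C) : 0 < e / 2 / (cnorm c + 1) by rewrite !divr_gt0.
near=> j; apply: le_lt_trans (cnormD _ _) _; rewrite (splitr e) !cnormM.
have h (c x : C) : cnorm x < e / 2 / (cnorm c + 1) -> cnorm c * cnorm x < e / 2.
  rewrite ltr_pdivlMr// mulrC; apply: le_lt_trans.
  by apply: ler_wpM2r; [exact: cnorm_ge0|rewrite lerDl].
by apply: ltrD; apply: h; near: j; [exact: c1|exact: c2].
Unshelve. all: by end_near. Qed.

End TestFunctions.

(** * Riemann sums *)

Section ProductFunctions.
Variable R : realType.

Definition prodf n (psi : 'I_n -> R -> R) (z : 'rV[R]_n) : R := \prod_i psi i (z 0 i).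

Lemma smooth_prod n (I : Type) (r : seq I) (F : I -> 'rV[R]_n -> R) :
  (forall i, smooth (F i)) -> smooth (fun z => \prod_(i <- r) F i z).
Proof.
move=> SF; elim: r => [|i r IH].
  by under eq_fun do rewrite big_nil; exact: smooth_cst.
by under eq_fun do rewrite big_cons; exact: smoothM.
Qed.

Lemma smooth_coord n (phi : R -> R) i : smooth1 phi -> smooth (fun z : 'rV[R]_n => phi (z 0 i)).
Proof.
move=> /(@smooth_ridge _ n phi (delta_mx i 0)).
by under eq_fun do rewrite -colE mxE.
Qed.

Lemma smooth_prodf n (psi : 'I_n -> R -> R) : (forall i, smooth1 (psi i)) -> smooth (prodf psi).
Proof. by move=> sp; apply: smooth_prod => i; exact: smooth_coord. Qed.

Lemma prodf_zero n (psi : 'I_n -> R -> R) (z : 'rV[R]_n) i : psi i (z 0 i) = 0 -> prodf psi z = 0.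
Proof. by move=> h; rewrite /prodf (bigD1 i)//= h mul0r. Qed.

Lemma test_fun_prodf n (psi : 'I_n -> R -> R) : (forall i, test1 (psi i)) -> test_fun (prodf psi).
Proof.
move=> tp; apply/test_funP; split; first by apply: smooth_prodf => i; have [] := tp i.
have /choice[r rP] : forall i, exists r : R, forall s, r < `|s| -> psi i s = 0.
  by move=> i; have [_ ?] := tp i.
exists (\sum_i `|r i|) => z rz.
have [i zi] : exists i, \sum_i `|r i| < `|z 0 i|.
  apply: contrapT => h; move: rz; rewrite ltNge => /negP; apply.
  apply: rV_norm_le => [|i]; first by rewrite sumr_ge0.
  by rewrite leNgt; apply/negP => zi; apply: h; exists i.
apply: (@prodf_zero _ _ _ i); apply: rP; apply: le_lt_trans zi.
by apply: le_trans (ler_norm _) _; rewrite (bigD1 i)//= lerDl sumr_ge0.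
Qed.

Lemma pder1_prodf n (psi : 'I_n -> R -> R) i : (forall i, smooth1 (psi i)) ->
  pder [:: i] (prodf psi) = prodf (fun j => if j == i then derive1 (psi j) else psi j).
Proof.
move=> sp; apply/funext => z; apply: is_deriveE; apply: is_derive_line.
have -> : (fun h : R => prodf psi (z + h *: ebasis R i)) =
    (fun h : R => (\prod_(j | j != i) psi j (z 0 j)) * psi i (z 0 i + h)).
  apply/funext => h; rewrite /prodf (bigD1 i)//= mulrC; congr (_ * _); last first.
    by rewrite !mxE !eqxx mulr1.
  by apply: eq_bigr => j ji; rewrite !mxE eqxx (negbTE ji) mulr0 addr0.
have -> : prodf (fun j => if j == i then derive1 (psi j) else psi j) z =
    (\prod_(j | j != i) psi j (z 0 j)) * derive1 (psi i) (z 0 i).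
  rewrite /prodf (bigD1 i)//= eqxx mulrC; congr (_ * _).
  by apply: eq_bigr => j /negbTE ->.
have h : is_derive (0 : R) 1 (fun h : R => psi i (z 0 i + h)) (derive1 (psi i) (z 0 i)).
  rewrite -[derive1 _ _]mulr1; apply: (@is_derive1_comp _ (psi i) (fun h : R => z 0 i + h)).
    by rewrite addr0; exact: smooth1_is_derive.
  apply: (@is_derive_eq _ _ _ (fun h : R => z 0 i + h)); by rewrite add0r mulr1.
exact: (@is_deriveZ _ _ _ (fun h : R => psi i (z 0 i + h)) _ _ _ _ h).
Qed.

(** The right side depends on [s] only through multiplicities, so mixed derivatives of a product
    function commute at once. *)
Lemma pder_prodf n (psi : 'I_n -> R -> R) s : (forall i, smooth1 (psi i)) ->
  pder s (prodf psi) = prodf (fun j => derive1n (count_mem j s) (psi j)).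
Proof.
have sn (f : R -> R) k : smooth1 f -> smooth1 (derive1n k f).
  by move=> sf; elim: k => [//|k IH]; rewrite derive1nS; exact: smooth1_derive.
move=> sp; elim: s => [|i s IH]; first by [].
rewrite -[LHS]/(pder [:: i] (pder s (prodf psi))) IH pder1_prodf; last by move=> j; exact: sn.
congr prodf; apply/funext => j /=; rewrite [i == j]eq_sym.
by have [->|_] := eqVneq j i; rewrite ?add1n ?add0n ?derive1nS.
Qed.

End ProductFunctions.

(** * Riemann sums on a uniform grid of a cube *)

Section Grid.
Variables (R : realType) (n : nat).
Implicit Types (H f g : 'rV[R]_n -> R) (L M : nat).

Definition gptv L M (q : {ffun 'I_n -> 'I_((2 * L) * M)}) : 'rV[R]_n :=
  \row_i gpt R L M (q i).

Definition gsum L M H : R := M%:R^-1 ^+ n * \sum_q H (@gptv L M q).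

Lemma gsum_prodf L M (psi : 'I_n -> R -> R) :
  gsum L M (prodf psi) = \prod_i (M%:R^-1 * \sum_(q < (2 * L) * M) psi i (gpt R L M q)).
Proof.
rewrite big_split /= prodr_const card_ord /gsum; congr (_ * _).
rewrite bigA_distr_bigA /=; apply: eq_bigr => q _.
by apply: eq_bigr => i _; rewrite mxE.
Qed.

Lemma gsumD L M H1 H2 : gsum L M (fun y => H1 y + H2 y) = gsum L M H1 + gsum L M H2.
Proof. by rewrite /gsum big_split mulrDr. Qed.

Lemma gsumZ L M a H : gsum L M (fun y => a * H y) = a * gsum L M H.
Proof. by rewrite /gsum -mulr_sumr mulrCA. Qed.

Lemma gsumB L M H1 H2 : gsum L M (fun y => H1 y - H2 y) = gsum L M H1 - gsum L M H2.
Proof. by rewrite /gsum sumrB mulrBr. Qed.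

Lemma le_gsum L M H1 H2 : (forall y, H1 y <= H2 y) -> gsum L M H1 <= gsum L M H2.
Proof.
move=> h; apply: ler_wpM2l; first by rewrite exprn_ge0// invr_ge0.
by apply: ler_sum.
Qed.

Lemma norm_gsum L M H : `|gsum L M H| <= gsum L M (fun y => `|H y|).
Proof.
rewrite /gsum normrM ger0_norm ?exprn_ge0 ?invr_ge0//.
by apply: ler_wpM2l; [rewrite exprn_ge0 ?invr_ge0|exact: ler_norm_sum].
Qed.

(** At most 2 L0 M + 1 grid points lie in [-L0, L0]; with the mesh factor and M >= 1 this gives a
    bound independent of L and M. *)
Lemma count_gpt L L0 M : (0 < M)%N ->
  M%:R^-1 * \sum_(q < (2 * L) * M) (`|gpt R L M q| <= L0%:R)%R%:R <= 2 * L0%:R + 1 :> R.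
Proof.
move=> M0; have M1 : 0 < M%:R :> R by rewrite ltr0n.
rewrite ler_pdivrMl//.
apply: (@le_trans _ _ (((L + L0) * M).+1 - (L - L0) * M)%:R).
  rewrite -natr_sum ler_nat.
  apply: (@leq_trans (\sum_(q < (2 * L) * M) ((L - L0) * M <= q < ((L + L0) * M).+1))).
    apply: leq_sum => q _; case: (boolP (_ <= _)) => //= h.
    have [l1 l2] : (L%:R - L0%:R) * M%:R <= q%:R :> R /\ q%:R <= (L%:R + L0%:R) * M%:R :> R.
      move: h; rewrite ler_norml /gpt => /andP[h1 h2]; split.
        by rewrite -ler_pdivlMr//; lra.
      by rewrite -ler_pdivrMr//; lra.
    have -> : (q < ((L + L0) * M).+1)%N by rewrite ltnS -(ler_nat R) natrM natrD.
    suff -> : ((L - L0) * M <= q)%N by [].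
    (* The difference [L - L0] is truncated to 0 when the interval exceeds the window, and the lower
       bound on q is then trivial. *)
    rewrite -(ler_nat R) natrM; have [LL|LL] := leqP L0 L; first by rewrite natrB.
    by rewrite (_ : (L - L0)%N = 0) ?mul0r//; apply/eqP; rewrite subn_eq0 ltnW.
  rewrite -(big_mkord xpredT (fun q => nat_of_bool ((L - L0) * M <= q < ((L + L0) * M).+1)%N)).
  set a := ((L - L0) * M)%N; set b := ((L + L0) * M).+1.
  elim: ((2 * L) * M)%N => [|k IH]; first by rewrite big_geq.
  have E m : (\sum_(0 <= q < m) (a <= q < b)%N <= minn b m - a)%N.
    elim: m => [|m IHm]; first by rewrite big_geq.
    rewrite big_nat_recr //=; case: (boolP (a <= m < b)%N) => h; lia.
  by apply: leq_trans (E _) _; lia.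
rewrite mulrDr mulr1 mulrCA -natrM -(natrM _ 2) -natrD ler_nat; nia.
Qed.

Lemma gsum_ball L L0 M : (0 < M)%N ->
  gsum L M (fun y => (`|y| <= L0%:R)%R%:R) <= (2 * L0%:R + 1) ^+ n.
Proof.
move=> M0; apply: (@le_trans _ _ (gsum L M (prodf (fun _ s => (`|s| <= L0%:R)%R%:R)))).
  apply: le_gsum => y; have [h|h] := lerP `|y| L0%:R.
    rewrite /prodf big1// => i _.
    by rewrite (le_trans (rV_norm_coord y i) h).
  by apply: prodr_ge0 => i _; rewrite ler0n.
have -> : (2 * L0%:R + 1) ^+ n = \prod_(i < n) (2 * L0%:R + 1 : R).
  by rewrite prodr_const card_ord.
rewrite gsum_prodf; apply: ler_prod => i _.
rewrite count_gpt// andbT mulr_ge0 ?invr_ge0//.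
by rewrite sumr_ge0// => q _; rewrite ler0n.
Qed.

Lemma gsum_bound L L0 M H K : (0 < M)%N -> bsupp L0%:R H -> (forall y, `|H y| <= K) ->
  `|gsum L M H| <= K * (2 * L0%:R + 1) ^+ n.
Proof.
move=> M0 Hs HK; apply: le_trans (norm_gsum _ _ _) _.
have K0 : 0 <= K by apply: le_trans (HK 0).
apply: (@le_trans _ _ (gsum L M (fun y => K * (`|y| <= L0%:R)%R%:R))).
  apply: le_gsum => y; case: (lerP `|y| L0%:R) => h; rewrite ?mulr1 ?mulr0//.
  by rewrite Hs// normr0.
by rewrite gsumZ ler_wpM2l// gsum_ball.
Qed.

(** The shift is a cyclic permutation of the i-th index. Only the wrapped index breaks the
    correspondence, exchanging y_i = L with y_i = -L, where [H] vanishes since L0 < L. *)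
Lemma gsum_step L L0 M H i : (0 < M)%N -> (L0 < L)%N -> bsupp L0%:R H ->
  gsum L M (fun y => H (y + M%:R^-1 *: ebasis R i)) = gsum L M H.
Proof.
move=> M0 LL Hs; rewrite /gsum; congr (_ * _).
have Q0 : (0 < (2 * L) * M)%N by rewrite !muln_gt0 M0 (leq_trans _ LL).
have M1 : M%:R != 0 :> R by rewrite pnatr_eq0 -lt0n.
pose sh (q : {ffun 'I_n -> 'I_((2 * L) * M)}) :=
  [ffun j => if j == i then ordS (q j) else q j].
pose sh' (q : {ffun 'I_n -> 'I_((2 * L) * M)}) :=
  [ffun j => if j == i then ord_pred (q j) else q j].
have shK : cancel sh sh'.
  by move=> q; apply/ffunP => j; rewrite !ffunE; case: eqP => // _; rewrite ordSK.
have shK' : cancel sh' sh.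
  by move=> q; apply/ffunP => j; rewrite !ffunE; case: eqP => // _; rewrite ord_predK.
rewrite [RHS](reindex sh)/=; last by exists sh' => q _; [exact: shK|exact: shK'].
apply: eq_bigr => q _.
have H0 (y : 'rV[R]_n) : L%:R <= `|y 0 i| -> H y = 0.
  move=> h; apply: Hs; apply: lt_le_trans (rV_norm_coord y i).
  by apply: lt_le_trans h; rewrite ltr_nat.
have [h|h] := ltnP (q i).+1 ((2 * L) * M).
  congr H; apply/rowP => j; rewrite !mxE ffunE eqxx /=.
  have [->|ji] := eqVneq j i; last by rewrite mulr0 addr0.
  by rewrite /= modn_small// /gpt -[(q i).+1%:R]natr1 mulr1; field.
have qe : (q i).+1 = ((2 * L) * M)%N by apply/eqP; rewrite eqn_leq h ltn_ord.
rewrite !H0// !mxE ?ffunE eqxx /=; last first.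
  rewrite eqxx mulr1 /gpt -addrA -[X in _ + (_ + X)]mul1r -mulrDl natr1 qe natrM mulfK// natrM.
  by rewrite (_ : - L%:R + 2 * L%:R = L%:R) ?ler_norm//; ring.
by rewrite qe modnn /gpt mul0r addr0 normrN ler_norm.
Qed.

(* Discrete integration by parts: [gsum] of an exact difference telescopes to 0. *)
Lemma gsum_pder L L0 M H i C : (0 < M)%N -> (L0 < L)%N -> smooth H -> bsupp L0%:R H ->
  (forall y, `|pder [:: i; i] H y| <= C) ->
  `|gsum L M (pder [:: i] H)| <= C * (2 * L0.+1%:R + 1) ^+ n / M%:R.
Proof.
move=> M0 LL sH Hs HC; have M1 : 0 < M%:R :> R by rewrite ltr0n.
pose h : R := M%:R^-1; have h0 : 0 < h by rewrite invr_gt0.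
(* Subtracting the forward difference, whose sum is 0, leaves an error that two mean values bound
   pointwise by C/M. *)
pose E (y : 'rV[R]_n) := pder [:: i] H y - M%:R * (H (y + h *: ebasis R i) - H y).
have -> : gsum L M (pder [:: i] H) = gsum L M E.
  rewrite /E gsumB gsumZ gsumB (@gsum_step L L0)//.
  by rewrite subrr mulr0 subr0.
have EC y : `|E y| <= h * C.
  have [_ dH] := sH [::]; have [_ dH1] := sH [:: i].
  have [th t1 t2] := @mvt_line _ _ H y (ebasis R i) h (fun x => dH x i).
  have [th' t3 t4] := @mvt_line _ _ (pder [:: i] H) y (ebasis R i) th (fun x => dH1 x i).
  rewrite /E t2 mulrA divff ?gt_eqF// mul1r distrC.
  rewrite -[X in X - _]/(pder [:: i] H (y + th *: ebasis R i)) t4 normrM.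
  apply: ler_pM => //; last exact: HC.
  by rewrite -(ger0_norm (ltW h0)).
(* One unit wider than the support of [H], to contain its shift by h <= 1. *)
have Es : bsupp L0.+1%:R E.
  move=> y yL; have yL0 : L0%:R < `|y| by apply: lt_trans yL; rewrite ltr_nat.
  rewrite /E (bsupp_pder [:: i] Hs)// (Hs y)// (Hs (y + _)) ?subr0 ?mulr0 ?subr0//.
  move: yL; rewrite -natr1 => yL.
  have h1 : `|h *: ebasis R i| <= 1.
    rewrite normrZ ger0_norm; last exact: ltW.
    apply: mulr_ile1 => //; first exact: ltW.
      by rewrite invf_le1// ler1n.
    exact: ebasis_norm.
  have := ler_normB (y + h *: ebasis R i) (h *: ebasis R i).
  by rewrite addrK => /(lt_le_trans yL); lra.
have := @gsum_bound L L0.+1 M E (h * C) M0 Es EC.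
by have -> : C * (2 * L0.+1%:R + 1) ^+ n / M%:R =
  h * C * (2 * L0.+1%:R + 1) ^+ n by rewrite -/h; ring.
Qed.

End Grid.

(** * Density of translated product kernels *)

Section Density.
Variables (R : realType) (n : nat).
Implicit Types (H f g : 'rV[R]_n -> R) (L M : nat).

Lemma pderB s f g : smooth f -> smooth g ->
  pder s (fun z => f z - g z) = (fun z => pder s f z - pder s g z).
Proof.
move=> sf sg.
have -> : (fun z => f z - g z) = (fun z => f z + -1 * g z).
  by apply/funext => z; rewrite mulN1r.
rewrite (pderD s sf (smoothZ (-1) sg)) (pderZ s (-1) sg).
by apply/funext => z; rewrite mulN1r.
Qed.

Lemma pder1_reflect f z i : smooth f ->
  pder [:: i] (fun y => f (z - y)) = (fun y => - pder [:: i] f (z - y)).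
Proof.
move=> sf.
have -> : (fun y => f (z - y)) = (fun y => f (z + y *m (- 1%:M))).
  by apply/funext => y; rewrite mulmxN mulmx1.
rewrite pder1_affine//; apply/funext => y; rewrite mulmxN mulmx1.
rewrite (bigD1 i)//= !mxE eqxx mulN1r big1 ?addr0// => j ji.
by rewrite !mxE eq_sym (negbTE ji) oppr0 mul0r.
Qed.

Lemma smooth_reflect f z : smooth f -> smooth (fun y => f (z - y)).
Proof.
move=> /(@smooth_affine _ n n f z (- 1%:M)).
by under eq_fun do rewrite mulmxN mulmx1.
Qed.

(** Each transferred derivative costs O(1/M), uniformly in z. No sign appears because the reflection
    y -> z - y contributes a second minus. The outermost derivative of [g] moves first and becomes
    the innermost one of [f], hence [rev s]; the derivatives of [f] are not yet known to commute. *)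
Lemma gsum_parts L L0 f g s : test_fun f -> test_fun g -> bsupp L0%:R f -> (L0 < L)%N ->
  exists C, forall M z, (0 < M)%N ->
  `|gsum L M (fun y => f y * pder s g (z - y)) -
    gsum L M (fun y => pder (rev s) f y * g (z - y))| <= C / M%:R.
Proof.
move=> tf tg fs LL; elim: s f tf fs => [|i s IH] f tf fs.
  by exists 0 => M z M0; rewrite subrr normr0 mul0r.
have [C1 hC1] := IH (pder [:: i] f) (test_fun_pder [:: i] tf) (bsupp_pder [:: i] fs).
have b (h : 'rV[R]_n -> R) : test_fun h -> exists2 K, 0 <= K & forall z, `|h z| <= K :=
  @test_fun_bounded R n h.
have tgs := test_fun_pder s tg.
have [a0 a00 ha0] := b _ tf.
have [a1 a10 ha1] := b _ (test_fun_pder [:: i] tf).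
have [a2 a20 ha2] := b _ (test_fun_pder [:: i; i] tf).
have [b0 b00 hb0] := b _ tgs.
have [b1 b10 hb1] := b _ (test_fun_pder [:: i] tgs).
have [b2 b20 hb2] := b _ (test_fun_pder [:: i; i] tgs).
pose C2 := (a2 * b0 + a1 * b1 + (a1 * b1 + a0 * b2)) * (2 * L0.+1%:R + 1) ^+ n.
exists (C2 + C1) => M z M0.
have sf := test_fun_smooth tf; have sg := test_fun_smooth tgs.
have sfi : smooth (pder [:: i] f) by exact: smooth_pder.
have sgi : smooth (pder [:: i] (pder s g)) by exact: smooth_pder.
pose H (y : 'rV[R]_n) := f y * pder s g (z - y).
have sH : smooth H by exact: (smoothM sf (smooth_reflect z sg)).
have E1 : pder [:: i] H = (fun y => pder [:: i] f y * pder s g (z - y) +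
                                   f y * - pder (i :: s) g (z - y)).
  by rewrite (pder1M i sf (smooth_reflect z sg)) (pder1_reflect z i sg).
have E2 : pder [:: i; i] H = (fun y =>
    (pder [:: i; i] f y * pder s g (z - y) + pder [:: i] f y * - pder (i :: s) g (z - y)) +
   -1 * (pder [:: i] f y * pder (i :: s) g (z - y) + f y * - pder [:: i, i & s] g (z - y))).
  rewrite -[LHS]/(pder [:: i] (pder [:: i] H)) E1.
  under [X in pder _ X]eq_fun do rewrite mulrN -mulN1r.
  have sr1 : smooth (fun y => pder s g (z - y)) by exact: smooth_reflect.
  have sr2 : smooth (fun y => pder (i :: s) g (z - y)) by exact: (smooth_reflect z sgi).
  have F1 : pder [:: i] (fun y => pder [:: i] f y * pder s g (z - y)) =
      (fun y => pder [:: i; i] f y * pder s g (z - y) +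
                pder [:: i] f y * - pder (i :: s) g (z - y)).
    by rewrite (pder1M i sfi sr1) (pder1_reflect z i sg).
  have F2 : pder [:: i] (fun y => f y * pder (i :: s) g (z - y)) =
      (fun y => pder [:: i] f y * pder (i :: s) g (z - y) +
                f y * - pder [:: i, i & s] g (z - y)).
    by rewrite (pder1M i sf sr2) (pder1_reflect z i sgi).
  rewrite (pder1D i (smoothM sfi sr1) (smoothZ (-1) (smoothM sf sr2))).
  by rewrite (pderZ [:: i] (-1) (smoothM sf sr2)) F1 F2.
have HC y : `|pder [:: i; i] H y| <= a2 * b0 + a1 * b1 + (a1 * b1 + a0 * b2).
  rewrite E2; apply: le_trans (ler_normD _ _) _; rewrite mulN1r normrN.
  apply: lerD; apply: le_trans (ler_normD _ _) _; apply: lerD; rewrite normrM ?normrN.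
  - by apply: ler_pM.
  - by apply: ler_pM => //; exact: hb1.
  - by apply: ler_pM => //; exact: hb1.
  - by apply: ler_pM => //; exact: hb2.
have Hs : bsupp L0%:R H by move=> y yL; rewrite /H fs// mul0r.
have := @gsum_pder R n L L0 M H i _ M0 LL sH Hs HC.
rewrite -/C2 E1 gsumD => h1.
have h2 := hC1 M z M0.
have -> : gsum L M (fun y => f y * pder (i :: s) g (z - y)) =
   - gsum L M (fun y => f y * - pder (i :: s) g (z - y)).
  by rewrite -mulN1r -gsumZ; congr gsum; apply/funext => y; ring.
have <- : pder (rev s) (pder [:: i] f) = pder (rev (i :: s)) f.
  by rewrite rev_cons pder_rcons.
move: h1 h2; set A := gsum L M _; set B := gsum L M _; set D := gsum L M _ => h1 h2.
rewrite mulrDl; have -> : - B - D = - (A + B) + (A - D) by ring.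
by apply: le_trans (ler_normD _ _) _; rewrite normrN lerD.
Qed.

(** The l1 distance suits a product kernel, whose concentration is known one coordinate at a
    time. *)
Lemma test_fun_lipschitz g : test_fun g ->
  exists2 K, 0 <= K & forall x y, `|g x - g y| <= K * \sum_i `|x 0 i - y 0 i|.
Proof.
move=> tg; have sg := test_fun_smooth tg.
have /choice[k kP] : forall i, exists k, 0 <= k /\ forall z, `|pder [:: i] g z| <= k.
  by move=> i; have [k k0 h] := test_fun_bounded (test_fun_pder [:: i] tg); exists k.
exists (\sum_i k i); first by rewrite sumr_ge0// => i _; have [] := kP i.
move=> x y.
have dg z : derivable g z (x - y) by have [] := smooth_is_derive_dir z (x - y) sg.
have [th _] := @mvt_line _ _ g y (x - y) 1 dg.
rewrite scale1r [y + _]addrC subrK mul1r => ->.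
rewrite (is_deriveE (smooth_is_derive_dir _ (x - y) sg)).
apply: le_trans (ler_norm_sum _ _ _) _; rewrite mulr_sumr; apply: ler_sum => i _.
rewrite normrM !mxE mulrC ler_wpM2r//; apply: le_trans (proj2 (kP i) _) _.
by rewrite (bigD1 i)//= lerDl sumr_ge0// => j _; have [] := kP j.
Qed.

Definition kernv (N : nat) : 'rV[R]_n -> R := prodf (fun _ => @kern R N).

Lemma test_fun_kernv N : test_fun (kernv N).
Proof. by apply: test_fun_prodf => i; exact: test1_kern. Qed.

Lemma kernv_ge0 N z : 0 <= kernv N z.
Proof. by apply: prodr_ge0 => i _; exact: kern_ge0. Qed.

Lemma gsum_kernv_shift L M (F : 'I_n -> R -> R) (z : 'rV[R]_n) :
  gsum L M (fun y => prodf F (z - y)) =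
  \prod_i (M%:R^-1 * \sum_(q < (2 * L) * M) F i (z 0 i - gpt R L M q)).
Proof.
rewrite -(@gsum_prodf R n L M (fun i s => F i (z 0 i - s))).
by congr gsum; apply/funext => y; apply: eq_bigr => i _; rewrite !mxE.
Qed.

(** By [kern_mass] the error at z is the kernel mean of g(y) - g(z). Against |z_i - y_i| the product
    kernel factors into one moment, small by [kern_concentrated], and masses equal to 1. *)
Lemma gsum_kernv_approx L0 g e : test_fun g -> bsupp L0%:R g -> 0 < e ->
  exists N0 : nat, forall N M z, (N0 <= N)%N -> (N.+1 < M)%N ->
  `|gsum L0.+2 M (fun y => g y * kernv N (z - y)) - g z| <= e.
Proof.
move=> tg gs e0; have [K K0 hK] := test_fun_lipschitz tg.
have n1 : 0 < K * n%:R + 1 by rewrite ltr_wpDl// mulr_ge0.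
have e1 : 0 < e / (K * n%:R + 1) by rewrite divr_gt0.
have [N0 hN0] := @kern_concentrated R _ e1.
exists N0 => N M z NN NM.
(* The window L0 + 2 serves both cases: if some |z_i| > L0 + 1, the kernel at z misses the support
   of [g], being zero at distance 3/4; otherwise [kern_mass] holds in every coordinate. *)
have [zL|zL] := pselect (forall i, `|z 0 i| <= L0.+2%:R - 1); last first.
  have [i zi] : exists i, L0.+2%:R - 1 < `|z 0 i|.
    apply: contrapT => h; apply: zL => i; rewrite leNgt; apply/negP => zi.
    by apply: h; exists i.
  have zi1 : L0%:R + 1 < `|z 0 i| by move: zi; rewrite -addn2 natrD; lra.
  have -> : g z = 0.
    by apply: gs; apply: lt_le_trans (rV_norm_coord z i); lra.
  rewrite subr0 (_ : (fun y => g y * kernv N (z - y)) = (fun=> 0)).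
    by rewrite /gsum big1 ?mulr0 ?normr0 ?ltW.
  apply/funext => y; have [yL|yL] := lerP `|y| L0%:R; last by rewrite gs// mul0r.
  rewrite /kernv (@prodf_zero _ _ _ _ i) ?mulr0// kern_eq0// !mxE.
  have := le_trans (rV_norm_coord y i) yL.
  by have := ler_normB (z 0 i - y 0 i) (- y 0 i); rewrite opprK subrK normrN; lra.
have mass : gsum L0.+2 M (fun y => kernv N (z - y)) = 1.
  rewrite gsum_kernv_shift big1// => i _; apply: kern_mass => //; lia.
rewrite -[X in _ - X]mulr1 -mass -gsumZ -gsumB.
apply: le_trans (norm_gsum _ _ _) _.
apply: (@le_trans _ _ (gsum L0.+2 M (fun y => K * \sum_i (`|z 0 i - y 0 i| * kernv N (z - y))))).
  apply: le_gsum => y; rewrite -mulrBl normrM (ger0_norm (kernv_ge0 _ _)).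
  rewrite -mulr_suml mulrA; apply: ler_wpM2r; first exact: kernv_ge0.
  by rewrite distrC; exact: hK.
rewrite gsumZ; have -> : gsum L0.+2 M (fun y => \sum_i (`|z 0 i - y 0 i| * kernv N (z - y))) =
   \sum_i gsum L0.+2 M (fun y => `|z 0 i - y 0 i| * kernv N (z - y)).
  by rewrite /gsum -mulr_sumr exchange_big.
apply: (@le_trans _ _ (K * \sum_(i < n) (e / (K * n%:R + 1)))); last first.
  rewrite sumr_const card_ord -[_ *+ n]mulr_natr.
  have -> : K * (e / (K * n%:R + 1) * n%:R) = e * (K * n%:R / (K * n%:R + 1)) by ring.
  by rewrite ler_piMr ?(ltW e0)// ler_pdivrMr// mul1r lerDl.
apply: ler_wpM2l => //; apply: ler_sum => i _.
have -> : (fun y : 'rV[R]_n => `|z 0 i - y 0 i| * kernv N (z - y)) =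
    (fun y => prodf (fun j s => if j == i then `|s| * kern N s else kern N s) (z - y)).
  apply/funext => y; rewrite /kernv /prodf (bigD1 i)//= [RHS](bigD1 i)//= eqxx !mxE mulrA.
  by congr (_ * _); apply: eq_bigr => j /negbTE ->.
rewrite gsum_kernv_shift (bigD1 i)//= eqxx [X in _ * X]big1 ?mulr1; first by apply: hN0.
by move=> j /negbTE ->; apply: kern_mass => //; lia.
Qed.

Definition kern_approx L N M f (z : 'rV[R]_n) := gsum L M (fun y => f y * kernv N (z - y)).

Lemma pder_kern_approx L N M f s z :
  pder s (kern_approx L N M f) z = gsum L M (fun y => f y * pder s (kernv N) (z - y)).
Proof.
have sk := test_fun_smooth (test_fun_kernv N).
rewrite /kern_approx /gsum pderZ; last first.
  by apply: smooth_sum => q; apply/smoothZ/smooth_shift.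
congr (_ * _); rewrite pder_sum; last by move=> q; apply/smoothZ/smooth_shift.
by apply: eq_bigr => q _; rewrite pderZ ?pder_shift//; exact: smooth_shift.
Qed.

Lemma smooth_kern_approx L N M f : smooth (kern_approx L N M f).
Proof.
apply/smoothZ/smooth_sum => q; apply/smoothZ/smooth_shift.
exact: (test_fun_smooth (test_fun_kernv N)).
Qed.

Lemma pder_kernv_perm N s1 s2 : perm_eq s1 s2 -> pder s1 (kernv N) = pder s2 (kernv N).
Proof.
move=> /permP e; rewrite !pder_prodf; try by move=> i; have [] := @test1_kern R N.
by congr prodf; apply/funext => j; rewrite e.
Qed.

Lemma bsupp_kern_approx L N M f : (0 < M)%N -> bsupp (L%:R + 1) (kern_approx L N M f).
Proof.
move=> M0 z zL; rewrite /kern_approx /gsum big1 ?mulr0// => q _.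
have [i zi] : exists i, L%:R + 1 < `|z 0 i|.
  apply: contrapT => h; move: zL; rewrite ltNge => /negP; apply.
  apply: rV_norm_le => [|i]; first by rewrite addr_ge0.
  by rewrite leNgt; apply/negP => zi; apply: h; exists i.
rewrite /kernv (@prodf_zero _ _ _ _ i) ?mulr0// kern_eq0// !mxE.
have M1 : 0 < M%:R :> R by rewrite ltr0n.
have yL : `|gpt R L M (q i)| <= L%:R.
  have q0 : 0 <= (q i)%:R / M%:R :> R by rewrite divr_ge0.
  have q1 : (q i)%:R / M%:R <= 2 * L%:R :> R.
    by rewrite ler_pdivrMr// -!natrM ler_nat ltnW.
  by rewrite ler_norml /gpt; lra.
by have := ler_normB (z 0 i - gpt R L M (q i)) (- gpt R L M (q i)); rewrite opprK subrK normrN; lra.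
Qed.

(* The mesh is chosen diagonally: at stage [j] it handles the multi-indices [s] with
   [pickle s <= j]. *)
Lemma kern_approx_null L0 f : test_fun f -> bsupp L0%:R f ->
  exists2 M : nat -> nat, (forall j, (0 < M j)%N) &
  null_seq (fun j z => f z - kern_approx L0.+2 j (M j) f z).
Proof.
move=> tf fs.
have /choice[m mP] : forall (ns : nat * seq 'I_n), exists m : nat,
  forall M z, (m <= M)%N -> (0 < M)%N ->
  `|gsum L0.+2 M (fun y => f y * pder (rev ns.2) (kernv ns.1) (z - y)) -
    gsum L0.+2 M (fun y => pder ns.2 f y * kernv ns.1 (z - y))| <= ns.1.+1%:R^-1.
  move=> [N s] /=.
  have [C hC] := @gsum_parts L0.+2 L0 f (kernv N) (rev s) tf (test_fun_kernv N) fs (leqW (leqnn _)).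
  exists (Num.truncn (`|C| * N.+1%:R)).+1 => M z mM M0.
  have := hC M z M0; rewrite revK => /le_trans; apply.
  have M1 : 0 < M%:R :> R by rewrite ltr0n.
  rewrite ler_pdivrMr// ler_pdivlMl// mulrC.
  apply: le_trans (_ : `|C| * N.+1%:R <= _); first by rewrite ler_wpM2r// ler_norm.
  apply: le_trans (ltW (@truncnS_gt R _)) _; by rewrite ler_nat.
(* The value 0 is neutral for a c that codes no multi-index. The sum of the [G j c] over c <= j
   dominates each of them, and the extra j + 2 in [M j] secures N + 1 < M for N = j. *)
pose G j c := if unpickle c is Some s then m (j, s) else 0%N.
pose M j := (\sum_(c < j.+1) G j c + j.+2)%N.
have Mj j : (j.+1 < M j)%N by rewrite /M addnS ltnS leq_addl.
exists M; first by move=> j; exact: leq_trans (Mj j).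
split.
- move=> j; have := smoothZ (-1) (smooth_kern_approx L0.+2 j (M j) f).
  move=> /(smoothD (test_fun_smooth tf)).
  by under eq_fun do rewrite mulN1r.
- exists (L0.+2%:R + 1) => j z zL; rewrite bsupp_kern_approx ?subr0//; last exact: leq_trans (Mj j).
  apply: fs; apply: lt_trans zL; rewrite natr1 ltr_nat; lia.
- move=> s e e0.
  have e2 : 0 < e / 3 by rewrite divr_gt0.
  have [N0 hN0] := gsum_kernv_approx (test_fun_pder s tf) (bsupp_pder s fs) e2.
  have [j0 hj0] : exists j0 : nat, forall j, (j0 <= j)%N -> j.+1%:R^-1 <= e / 3.
    exists (Num.truncn (3 / e)) => j jj; rewrite -[leRHS]invrK lef_pV2 ?posrE ?invr_gt0//.
    rewrite invf_div; apply: le_trans (ltW (@truncnS_gt R _)) _; by rewrite ler_nat.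
  exists (N0 + j0 + pickle s)%N => // j /= jj z.
  rewrite (pderB s (test_fun_smooth tf) (smooth_kern_approx L0.+2 j (M j) f)).
  rewrite (pder_kern_approx L0.+2 j (M j) f s z).
  (* The reversal is absorbed by the kernel, whose derivatives commute thanks to its product form;
     commuting those of [f] here would be circular. *)
  have ps : perm_eq s (rev s) by rewrite perm_sym perm_rev.
  rewrite (pder_kernv_perm j ps).
  have h1 := hN0 j (M j) z; have {}h1 := h1 ltac:(lia) (Mj j).
  have h2 := mP (j, s) (M j) z; have {}h2 := h2 _ (leq_trans (ltn0Sn _) (ltnW (Mj j))).
  have mM : (m (j, s) <= M j)%N.
    have cj : (pickle s < j.+1)%N by lia.
    have Gs : G j (pickle s) = m (j, s) by rewrite /G pickleK.
    have : (G j (pickle s) <= \sum_(c < j.+1) G j c)%N.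
      by rewrite (bigD1 (Ordinal cj))//= leq_addr.
    rewrite Gs /M; lia.
  have {}h2 := h2 mM; have h3 := hj0 j ltac:(lia).
  rewrite distrC; move: h1 h2 => /=.
  set A := gsum _ _ _; set B := gsum _ _ _ => h1 h2.
  have -> : B - pder s f z = (B - A) + (A - pder s f z) by ring.
  have e3 (x : R) : 0 < x -> x / 3 + x / 3 < x by move=> ?; lra.
  apply: le_lt_trans (ler_normD _ _) _.
  exact: le_lt_trans (lerD (le_trans h2 h3) h1) (e3 _ e0).
Qed.

Lemma test_fun_bsupp f : test_fun f -> exists L0 : nat, bsupp L0%:R f.
Proof.
move=> /test_funP[_ [r fr]]; exists (Num.truncn r).+1 => z zr; apply: fr.
by apply: lt_trans zr; exact: truncnS_gt.
Qed.

(* Schwarz's theorem, inherited from product kernels, for which it is evident. *)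
Lemma pder_perm f s1 s2 : test_fun f -> perm_eq s1 s2 -> pder s1 f = pder s2 f.
Proof.
move=> tf s12; have [L0 fs] := test_fun_bsupp tf.
have [M M0 [_ _ u0]] := kern_approx_null tf fs.
apply/funext => z; apply/eqP; rewrite -subr_eq0 -normr_le0; apply/ler_addgt0Pl => e e0.
rewrite addr0; have e2 : 0 < e / 2 by rewrite divr_gt0.
have E s j y := congr1 (fun g => g y)
  (pderB s (test_fun_smooth tf) (smooth_kern_approx L0.+2 j (M j) f)).
near \oo => j.
have h1 : `|pder s1 (fun z => f z - kern_approx L0.+2 j (M j) f z) z| < e / 2.
  by move: z; near: j; exact: u0.
have h2 : `|pder s2 (fun z => f z - kern_approx L0.+2 j (M j) f z) z| < e / 2.
  by move: z h1; near: j; apply: filterS (u0 s2 _ e2) => j h z _; exact: h.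
move: h1 h2; rewrite !E (pder_kern_approx L0.+2 j (M j) f s1 z).
rewrite (pder_kern_approx L0.+2 j (M j) f s2 z) (pder_kernv_perm j s12).
set G := gsum _ _ _ => h1 h2.
have -> : pder s1 f z - pder s2 f z = (pder s1 f z - G) - (pder s2 f z - G) by ring.
apply: le_trans (ler_normB _ _) _; lra.
Unshelve. all: by end_near. Qed.

(** The approximations are finite sums of translated kernels, so T of f minus an approximation is
    always T f, and it tends to 0. *)
Lemma dist_ext0 (T : ('rV[R]_n -> R) -> complex R) : Defs.distribution T ->
  (forall N y, T (fun z => kernv N (z - y)) = 0) -> forall f, test_fun f -> T f = 0.
Proof.
move=> dT T0 f tf; have [L0 fs] := test_fun_bsupp tf.
have [M M0 nseq] := kern_approx_null tf fs.
have tk N y : test_fun (fun z => kernv N (z - y)) by exact/test_fun_shift/test_fun_kernv.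
have E j : T (fun z => f z - kern_approx L0.+2 j (M j) f z) = T f.
  rewrite distB//; last by apply/test_funZ/test_fun_sum => q; exact: test_funZ.
  rewrite /kern_approx /gsum distZ//; last by apply/test_fun_sum => q; exact: test_funZ.
  rewrite dist_sum//; last by move=> q; exact: test_funZ.
  by rewrite big1 ?mulr0 ?subr0// => q _; rewrite distZ// T0 mulr0.
have /distributionP[_ /(_ _ nseq) c] := dT.
apply/cnorm_eq0/eqP; rewrite eq_le cnorm_ge0 andbT; apply/ler_addgt0Pl => e e0.
have := c e e0; rewrite addr0 => -[j0 _ /(_ j0 (leqnn _))] /=.
by rewrite E => /ltW.
Qed.

End Density.

(** * Uniqueness for ordinary differential equations in one variable *)

(** Multiplication by X shifts the sequence [a]. Read for a differential operator applied to a
    solution, one linear factor of the operator is absorbed into the solution. *)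
Lemma sum_coef_mulXsub (K : comNzRingType) (p : {poly K}) (c : K) (a : nat -> K) k :
  size p = k -> \sum_(l < k.+1) (p * ('X - c%:P))`_l * a l =
                \sum_(l < k) p`_l * (a l.+1 - c * a l).
Proof.
move=> sp.
have E (l : nat) : (p * ('X - c%:P))`_l = (if l == 0%N then 0 else p`_l.-1) - c * p`_l.
  by rewrite mulrBr coefB coefMX coefMC mulrC.
under eq_bigr => l _ do rewrite E mulrBl.
rewrite sumrB big_ord_recl /= mul0r add0r [X in _ - X]big_ord_recr /=.
rewrite (nth_default 0 (_ : (size p <= k)%N)) ?sp// mulr0 mul0r addr0 -sumrB.
by apply: eq_bigr => l _; rewrite /bump /= add1n /=; ring.
Qed.

Section ShiftODE.
Variable R : realType.
Local Notation C := (complex R).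

(** Difference quotients converge to the derivative in D: two mean values bound [pder s] of the
    error by |h| times a bound on a derivative of [f] two orders higher. [B] keeps the supports in
    one ball, and [pder_perm] commutes i past s. *)
Lemma shift_null n (f : 'rV[R]_n -> R) i (h : nat -> R) B : test_fun f ->
  (forall j, h j != 0) -> (forall j, `|h j| <= B) -> h @ \oo --> 0 ->
  null_seq (fun j z => (h j)^-1 * (f (z + h j *: ebasis R i) - f z) - pder [:: i] f z).
Proof.
move=> tf h0 hB hl; have sf := test_fun_smooth tf.
have sS j : smooth (fun z => f (z + h j *: ebasis R i)) by exact: smooth_shift.
have sN (g : 'rV[R]_n -> R) : smooth g -> smooth (fun z => - g z).
  by move=> /(smoothZ (-1)); under eq_fun do rewrite mulN1r.
have sD j : smooth (fun z => f (z + h j *: ebasis R i) - f z).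
  exact: (smoothD (sS j) (sN _ sf)).
have sP : smooth (pder [:: i] f) by exact: smooth_pder.
split.
- by move=> j; exact: (smoothD (smoothZ _ (sD j)) (sN _ sP)).
- have /test_funP[_ [r fr]] := tf; exists (`|r| + B) => j z zr.
  have rz : r < `|z|.
    apply: le_lt_trans zr; apply: le_trans (ler_norm r) _; rewrite lerDl.
    by apply: le_trans (hB 0%N).
  rewrite (bsupp_pder [:: i] fr)// (fr z)// fr ?subr0 ?mulr0//.
  have := ler_normB (z + h j *: ebasis R i) (h j *: ebasis R i); rewrite addrK => zn.
  have : `|h j *: ebasis R i| <= B.
    rewrite normrZ; apply: le_trans (hB j).
    by apply: ler_piMr => //; exact: ebasis_norm.
  have := ler_norm r; lra.
- move=> s e e0.
  have [K K0 hK] := test_fun_bounded (test_fun_pder [:: i, i & s] tf).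
  have K1 : 0 < K + 1 by rewrite ltr_wpDl.
  have ec : 0 < e / (K + 1) by rewrite divr_gt0.
  move/cvgrPdist_lt : hl => /(_ _ ec); apply: filterS => j hj z.
  rewrite sub0r normrN in hj.
  rewrite (pderB s (smoothZ (h j)^-1 (sD j)) sP) (pderZ s _ (sD j)) (pderB s (sS j) sf).
  rewrite (pder_shift s _ sf) -pder_rcons.
  have ps : perm_eq (rcons s i) (i :: s) by rewrite perm_rcons.
  rewrite (pder_perm tf ps).
  have sFs := smooth_pder s sf.
  have d1 x : derivable (pder s f) x (ebasis R i) by have [_] := sf s; apply.
  have d2 x : derivable (pder (i :: s) f) x (ebasis R i) by have [_] := sf (i :: s); apply.
  have [th t1 t2] := mvt_line z (h j) d1.
  have [th' t3 t4] := mvt_line z th d2.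
  rewrite t2 mulKf// -[X in X - _]/(pder (i :: s) f (z + th *: ebasis R i)) t4 normrM.
  apply: (@le_lt_trans _ _ (`|h j| * (K + 1))); last by rewrite -ltr_pdivlMr.
  apply: ler_pM => //; apply: le_trans (hK _) _; by rewrite lerDl.
Qed.

(** [P] stands for the real or the imaginary part, so that the calculus stays real. The limit is
    taken along sequences, the form in which continuity of a distribution is stated. *)
Lemma dist_shift_derive n (T : ('rV[R]_n -> R) -> C) (f : 'rV[R]_n -> R) i
    (P : C -> R) (tau : R) :
  (forall x y, P (x - y) = P x - P y) -> (forall (a : R) x, P ((a%:C)%C * x) = a * P x) ->
  (forall x, `|P x| <= cnorm x) ->
  Defs.distribution T -> test_fun f ->
  is_derive tau 1 (fun t => P (T (fun z => f (z + t *: ebasis R i))))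
    (P (T (fun z => pder [:: i] f (z + tau *: ebasis R i)))).
Proof.
move=> PB PZ Pn dT tf; pose ft z := f (z + tau *: ebasis R i).
have tft : test_fun ft by exact: test_fun_shift.
have E1 : (fun z => pder [:: i] f (z + tau *: ebasis R i)) = pder [:: i] ft.
  by rewrite /ft (pder_shift [:: i] _ (test_fun_smooth tf)).
rewrite E1; set l := P _.
suff L : (fun h : R => h^-1 *: (((fun t =>
  P (T (fun z => f (z + t *: ebasis R i)))) \o shift tau) (h *: 1)
    - P (T (fun z => f (z + tau *: ebasis R i))))) @ 0^' --> l.
  by apply: DeriveDef; [apply/cvg_ex; eexists; exact: L|exact: cvg_lim L].
apply/cvgr_dnbhsP => u [u0 ul].
have [B hB] : exists B, forall j, `|u j| <= B.
  have /cvg_seq_bounded[B [_ hB]] : cvgn u by apply/cvg_ex; exists 0.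
  by exists (B + 1) => j; apply: (hB (B + 1)) => //; rewrite ltrDl.
have nS := shift_null i tft u0 hB ul.
have /distributionP[_ /(_ _ nS) c] := dT.
apply/cvgrPdist_lt => e /c; apply: filterS => j; apply: le_lt_trans.
have tS : test_fun (fun z => ft (z + u j *: ebasis R i)) by exact: test_fun_shift.
have tN (g : 'rV[R]_n -> R) : test_fun g -> test_fun (fun z => - g z).
  by move=> /(test_funZ (-1)); under eq_fun do rewrite mulN1r.
have tB := test_funD tS (tN _ tft).
rewrite (distB dT (test_funZ _ tB) (test_fun_pder [:: i] tft)) (distZ dT _ tB) (distB dT tS tft).
rewrite distrC; apply: le_trans (Pn _); rewrite PB PZ PB /= /GRing.scale /= mulr1.
rewrite (_ : (fun z => f (z + (u j + tau) *: ebasis R i)) =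
  (fun z => ft (z + u j *: ebasis R i))) //.
by apply/funext => z; rewrite /ft scalerDl addrA.
Qed.

(* [|w|^2 exp(-2 Re(lam) t)] has zero derivative, where [w t] is [W] of the translate. *)
Lemma first_order_unique n (W : ('rV[R]_n -> R) -> C) (g : 'rV[R]_n -> R) i (lam : C) (tau0 : R) :
  Defs.distribution W -> test_fun g ->
  (forall t : R, W (fun z => pder [:: i] g (z + t *: ebasis R i)) =
     lam * W (fun z => g (z + t *: ebasis R i))) ->
  W (fun z => g (z + tau0 *: ebasis R i)) = 0 -> W g = 0.
Proof.
move=> dW tg eqW W0.
pose w (t : R) := W (fun z => g (z + t *: ebasis R i)).
pose a (t : R) := complex.Re (w t); pose b (t : R) := complex.Im (w t).
have da (t : R) : is_derive t 1 a (complex.Re (lam * w t)).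
  rewrite -eqW; apply: (@dist_shift_derive n W g i (@complex.Re R) t) => //.
  - by move=> [x1 x2] [y1 y2].
  - by move=> c [x1 x2] /=; rewrite mul0r subr0.
  - exact: cnorm_Re.
have db (t : R) : is_derive t 1 b (complex.Im (lam * w t)).
  rewrite -eqW; apply: (@dist_shift_derive n W g i (@complex.Im R) t) => //.
  - by move=> [x1 x2] [y1 y2].
  - by move=> c [x1 x2] /=; rewrite mul0r addr0.
  - exact: cnorm_Im.
pose F (t : R) := (a t * a t + b t * b t) * expR (- 2 * complex.Re lam * t).
have dF (t : R) : is_derive t 1 F 0.
  have dE : is_derive t 1 (fun t => expR (- 2 * complex.Re lam * t))
      (expR (- 2 * complex.Re lam * t) * (- 2 * complex.Re lam)).
    apply: (@is_derive1_comp _ expR (fun t => - 2 * complex.Re lam * t)).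
    by apply: (@is_derive_eq _ _ _ (fun t : R => - 2 * complex.Re lam * t));
      rewrite /GRing.scale /=; ring.
  have dA : is_derive t 1 (fun t => a t * a t + b t * b t)
     (a t * complex.Re (lam * w t) + a t * complex.Re (lam * w t) +
     (b t * complex.Im (lam * w t) + b t * complex.Im (lam * w t))).
    have dM (c : R -> R) c' : is_derive t 1 c c' ->
        is_derive t 1 (fun t => c t * c t) (c t * c' + c t * c').
      by move=> dc; exact: (@is_deriveM _ _ c c).
    exact: (@is_deriveD _ _ _ (fun t => a t * a t) (fun t => b t * b t) _ _ _ _
             (dM _ _ (da t)) (dM _ _ (db t))).
  have dM := @is_deriveM _ _ _ _ _ _ _ _ dA dE.
  apply: (@is_derive_eq _ _ _ F _ _ _ _ dM).
  rewrite /GRing.scale /= /a /b; case: (w t) => x y; case: (lam) => l1 l2 /=; ring.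
have F0 : F 0 = F tau0 by exact: is_derive_0_is_cst.
move: F0; rewrite /F /a /b {2 3 4 5 6 7 8}/w W0 /= !mulr0 addr0 mul0r expR0 mulr1 => h.
have w0 : w 0 = W g by rewrite /w; congr W; apply/funext => z; rewrite scale0r addr0.
rewrite -w0; apply/cnorm_eq0; rewrite /cnorm normc_def /= !expr2 h sqrtr0 //.
Qed.

(** Induction on the degree: if q = q1 (X - lam), then [W1] = (d/dt - lam) W solves the equation of
    q1 and still vanishes on the past, so it is 0 on [G], and W solves a first-order equation. [G]
    is a parameter because the equation will be available on special test functions only. The margin
    d > 0 leaves room for an open set where g vanishes, so that derivatives inherit the
    condition. *)
Lemma ode_unique n (i : 'I_n) (G : ('rV[R]_n -> R) -> Prop) (q : {poly C}) :
  (forall g, G g -> test_fun g) -> (forall g, G g -> G (pder [:: i] g)) ->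
  (forall g (t : R), G g -> G (fun z => g (z + t *: ebasis R i))) ->
  q != 0 -> forall W, Defs.distribution W ->
  (forall g, G g -> (exists2 d : R, 0 < d & forall z : 'rV[R]_n, - d <= z 0 i -> g z = 0) ->
    W g = 0) ->
  (forall g, G g -> \sum_(l < size q) q`_l * ((-1) ^+ l * W (pder (nseq l i) g)) = 0) ->
  forall g, G g -> W g = 0.
Proof.
move=> Gt Gd Gs; elim: {q}(size q) {-2}q (erefl (size q)) => [|k IH] q sq q0 W dW Wneg Wq g Gg.
  by move/eqP: sq; rewrite size_poly_eq0 (negbTE q0).
have [k0|k0] := eqVneq k 0%N.
  have lq : lead_coef q = q`_0 by rewrite lead_coefE sq k0.
  have := Wq g Gg; rewrite sq k0 big_ord1 expr0 mul1r /= -lq => /eqP.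
  by rewrite mulf_eq0 lead_coef_eq0 (negbTE q0) => /eqP.
have /closed_rootP[lam] : size q != 1%N by rewrite sq eqSS.
move=> /factor_theorem[q1 qE].
have q10 : q1 != 0 by apply: contra_neq q0 => q10; rewrite qE q10 mul0r.
have sq1 : size q1 = k.
  have := sq; rewrite qE size_Mmonic ?monicXsubC// size_XsubC addn2 /= => -[].
  by [].
pose W1 (f : 'rV[R]_n -> R) := (-1) * W (pder [:: i] f) + (- lam) * W f.
have dW1 : Defs.distribution W1 by apply: dist_comb => //; exact: dist_pder.
have W1q f : G f -> \sum_(l < size q1) q1`_l * ((-1) ^+ l * W1 (pder (nseq l i) f)) = 0.
  move=> Gf; rewrite -[RHS](Wq f Gf) sq sq1.
  rewrite qE (@sum_coef_mulXsub _ q1 lam (fun l => (-1) ^+ l * W (pder (nseq l i) f)) k sq1).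
  apply: eq_bigr => l _; rewrite /W1 -[pder [:: i] (pder _ _)]/(pder (nseq l.+1 i) f).
  by rewrite exprS; ring.
have W1neg f : G f -> (exists2 d : R, 0 < d & forall z : 'rV[R]_n, - d <= z 0 i -> f z = 0) ->
  W1 f = 0.
  move=> Gf [d d0 fd]; rewrite /W1 (Wneg f)//; last by exists d.
  rewrite Wneg ?mulr0 ?addr0//; first exact: Gd.
  exists (d / 2); first by rewrite divr_gt0.
  move=> z zd; rewrite /= (@near_eq_derive _ _ _ _ (cst 0)); first exact: derive_cst.
  have : \forall y \near z, - d < (y : 'rV[R]_n) 0 i.
    have /cvgrPdist_lt := @coord_continuous R 1 n 0 i z.
    move=> /(_ (d / 2)); rewrite divr_gt0// => /(_ isT); apply: filterS => y hy.
    have := le_lt_trans (ler_norm _) hy; lra.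
  by apply: filterS => y /ltW; exact: fd.
have W10 := IH q1 sq1 q10 W1 dW1 W1neg W1q.
have /test_funP[_ [r gr]] := Gt g Gg.
have [tau0 Wtau] : exists tau0 : R, W (fun z => g (z + tau0 *: ebasis R i)) = 0.
  (* The translated function is supported in z_i <= -2, so the margin 1 is available: this is the
     starting value of the first-order equation. *)
  exists (`|r| + 2); apply: Wneg; first exact: Gs.
  exists 1 => // z z1; apply: gr; apply: lt_le_trans (rV_norm_coord _ i).
  rewrite /ebasis !mxE !eqxx mulr1; apply: lt_le_trans (ler_norm _).
  by have := ler_norm r; lra.
apply: (@first_order_unique n W g i (- lam) tau0) => //; first exact: Gt.
move=> t; have := W10 _ (Gs g t Gg); rewrite /W1 (pder_shift [:: i] _ (test_fun_smooth (Gt g Gg))).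
by rewrite mulN1r addrC => /eqP; rewrite subr_eq0 => /eqP ->.
Qed.

End ShiftODE.

(** * Adapted coordinates *)

Section Coordinates.
Variables (R : realType) (d : nat).

Definition wid (i : 'I_d) : 'I_d.+1 := widen_ord (leqnSn d) i.

(** Reconciles the two encodings of the space indices: [widen_ord] in [xpart], [unlift ord_max] in
    [ivt]. *)
Lemma lift_max i : lift ord_max i = wid i.
Proof. by apply/val_inj; rewrite /= /bump leqNgt ltn_ord. Qed.

Lemma unlift_wid i : unlift ord_max (wid i) = Some i.
Proof. by rewrite -lift_max liftK. Qed.

Lemma wid_neq i : (wid i == ord_max) = false.
Proof. by rewrite -lift_max eq_sym; apply/negbTE; exact: neq_lift. Qed.

Lemma wid_max (j : 'I_d.+1) : j = ord_max \/ exists i, j = wid i.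
Proof.
case: (unliftP ord_max j) => [i ->|->]; last by left.
by right; exists i; rewrite lift_max.
Qed.

(** The block matrix diag(B, 1). Using [unlift] keeps the index type ['I_d.+1], which [block_mx]
    would turn into ['I_(d + 1)]. *)
Definition extmx (B : 'M[R]_d) : 'M[R]_d.+1 := \matrix_(i, j)
  match unlift ord_max i, unlift ord_max j with
  | Some a, Some b => B a b | None, None => 1 | _, _ => 0
  end.

Lemma extmx_ww B i j : extmx B (wid i) (wid j) = B i j.
Proof. by rewrite mxE !unlift_wid. Qed.
Lemma extmx_wm B i : extmx B (wid i) ord_max = 0.
Proof. by rewrite mxE unlift_wid unlift_none. Qed.
Lemma extmx_mw B i : extmx B ord_max (wid i) = 0.
Proof. by rewrite mxE unlift_wid unlift_none. Qed.
Lemma extmx_mm B : extmx B ord_max ord_max = 1.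
Proof. by rewrite mxE unlift_none. Qed.

Lemma extmxM B B' : extmx B *m extmx B' = extmx (B *m B').
Proof.
apply/matrixP => i j; rewrite mxE big_ord_recr /=.
have [->|[i' ->]] := wid_max i; have [->|[j' ->]] := wid_max j;
  rewrite ?extmx_ww ?extmx_wm ?extmx_mw ?extmx_mm ?mulr0 ?mulr1 ?addr0.
- by rewrite big1 ?add0r// => k _; rewrite -/(wid k) extmx_mw mul0r.
- by rewrite big1 // => k _; rewrite -/(wid k) extmx_mw mul0r.
- by rewrite big1 // => k _; rewrite -/(wid k) extmx_wm mulr0.
- by rewrite mxE; apply: eq_bigr => k _; rewrite -/(wid k) !extmx_ww.
Qed.

Lemma extmx1 : extmx 1%:M = 1%:M.
Proof.
apply/matrixP => i j.
have [->|[i' ->]] := wid_max i; have [->|[j' ->]] := wid_max j;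
  rewrite ?extmx_ww ?extmx_wm ?extmx_mw ?extmx_mm !mxE ?eqxx ?wid_neq//.
by rewrite eq_sym wid_neq.
Qed.

Lemma extmx_unit B : B \in unitmx -> extmx B \in unitmx.
Proof.
move=> uB; have := @mulmx1_unit _ _ (extmx B) (extmx (invmx B)).
by rewrite extmxM mulmxV// extmx1 => /(_ erefl)[].
Qed.

Lemma mul_extmx_wid (z : 'rV[R]_d.+1) B i : (z *m extmx B) 0 (wid i) = (xpart z *m B) 0 i.
Proof.
rewrite !mxE big_ord_recr /= extmx_mw mulr0 addr0; apply: eq_bigr => k _.
by rewrite -/(wid k) extmx_ww mxE.
Qed.

Lemma mul_extmx_max (z : 'rV[R]_d.+1) B : (z *m extmx B) 0 ord_max = tpart z.
Proof.
rewrite !mxE big_ord_recr /= extmx_mm mulr1 big1 ?add0r// => k _.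
by rewrite -/(wid k) extmx_wm mulr0.
Qed.

Lemma row_extmx_max B : row ord_max (extmx B) = ebasis R ord_max.
Proof.
apply/rowP => j; rewrite !mxE eqxx /= unlift_none.
by have [->|[i ->]] := wid_max j; rewrite ?unlift_none ?eqxx// unlift_wid wid_neq.
Qed.

(** Periodicity is given on tensors, and product functions in lattice coordinates are tensors. *)
Lemma prodf_tensor (psi : 'I_d.+1 -> R -> R) B (z : 'rV[R]_d.+1) :
  prodf psi (z *m extmx B) =
  tensor (fun x => prodf (fun i => psi (wid i)) (x *m B))
         (fun s => psi ord_max (s 0 0)) z.
Proof.
rewrite /prodf /tensor big_ord_recr /= mul_extmx_max mxE; congr (_ * _).
by apply: eq_bigr => i _; rewrite -/(wid i) mul_extmx_wid.
Qed.

Lemma mi_seq_split (m : 'I_d.+1 -> nat) :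
  mi_seq m = flatten [seq nseq (m (wid i)) (wid i) | i <- enum 'I_d] ++
             nseq (m ord_max) ord_max.
Proof.
rewrite /mi_seq enum_ordSr map_rcons flatten_rcons; congr (flatten _ ++ _).
by rewrite -map_comp.
Qed.

End Coordinates.

(** Evaluates the linear functional X^l -> a_l on a sum of monomials. Monomials may cancel, so
    [size q] says little about the exponents; the proof replaces it by a common bound [N]. *)
Lemma sum_poly_coef (K : comNzRingType) (I : Type) (r : seq I) (c : I -> K) (e : I -> nat)
    (a : nat -> K) :
  let q := \sum_(m <- r) c m *: 'X^(e m) in
  \sum_(l < size q) q`_l * a l = \sum_(m <- r) c m * a (e m).
Proof.
move=> q; pose N := (size q + \sum_(m <- r) (e m).+1)%N.
have E : \sum_(l < size q) q`_l * a l = \sum_(l < N) q`_l * a l.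
  rewrite -!(big_mkord xpredT (fun l => q`_l * a l)) [RHS](big_cat_nat _ (n := size q))//=;
    last first.
    exact: leq_addr.
  rewrite [X in _ + X]big_nat_cond [X in _ + X]big1 ?addr0// => l /andP[/andP[h _] _].
  by rewrite nth_default// mul0r.
have eN : all (fun m => (e m < N)%N) r.
  rewrite /N; elim: (r) (size q) => [//|m r' IH] k /=; rewrite big_cons; apply/andP; split;
    first by lia.
  have := IH (k + (e m).+1)%N; by rewrite addnA.
rewrite E {E}; clearbody N; rewrite {}/q; elim: r eN => [|m r IH] /=.
  by move=> _; rewrite !big_nil big1// => l _; rewrite coef0 mul0r.
move=> /andP[mN /IH {}IH]; rewrite [RHS]big_cons -IH.
under eq_bigr do rewrite big_cons coefD mulrDl.
rewrite big_split /=; congr (_ + _).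
rewrite (bigD1 (Ordinal mN))//= coefZ coefXn eqxx mulr1 big1 ?addr0// => l lm.
rewrite coefZ coefXn (_ : (l == e m :> nat) = false) ?mulr0 ?mul0r//.
by apply/negbTE; apply: contra lm => /eqP h; apply/eqP/val_inj.
Qed.

Lemma cosD2piz (R : realType) (x : R) (m : int) : cos (x + 2 * pi * m%:~R) = cos x.
Proof.
have h (n : nat) (y : R) : cos (y + 2 * pi * n%:R) = cos y.
  by rewrite -[RHS](periodicn (@cosD2pi R) n y) mulr_natr -(mulr_natl pi 2).
case: m => n; first exact: h.
rewrite NegzE mulrNz mulrN -(h n.+1) -[n.+1%:~R]/(n.+1%:R); congr cos; ring.
Qed.

Lemma sinD2piz (R : realType) (x : R) (m : int) : sin (x + 2 * pi * m%:~R) = sin x.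
Proof. by rewrite -!cosBpihalf addrAC cosD2piz. Qed.

(** * Uniqueness of periodic solutions *)

(** Duality gives (-1)^|m|, and each space derivative of exp(- i v.x) gives - i v_j: the signs in
    space cancel and the one in time remains. *)
Lemma sign_mdeg (K : comNzRingType) d (m : mpoly.multinom d.+1) (w : 'I_d -> K) :
  (-1) ^+ mpoly.mdeg m * \prod_(i < d) (- w i) ^+ mpoly.fun_of_multinom m (wid i) =
  (-1) ^+ mpoly.fun_of_multinom m ord_max *
    \prod_(i < d) w i ^+ mpoly.fun_of_multinom m (wid i).
Proof.
set fm := mpoly.fun_of_multinom m.
have -> : mpoly.mdeg m = (\sum_(i < d) fm (wid i) + fm ord_max)%N.
  by rewrite mpoly.mdegE big_ord_recr.
rewrite exprD.
have -> : (-1) ^+ (\sum_(i < d) fm (wid i)) = \prod_(i < d) (-1) ^+ fm (wid i) :> K.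
  by elim/big_rec2: _ => [|i x1 x2 _ IH]; rewrite ?expr0// exprD IH.
rewrite mulrAC -big_split /= mulrC; congr (_ * _).
by apply: eq_bigr => i _; rewrite -exprMn mulN1r opprK.
Qed.

Section Uniqueness.
Variables (R : realType) (d : nat) (A : 'M[R]_d).
Hypothesis uA : A \in unitmx.
Variable u : ('rV[R]_d.+1 -> R) -> complex R.
Hypothesis du : Defs.distribution u.
Local Notation C := (complex R).

(** The row z Lam holds lattice coordinates: the k-th period becomes the k-th basis vector, and t is
    unchanged. *)
Let Lam : 'M[R]_d.+1 := extmx (invmx A).

Definition latv k : 'rV[R]_d.+1 := row (wid k) (extmx A).

Let uiA : invmx A \in unitmx. Proof. by rewrite unitmx_inv. Qed.

Let uLam : Lam \in unitmx. Proof. exact: extmx_unit. Qed.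

Let latv_Lam k : latv k *m Lam = ebasis R (wid k).
Proof. by rewrite /latv -row_mul extmxM mulmxV// extmx1 row1. Qed.

Lemma xpart_latv z k : xpart (z + latv k) = xpart z + row k A.
Proof. by apply/rowP => j; rewrite !mxE !unlift_wid. Qed.

Lemma tpart_latv z k : tpart (z + latv k) = tpart z.
Proof. by rewrite /tpart !mxE unlift_wid unlift_none addr0. Qed.

Lemma test_fun_coord1 (phi : R -> R) : test1 phi -> test_fun (fun s : 'rV[R]_1 => phi (s 0 0)).
Proof.
move=> tphi; have := @test_fun_prodf R 1 (fun=> phi) (fun=> tphi).
by congr test_fun; apply/funext => s; rewrite /prodf big_ord1.
Qed.

Let test_Lam (psi : 'I_d.+1 -> R -> R) : (forall i, test1 (psi i)) ->
  test_fun (fun z => prodf psi (z *m Lam)).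
Proof.
move=> tpsi; have := test_fun_affine 0 uLam (test_fun_prodf tpsi).
by congr test_fun; apply/funext => z; rewrite add0r.
Qed.

(** The density result transported by [Lam], so that the factors of the kernels are aligned with the
    periods. *)
Lemma dist_Lam_ext0 (w : ('rV[R]_d.+1 -> R) -> C) : Defs.distribution w ->
  (forall N (y : 'rV[R]_d.+1), w (fun z => prodf (fun i s => kern N (s - y 0 i)) (z *m Lam)) = 0) ->
  forall f, test_fun f -> w f = 0.
Proof.
move=> dw w0 f tf.
have := dist_ext0 (dist_affine dw 0 uLam).
have E (g : 'rV[R]_d.+1 -> R) : (fun z => g (0 + z *m Lam)) = (fun z => g (z *m Lam)).
  by apply/funext => z; rewrite add0r.
have h0 N y : w (fun z => kernv N (0 + z *m Lam - y)) = 0.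
  rewrite -(w0 N y); congr w; apply/funext => z; rewrite add0r.
  by apply: eq_bigr => i _; rewrite !mxE.
move=> /(_ h0 (fun z => f (0 + z *m extmx A)) (test_fun_affine 0 (extmx_unit uA) tf)) <-.
by congr w; apply/funext => z; rewrite !add0r -mulmxA extmxM mulVmx// extmx1 mulmx1.
Qed.

Lemma periodic_test : periodic_dist A u ->
  forall k f, test_fun f -> u (fun z => f (z + latv k)) = u f.
Proof.
move=> uper k f tf.
pose w f := 1 * u (fun z => f (z + latv k)) + (-1) * u f.
have dw : Defs.distribution w by apply: dist_comb => //; exact: dist_shift.
suff : w f = 0 by rewrite /w mul1r mulN1r => /eqP; rewrite subr_eq0 => /eqP.
apply: dist_Lam_ext0 => // N y.
pose psi x := prodf (fun i s => kern N (s - y 0 (wid i))) (x *m invmx A) : R.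
pose phi (s : 'rV[R]_1) := kern N (s 0 0 - y 0 ord_max).
have E : (fun z => prodf (fun i s => kern N (s - y 0 i)) (z *m Lam)) = tensor psi phi.
  by apply/funext => z; rewrite prodf_tensor.
rewrite E /w.
have -> : (fun z => tensor psi phi (z + latv k)) = tensor (fun x => psi (x + row k A)) phi.
  by apply/funext => z; rewrite /tensor xpart_latv tpart_latv.
rewrite uper ?mul1r ?mulN1r ?subrr//.
  exact/(@test_fun_coord1 (fun s => kern N (s - y 0 ord_max)))/test1_shift/test1_kern.
have := @test_fun_affine R d (invmx A) 0 (prodf (fun i s => kern N (s - y 0 (wid i)))) uiA.
have tk : test_fun (prodf (fun i s => kern N (s - y 0 (wid i)))).
  by apply: test_fun_prodf => i; exact/test1_shift/test1_kern.
by move=> /(_ tk); congr test_fun; apply/funext => x; rewrite add0r.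
Qed.

Hypothesis uper : forall k f, test_fun f -> u (fun z => f (z + latv k)) = u f.

(* [phase k z = v.x] for [z = (x, t)] and [v = A^-1 (2 pi k)], see [freq_wid]. *)
Definition freq (k : 'I_d -> int) : 'cV[R]_d.+1 :=
  \col_i match unlift ord_max i with Some a => 2 * pi * (k a)%:~R | None => 0 end.

Definition phase (k : 'I_d -> int) (z : 'rV[R]_d.+1) : R := (z *m Lam *m freq k) 0 0.

Lemma phaseE k z : phase k z = (z *m (Lam *m freq k)) 0 0.
Proof. by rewrite /phase mulmxA. Qed.

Lemma phase_latv k z l : phase k (z + latv l) = phase k z + 2 * pi * (k l)%:~R.
Proof.
rewrite /phase !mulmxDl latv_Lam ebasis_mul mxE; congr (_ + _).
by rewrite !mxE unlift_wid.
Qed.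

Lemma smooth_phase k (phi : R -> R) : smooth1 phi -> smooth (fun z => phi (phase k z)).
Proof.
move=> sphi; have := smooth_ridge (Lam *m freq k) sphi.
by under eq_fun do rewrite -phaseE.
Qed.

Lemma pder_phase k (phi : R -> R) j : smooth1 phi ->
  pder [:: j] (fun z => phi (phase k z)) = (fun z => (Lam *m freq k) j 0 * derive1 phi (phase k z)).
Proof.
move=> sphi; have := pder1_ridge j (Lam *m freq k) sphi.
by under eq_fun do rewrite -phaseE; under [X in _ = X -> _]eq_fun do rewrite -phaseE.
Qed.

(* The pairing of [u] with [pder s (g * exp(- i * phase k))]. *)
Definition twist k s (g : 'rV[R]_d.+1 -> R) : C :=
  1 * u (pder s (fun z => g z * cos (phase k z))) +
  (- 'i%C) * u (pder s (fun z => g z * sin (phase k z))).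

Lemma dist_pders n (T : ('rV[R]_n -> R) -> C) s : Defs.distribution T ->
  Defs.distribution (fun f => T (pder s f)).
Proof.
elim: s T => [//|i s IH] T dT.
exact: (IH (fun f => T (pder [:: i] f)) (dist_pder dT i)).
Qed.

Lemma dist_twist k s : Defs.distribution (twist k s).
Proof.
apply: dist_comb; apply: (dist_mul (T := fun f => u (pder s f))); rewrite ?dist_pders//.
  exact: dist_pders.
  by apply: smooth_phase; exact: smooth1_cos.
  exact: dist_pders.
by apply: smooth_phase; exact: smooth1_sin.
Qed.

(** Leibniz with exp(- i phase). On bumps only one term will survive: the second in space
    directions, by periodicity, and the first in the time direction, where the frequency is 0. *)
Lemma twist_rcons k s j g : test_fun g ->
  twist k (rcons s j) g = twist k s (pder [:: j] g) +
    (- 'i%C * (((Lam *m freq k) j 0)%:C)%C) * twist k s g.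
Proof.
move=> tg; have sg := test_fun_smooth tg; set v := (Lam *m freq k) j 0.
have sc : smooth (fun z => cos (phase k z)) by apply: smooth_phase; exact: smooth1_cos.
have ss : smooth (fun z => sin (phase k z)) by apply: smooth_phase; exact: smooth1_sin.
have tgc := test_funM tg sc; have tgs := test_funM tg ss.
have tdc := test_funM (test_fun_pder [:: j] tg) sc.
have tds := test_funM (test_fun_pder [:: j] tg) ss.
have dus := dist_pders s du.
have Ec : pder [:: j] (fun z => g z * cos (phase k z)) =
    (fun z => pder [:: j] g z * cos (phase k z) + (- v) * (g z * sin (phase k z))).
  rewrite (pder1M j sg sc) (pder_phase k j (@smooth1_cos R)) derive1_cos.
  by apply/funext => z; rewrite /v; ring.
have Es : pder [:: j] (fun z => g z * sin (phase k z)) =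
    (fun z => pder [:: j] g z * sin (phase k z) + v * (g z * cos (phase k z))).
  rewrite (pder1M j sg ss) (pder_phase k j (@smooth1_sin R)) derive1_sin.
  by apply/funext => z; rewrite /v; ring.
rewrite /twist !pder_rcons Ec Es.
rewrite (distD dus tdc (test_funZ _ tgs)) (distD dus tds (test_funZ _ tgc)).
rewrite (distZ dus _ tgs) (distZ dus _ tgc) rmorphN /=.
set a := u _; set b := u _; set c := u _; set e := u _.
have i2 : 'i%C * 'i%C = -1 :> C by rewrite -expr2 sqr_i.
transitivity (1 * a + - 'i%C * c + (- 'i%C * (v%:C)%C) * e + ('i%C * 'i%C) * (v%:C)%C * b).
  by rewrite i2; ring.
by ring.
Qed.

Lemma twist_latv k s l g : test_fun g ->
  twist k s (fun z => g (z + latv l)) = twist k s g.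
Proof.
move=> tg.
have E (phi : R -> R) : smooth1 phi -> (forall x (m : int), phi (x + 2 * pi * m%:~R) = phi x) ->
    u (pder s (fun z => g (z + latv l) * phi (phase k z))) =
    u (pder s (fun z => g z * phi (phase k z))).
  move=> sphi pphi.
  have tgp := test_funM tg (smooth_phase k sphi).
  rewrite -[RHS](uper l (test_fun_pder s tgp)) -(pder_shift s (latv l) (test_fun_smooth tgp)).
  by congr (u (pder s _)); apply/funext => z; rewrite phase_latv pphi.
rewrite /twist !E//; [exact: smooth1_sin|exact: sinD2piz|exact: smooth1_cos|exact: cosD2piz].
Qed.

Definition cell (y : 'I_d -> R) (phi : R -> R) (i : 'I_d.+1) : R -> R :=
  match unlift ord_max i with Some a => fun s => chi (s - y a) | None => phi end.

Definition bump y phi (z : 'rV[R]_d.+1) : R := prodf (cell y phi) (z *m Lam).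

Lemma test1_cell y phi i : test1 phi -> test1 (cell y phi i).
Proof. by move=> tphi; rewrite /cell; case: unlift => // a; exact/test1_shift/test1_chi. Qed.

Lemma test_fun_bump y phi : test1 phi -> test_fun (bump y phi).
Proof. by move=> tphi; apply: test_Lam => i; exact: test1_cell. Qed.

Let pder_bump y phi j : test1 phi -> pder [:: j] (bump y phi) =
  (fun z => \sum_l Lam j l * pder [:: l] (prodf (cell y phi)) (z *m Lam)).
Proof.
move=> tphi; have sp : smooth (prodf (cell y phi)).
  by apply: smooth_prodf => i; have [] := test1_cell y i tphi.
have := pder1_affine j 0 Lam sp.
by under eq_fun do rewrite add0r; under [X in _ = X -> _]eq_fun do under eq_bigr do rewrite add0r.
Qed.

Lemma pder_bump_max y phi : test1 phi -> pder [:: ord_max] (bump y phi) = bump y (derive1 phi).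
Proof.
move=> tphi; rewrite pder_bump//; apply/funext => z.
rewrite big_ord_recr /= extmx_mm mul1r big1 ?add0r; last first.
  by move=> l _; rewrite -/(wid l) /Lam extmx_mw mul0r.
rewrite -[LHS]/(pder [:: ord_max] (prodf (cell y phi)) (z *m Lam)) pder1_prodf; last first.
  by move=> i; have [] := test1_cell y i tphi.
rewrite /bump; congr (prodf _ _); apply/funext => i.
have [->|[a ->]] := wid_max i; first by rewrite eqxx /cell unlift_none.
by rewrite wid_neq /cell unlift_wid.
Qed.

(* Since [chi s = step (s + 1) - step s], a derivative of [bump] in a space direction
   is a sum of differences of lattice translates, which [twist] cannot see. *)
Lemma twist_pder_bump k s y phi j : test1 phi ->
  twist k s (pder [:: wid j] (bump y phi)) = 0.
Proof.
move=> tphi; have dT := dist_twist k s.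
(* The bump with its l-th factor [chi] replaced by the derivative of [step], which has compact
   support although [step] has not. Translation by the l-th period adds 1 to that coordinate
   alone. *)
pose zeta (l : 'I_d) (z : 'rV[R]_d.+1) :=
  prodf (fun i => if i == wid l then (fun s => derive1 (@step R) (s - y l)) else cell y phi i)
   (z *m Lam) : R.
have tz l : test_fun (zeta l).
  apply: test_Lam => i; case: eqP => _; last exact: test1_cell.
  exact/test1_shift/test1_dstep.
have E : pder [:: wid j] (bump y phi) =
    (fun z => \sum_(l < d) invmx A j l * (zeta l (z + latv l) - zeta l z)).
  rewrite pder_bump//; apply/funext => z.
  rewrite big_ord_recr /= extmx_wm mul0r addr0; apply: eq_bigr => l _.
  rewrite -/(wid l) /Lam extmx_ww; congr (_ * _).
  rewrite -[LHS]/(pder [:: wid l] (prodf (cell y phi)) (z *m Lam)) pder1_prodf; last first.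
    by move=> i; have [] := test1_cell y i tphi.
  rewrite /zeta mulmxDl latv_Lam /prodf.
  rewrite (bigD1 (wid l))//= [X in _ = X - _](bigD1 (wid l))//= [X in _ = _ - X](bigD1 (wid l))//=.
  rewrite !eqxx /cell unlift_wid.
  set P1 := \prod_(i | _) _; set P2 := \prod_(i | _) _; set P3 := \prod_(i | _) _.
  have -> : P2 = P1.
    apply: eq_bigr => i /negbTE il; rewrite il; congr (cell y phi i _).
    by rewrite [LHS]mxE [X in _ + X]mxE il andbF addr0.
  have -> : P3 = P1 by apply: eq_bigr => i /negbTE ->.
  rewrite -mulrBl; congr (_ * _).
  have -> : derive1 (fun s => chi (s - y l)) ((z *m Lam) 0 (wid l)) =
      derive1 (@chi R) ((z *m Lam) 0 (wid l) - y l).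
    rewrite derive1E; apply: is_deriveE; rewrite -[derive1 (@chi R) _]mulr1.
    apply: (@is_derive1_comp _ (@chi R) (fun s => s - y l)).
      by apply: smooth1_is_derive; have [] := @test1_chi R.
    by apply: (@is_derive_eq _ _ _ (fun s : R => s - y l)); rewrite subr0.
  have -> : (z *m Lam + ebasis R (wid l)) 0 (wid l) = (z *m Lam) 0 (wid l) + 1.
    by rewrite [LHS]mxE /ebasis [X in _ + X]mxE !eqxx.
  by rewrite derive1_chi addrAC.
rewrite E dist_sum//; last first.
  move=> l; apply: test_funZ.
  have := test_funD (test_fun_shift (latv l) (tz l)) (test_funZ (-1) (tz l)).
  by congr test_fun; apply/funext => z; rewrite mulN1r.
rewrite big1// => l _; rewrite distZ//.
  by rewrite distB// ?twist_latv ?subrr ?mulr0//; exact: test_fun_shift.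
have := test_funD (test_fun_shift (latv l) (tz l)) (test_funZ (-1) (tz l)).
by congr test_fun; apply/funext => z; rewrite mulN1r.
Qed.

Lemma twist_space k s y phi : test1 phi ->
  twist k [seq wid j | j <- s] (bump y phi) =
  \prod_(j <- s) (- 'i%C * (((Lam *m freq k) (wid j) 0)%:C)%C) * twist k [::] (bump y phi).
Proof.
move=> tphi; elim/last_ind: s => [|s j IH]; first by rewrite big_nil mul1r.
rewrite map_rcons twist_rcons; last exact: test_fun_bump.
by rewrite twist_pder_bump// add0r IH -cats1 big_cat big_seq1 /= mulrCA mulrA.
Qed.

Lemma freq_max k : (Lam *m freq k) ord_max 0 = 0.
Proof.
rewrite mxE big_ord_recr /= extmx_mm mul1r !mxE unlift_none addr0 big1// => l _.
by rewrite -/(wid l) /Lam extmx_mw mul0r.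
Qed.

Lemma twist_time k s l y phi : test1 phi ->
  twist k (s ++ nseq l ord_max) (bump y phi) = twist k s (bump y (derive1n l phi)).
Proof.
elim: l phi => [|l IH] phi tphi; first by rewrite cats0.
have -> : nseq l.+1 (ord_max : 'I_d.+1) = rcons (nseq l ord_max) ord_max.
  by elim: (l) => //= m <-.
rewrite -rcons_cat twist_rcons; last exact: test_fun_bump.
rewrite freq_max rmorph0 mulr0 mul0r addr0 pder_bump_max// IH; last exact: test1_derive.
by rewrite derive1Sn.
Qed.


Lemma freq_wid k i : (Lam *m freq k) (wid i) 0 =
  (invmx A *m \col_(i < d) (2 * pi * (k i)%:~R)) i 0.
Proof.
rewrite !mxE big_ord_recr /= extmx_wm mul0r addr0; apply: eq_bigr => l _.
by rewrite -/(wid l) /Lam extmx_ww !mxE unlift_wid.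
Qed.

Lemma twist_mi_seq k (m : 'I_d.+1 -> nat) y phi : test1 phi ->
  twist k (mi_seq m) (bump y phi) =
  \prod_(i < d) (- 'i%C * (((Lam *m freq k) (wid i) 0)%:C)%C) ^+ m (wid i) *
    twist k [::] (bump y (derive1n (m ord_max) phi)).
Proof.
move=> tphi; rewrite mi_seq_split twist_time//.
have -> : flatten [seq nseq (m (wid i)) (wid i) | i <- enum 'I_d] =
    [seq wid j | j <- flatten [seq nseq (m (wid i)) i | i <- enum 'I_d]].
  rewrite map_flatten -map_comp; congr flatten; apply: eq_map => i /=.
  by rewrite map_nseq.
rewrite twist_space; last exact: test1_derive1n.
congr (_ * _); rewrite big_flatten big_map big_enum /=; apply: eq_bigr => i _.
by elim: (m (wid i)) => [|n IH] /=; rewrite ?big_nil ?expr0// big_cons IH exprS.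
Qed.

Lemma pder_nseq_bump y phi l : test1 phi ->
  pder (nseq l ord_max) (bump y phi) = bump y (derive1n l phi).
Proof.
move=> tphi; elim: l => [//|l IH].
rewrite -[LHS]/(pder [:: ord_max] (pder (nseq l ord_max) (bump y phi))) IH.
by rewrite pder_bump_max ?derive1nS//; exact: test1_derive1n.
Qed.

Variable p : mpoly.mpoly d.+1 C.
Hypothesis Dp0 : forall f, test_fun f -> Dp p u f = 0.
Hypothesis uneg : vanishes_on_neg_t u.

(* The polynomial [p(iv, T)]. *)
Definition fiber_poly (v : 'I_d -> R) : {poly C} :=
  \sum_(m <- mpoly.msupp p)
     (mpoly.mcoeff m p * \prod_(i < d) ('i%C * ((v i)%:C)%C) ^+ mpoly.fun_of_multinom m (wid i))
       *: 'X^(mpoly.fun_of_multinom m ord_max).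

Let vk k i := (Lam *m freq k) (wid i) 0.

(** [Dp p u] is tested on the bump times the cosine and times the sine; the two equations combine
    into one for [twist], with coefficients those of p(iv, T). *)
Lemma twist_ode k y phi : test1 phi -> let q := fiber_poly (vk k) in
  \sum_(l < size q) q`_l * ((-1) ^+ l * twist k [::] (pder (nseq l ord_max) (bump y phi))) = 0.
Proof.
move=> tphi q; have tg := test_fun_bump y tphi.
have sc : smooth (fun z => cos (phase k z)) by apply: smooth_phase; exact: smooth1_cos.
have ss : smooth (fun z => sin (phase k z)) by apply: smooth_phase; exact: smooth1_sin.
have SP := @sum_poly_coef C _ (mpoly.msupp p)
  (fun m => mpoly.mcoeff m p *
     \prod_(i < d) ('i%C * ((vk k i)%:C)%C) ^+ (mpoly.fun_of_multinom m (wid i)))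
  (fun m => mpoly.fun_of_multinom m ord_max)
  (fun l => (-1) ^+ l * twist k [::] (pder (nseq l ord_max) (bump y phi))).
apply: etrans SP _; rewrite /=.
transitivity (1 * Dp p u (fun z => bump y phi z * cos (phase k z)) +
  (- 'i%C) * Dp p u (fun z => bump y phi z * sin (phase k z))); last first.
  by rewrite (Dp0 (test_funM tg sc)) (Dp0 (test_funM tg ss)) !mulr0 addr0.
rewrite /Dp mul1r mulr_sumr -big_split /=; apply: eq_bigr => m _.
pose cm := mpoly.mcoeff m p; set fm := mpoly.fun_of_multinom m.
transitivity (cm * ((-1) ^+ mpoly.mdeg m * twist k (mi_seq fm) (bump y phi))); last first.
  by rewrite /twist -/cm; ring.
rewrite twist_mi_seq// pder_nseq_bump// -/cm [X in _ = cm * X]mulrA.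
under [in RHS]eq_bigr do rewrite mulNr.
by rewrite sign_mdeg; ring.
Qed.

Lemma horner_fiber_poly (v : 'cV[R]_d) t :
  (fiber_poly (fun i => v i 0)).[t] = mpoly.meval (ivt v t) p.
Proof.
rewrite mpoly.mevalE horner_sum; apply: eq_bigr => m _.
rewrite hornerZ hornerXn big_ord_recr /= {2}/ivt unlift_none mulrA; congr (_ * _ * _).
by apply: eq_bigr => i _; rewrite /ivt -/(wid i) unlift_wid.
Qed.

Lemma twist_bump0 k y phi : test1 phi -> fiber_poly (vk k) != 0 ->
  twist k [::] (bump y phi) = 0.
Proof.
move=> tphi q0.
(* With [y] fixed, bumps vary only in their time profile, and form a family stable under time
   derivation and time translation. *)
pose G g := exists2 phi, test1 phi & g = bump y phi.
apply: (@ode_unique R _ ord_max G (fiber_poly (vk k))) => //.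
- by move=> _ [f tf ->]; exact: test_fun_bump.
- by move=> _ [f tf ->]; exists (derive1 f); [exact: test1_derive|exact: pder_bump_max].
- move=> _ t [f tf ->]; exists (fun s => f (s - - t)); first exact: test1_shift.
  apply/funext => z; rewrite /bump mulmxDl -scalemxAl ebasis_mul /Lam row_extmx_max -/Lam.
  apply: eq_bigr => i _; rewrite !mxE eqxx /cell.
  have [->|[a ->]] := wid_max i; rewrite ?unlift_none ?unlift_wid ?eqxx ?wid_neq /=.
    by rewrite mulr1 opprK.
  by rewrite mulr0 addr0.
- exact: dist_twist.
(* The margin e keeps the closed support inside the open half-space t < 0. *)
- move=> g [f tf gE] [e e0 ge].
  have h c : smooth c -> u (fun z => g z * c z) = 0.
    move=> sc; apply: uneg; first by rewrite gE; apply: test_funM => //; exact: test_fun_bump.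
    have cl : closed [set z : 'rV[R]_d.+1 | z 0 ord_max <= - e].
      apply: (@preimage_closed _ _ (fun z : 'rV[R]_d.+1 => z 0 ord_max) [set x | x <= - e]).
        by move=> z _; exact: coord_continuous.
      exact: closed_le.
    move=> z zf; rewrite /= /tpart.
    suff : z 0 ord_max <= - e by move=> /le_lt_trans; apply; rewrite oppr_lt0.
    have hs : closure [set x | g x * c x != 0] `<=`
      closure [set z : 'rV[R]_d.+1 | z 0 ord_max <= - e].
      apply: closureS => x /= gx; rewrite leNgt; apply/negP => /ltW /ge gx0.
      by rewrite gx0 mul0r eqxx in gx.
    by have := hs _ zf; rewrite -((closure_id _).1 cl).
  rewrite /twist /= !h ?mulr0 ?addr0//; apply: smooth_phase;
    [exact: smooth1_sin|exact: smooth1_cos].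
- by move=> _ [f tf ->]; exact: twist_ode.
- by exists phi.
Qed.

Hypothesis fiber0 : forall k, fiber_poly (vk k) != 0.

(** Since [u] is complex valued, killing cos - i sin does not kill each part. The frequency -k
    supplies cos + i sin, and the two equations together separate them. *)
Lemma u_bump_phase0 k y phi a : test1 phi ->
  u (fun z => bump y phi z * cos (phase k z + a)) = 0.
Proof.
move=> tphi; have tg := test_fun_bump y tphi.
have sc k' : smooth (fun z => cos (phase k' z)) by apply: smooth_phase; exact: smooth1_cos.
have ss k' : smooth (fun z => sin (phase k' z)) by apply: smooth_phase; exact: smooth1_sin.
pose Nk i := - k i.
have phN z : phase Nk z = - phase k z.
  rewrite /phase (_ : freq Nk = - freq k) ?mulmxN ?mxE//.
  apply/colP => i; rewrite !mxE; case: unlift => [b|]; rewrite ?oppr0//.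
  by rewrite /Nk mulrNz mulrN.
have h1 := twist_bump0 y tphi (fiber0 k); have h2 := twist_bump0 y tphi (fiber0 Nk).
have tc := test_funM tg (sc k); have ts := test_funM tg (ss k).
move: h1 h2; rewrite /twist /=.
have -> : (fun z => bump y phi z * cos (phase Nk z)) = (fun z => bump y phi z * cos (phase k z)).
  by apply/funext => z; rewrite phN cosN.
have -> : (fun z => bump y phi z * sin (phase Nk z)) =
  (fun z => -1 * (bump y phi z * sin (phase k z))).
  by apply/funext => z; rewrite phN sinN; ring.
rewrite (distZ du _ ts) rmorphN1.
set Uc := u _; set Us := u _ => h1 h2.
have Uc0 : Uc = 0.
  have : 2 * Uc = 0.
    by transitivity ((1 * Uc + - 'i%C * Us) + (1 * Uc + - 'i%C * (-1 * Us)));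
      [ring|rewrite h1 h2 addr0].
  by move/eqP; rewrite mulf_eq0 pnatr_eq0 /= => /eqP.
have Us0 : Us = 0.
  move: h1; rewrite Uc0 mulr0 add0r mulNr => /eqP; rewrite oppr_eq0 mulf_eq0.
  by rewrite [X in X || _](_ : _ = false) ?orFb => [/eqP//|]; rewrite eq_complex /= oner_eq0 andbF.
have -> : (fun z => bump y phi z * cos (phase k z + a)) =
   (fun z => cos a * (bump y phi z * cos (phase k z)) +
     (- sin a) * (bump y phi z * sin (phase k z))).
  by apply/funext => z; rewrite cosD; ring.
rewrite (distD du (test_funZ _ tc) (test_funZ _ ts)) (distZ du _ tc) (distZ du _ ts).
by rewrite -/Uc -/Us Uc0 Us0 !mulr0 addr0.
Qed.

(** Real trigonometric polynomials in lattice coordinates; the shift [a] merges sines and cosines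
    into one generator. *)
Inductive trig_poly : ('rV[R]_d.+1 -> R) -> Prop :=
| Trig_cos k (a : R) : trig_poly (fun z => cos (phase k z + a))
| Trig_add h1 h2 of trig_poly h1 & trig_poly h2 : trig_poly (fun z => h1 z + h2 z)
| Trig_scale c h of trig_poly h : trig_poly (fun z => c * h z).

Lemma trig_poly_smooth h : trig_poly h -> smooth h.
Proof.
elim=> {h} [k a|h1 h2 _ s1 _ s2|c h _ sh]; [|exact: smoothD|exact: smoothZ].
apply: (@smooth_phase k (fun s => cos (s + a))).
have := @smooth1_comp R cos 1 a (@smooth1_cos R).
by under eq_fun do rewrite mul1r.
Qed.

Lemma u_bump_trig0 h y phi : test1 phi -> trig_poly h -> u (fun z => bump y phi z * h z) = 0.
Proof.
move=> tphi; have tg := test_fun_bump y tphi; elim=> {h} [k a|h1 h2 t1 IH1 t2 IH2|c h th IH].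
- exact: u_bump_phase0.
- under [X in u X]eq_fun do rewrite mulrDr.
  by rewrite distD ?IH1 ?IH2 ?addr0//; apply: test_funM => //; exact: trig_poly_smooth.
- under [X in u X]eq_fun do rewrite mulrCA.
  by rewrite distZ ?IH ?mulr0//; apply: test_funM => //; exact: trig_poly_smooth.
Qed.

Lemma trig_poly_sum (I : Type) (r : seq I) F : (forall i, trig_poly (F i)) ->
  trig_poly (fun z => \sum_(i <- r) F i z).
Proof.
move=> tF; elim: r => [|i r IH].
  have := Trig_scale 0 (Trig_cos (fun=> 0) 0).
  by congr trig_poly; apply/funext => z; rewrite big_nil mul0r.
by under eq_fun do rewrite big_cons; exact: Trig_add.
Qed.

(** Product to sum: [km s] adds s m to the i-th frequency, for s = 1 and s = -1. *)
Lemma trig_poly_mul_cos h (m : int) i (b : R) : trig_poly h ->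
  trig_poly (fun z => cos (2 * pi * m%:~R * ((z *m Lam) 0 (wid i) - b)) * h z).
Proof.
pose km (s : int) (k : 'I_d -> int) j := if j == i then k j + s * m else k j.
have phm s k z : phase (km s k) z = phase k z + s%:~R * (2 * pi * m%:~R * (z *m Lam) 0 (wid i)).
  rewrite /phase [LHS]mxE [X in _ = X + _]mxE.
  rewrite (bigD1 (wid i))//= [X in _ = X + _](bigD1 (wid i))//=.
  set P := \sum_(j | _) _; set Q := \sum_(j | _) _.
  have -> : P = Q.
    apply: eq_bigr => j; have [->|[a ->]] := wid_max j; rewrite !mxE ?unlift_none// unlift_wid.
    rewrite /km => ai; rewrite (_ : a == i = false)//.
    by apply/negbTE; apply: contra ai => /eqP ->.
  rewrite [freq (km s k) _ _]mxE [freq k _ _]mxE unlift_wid /km eqxx intrD intrM; ring.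
elim=> {h} [k a|h1 h2 t1 IH1 t2 IH2|c h th IH].
- pose th (z : 'rV[R]_d.+1) := 2 * pi * m%:~R * (z *m Lam) 0 (wid i).
  have := Trig_scale (1/2) (Trig_add
    (Trig_cos (km 1 k) (a - 2 * pi * m%:~R * b)) (Trig_cos (km (-1) k) (a + 2 * pi * m%:~R * b))).
  congr trig_poly; apply/funext => z; rewrite !phm.
  have -> : phase k z + 1%:~R * (2 * pi * m%:~R * (z *m Lam) 0 (wid i)) + (a - 2 * pi * m%:~R * b) =
    (phase k z + a) + 2 * pi * m%:~R * ((z *m Lam) 0 (wid i) - b) by ring.
  have -> : phase k z + (-1)%:~R * (2 * pi * m%:~R * (z *m Lam) 0 (wid i)) +
    (a + 2 * pi * m%:~R * b) =
    (phase k z + a) - 2 * pi * m%:~R * ((z *m Lam) 0 (wid i) - b) by ring.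
  by move: (phase k z + a) (_ * (_ - b)) => X Y; rewrite cosD cosB; field.
- under eq_fun do rewrite mulrDr; exact: Trig_add.
- under eq_fun do rewrite mulrCA; exact: Trig_scale.
Qed.

Lemma trig_poly_fejer N (y : 'I_d -> R) :
  trig_poly (fun z => \prod_(i < d) fejer N ((z *m Lam) 0 (wid i) - y i)).
Proof.
elim: (index_enum _) => [|i r IH].
  have := Trig_cos (fun=> 0) 0; congr trig_poly; apply/funext => z; rewrite big_nil addr0.
  rewrite /phase mxE big1 ?cos0// => j _; rewrite [freq _ _ _]mxE.
  by case: unlift => [b|]; rewrite ?mulr0.
under eq_fun do rewrite big_cons /fejer -mulrA mulr_suml.
apply: Trig_scale; apply: trig_poly_sum => a.
under eq_fun do rewrite mulr_suml.
by apply: trig_poly_sum => b; exact: trig_poly_mul_cos.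
Qed.

Lemma unique_solution f : test_fun f -> u f = 0.
Proof.
apply: dist_Lam_ext0 => // N y.
(* Only the space factors of the kernel are split into [chi] and Fejér; the time factor stays whole,
   as the profile of the bump. *)
have := u_bump_trig0 (fun i => y 0 (wid i)) (test1_shift (y 0 ord_max) (@test1_kern R N))
  (trig_poly_fejer N (fun i => y 0 (wid i))).
move=> <-; congr u; apply/funext => z; rewrite /bump /prodf !big_ord_recr /= {2}/cell unlift_none.
rewrite mulrAC -big_split /=; congr (_ * _); apply: eq_bigr => i _.
by rewrite /cell -/(wid i) unlift_wid.
Qed.

End Uniqueness.

(** * An invariant mean by Riemann sums *)

(** The values cluster in a compact segment, and along an ultrafilter a cluster point is a limit. *)
Lemma ultra_bounded_cvg (R : realType) (U : set_system nat) (s : nat -> R) K :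
  UltraFilter U -> (forall j, `|s j| <= K) -> cvg (s j @[j --> U]).
Proof.
move=> UU sK; have PU : ProperFilter U by exact: ultra_proper.
have sI : (s @ U) `[- K, K]%classic.
  by apply: nearW => j; rewrite /= in_itv /= -ler_norml.
have [p [_ cp]] := @segment_compact R (- K) K (s @ U) _ sI; apply/cvg_ex; exists p => B Bp.
have [//|nB] := in_ultra_setVsetC (s @^-1` B) UU.
by have [x []] := cp (~` B) B nB Bp.
Qed.

Section Mean.
Variables (R : realType) (n : nat).
Local Notation C := (complex R).

(* Ultrafilter limits of Riemann sums provide the Lebesgue integral on test functions. *)
Lemma mean_exists : exists I : ('rV[R]_n -> R) -> R,
  [/\ Defs.distribution (fun f => ((I f)%:C)%C),
      forall f i, test_fun f -> I (pder [:: i] f) = 0 &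
      forall y : 'I_n -> R, I (prodf (fun i s => chi (y i - s))) = 1].
Proof.
(* Along an ultrafilter every bounded sequence converges, so existence of the limit comes down to
   the uniform bound [gsum_bound]. *)
have [U [UU Uoo]] := @ultraFilterLemma nat \oo _.
have PU : ProperFilter U by exact: ultra_proper.
(* One index drives both scales: the window grows to contain every support while the mesh
   shrinks. *)
pose S (f : 'rV[R]_n -> R) j : R := gsum j.+1 j.+1 f.
pose I (f : 'rV[R]_n -> R) : R := lim (S f j @[j --> U]).
have Icvg f : test_fun f -> S f j @[j --> U] --> I f.
  move=> tf; have [L0 fs] := test_fun_bsupp tf; have [K K0 fK] := test_fun_bounded tf.
  suff : cvg (S f j @[j --> U]) by [].
  apply: (@ultra_bounded_cvg _ _ _ (K * (2 * L0%:R + 1) ^+ n)) => j.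
  exact: gsum_bound.
have Ilim (f : 'rV[R]_n -> R) l : S f j @[j --> U] --> l -> I f = l.
  by move=> h; apply: cvg_lim.
have Ibound f L0 K : test_fun f -> bsupp L0%:R f -> (forall y, `|f y| <= K) ->
    `|I f| <= K * (2 * L0%:R + 1) ^+ n.
  move=> tf fs fK; apply/ler_addgt0Pl => e e0.
  have /cvgrPdist_lt/(_ e e0)/filter_ex[j hj] := Icvg f tf.
  have := @gsum_bound R n j.+1 L0 j.+1 f K (ltn0Sn j) fs fK; rewrite -/(S f j) => hS.
  have -> : I f = (I f - S f j) + S f j by rewrite subrK.
  apply: le_trans (ler_normD _ _) _; exact: lerD (ltW hj) hS.
exists I; split.
- apply/distributionP; split.
    move=> a f g tf tg; rewrite -rmorphM -rmorphD /=; congr (_%:C)%C; apply: Ilim.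
    under eq_fun do rewrite /S gsumD gsumZ.
    by apply: cvgD; [apply: cvgM; [exact: cvg_cst|exact: Icvg]|exact: Icvg].
  move=> phi [sphi [r br] u0] e e0.
  pose L0 := (Num.truncn r).+1.
  have bL j : bsupp L0%:R (phi j).
    by move=> z zr; apply: br; apply: lt_trans zr; exact: truncnS_gt.
  have tphi j : test_fun (phi j) by apply/test_funP; split=> //; exists r.
  have c0 : 0 < (2 * L0%:R + 1) ^+ n :> R by rewrite exprn_gt0// ltr_wpDl// mulr_ge0.
  have e2 : 0 < e / 2 / (2 * L0%:R + 1) ^+ n by rewrite !divr_gt0.
  have := u0 [::] _ e2; apply: filterS => j hj; rewrite cnorm_real.
  have := Ibound (phi j) L0 _ (tphi j) (bL j) (fun y => ltW (hj y)).
  by rewrite mulfVK ?gt_eqF// => /le_lt_trans; apply; rewrite ltr_pdivrMr// ltr_pMr// ltr1n.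
- move=> f i tf; apply: Ilim; have [L0 fs] := test_fun_bsupp tf.
  have [K K0 fK] := test_fun_bounded (test_fun_pder [:: i; i] tf).
  apply: (cvg_trans _ (_ : S (pder [:: i] f) j @[j --> \oo] --> (0 : R))).
    by move=> B; exact: Uoo.
  apply/cvgrPdist_le => e e0; near=> j; rewrite sub0r normrN.
  have Lj : (L0 < j.+1)%N by rewrite ltnS; near: j; exact: nbhs_infty_ge.
  apply: le_trans (gsum_pder (ltn0Sn j) Lj (test_fun_smooth tf) fs fK) _.
  rewrite ler_pdivrMr ?ltr0n// -ler_pdivrMl//.
  apply: le_trans (ltW (@truncnS_gt R _)) _; rewrite ler_nat ltnS.
  by near: j; exact: nbhs_infty_ge.
- move=> y; apply: Ilim.
  apply: (cvg_trans _ (_ : S (prodf (fun i s => chi (y i - s))) j @[j --> \oo] --> (1 : R))).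
    by move=> B; exact: Uoo.
  apply: cvg_near_cst; near=> j.
  rewrite /S gsum_prodf big1// => i _.
  have yj : `|y i| <= j.+1%:R - 1.
    rewrite -natr1 addrK; apply: (@le_trans _ _ (\sum_k `|y k|)).
      by rewrite (bigD1 i)//= lerDl sumr_ge0.
    apply: le_trans (ltW (@truncnS_gt R _)) _; rewrite ler_nat.
    by near: j; exact: nbhs_infty_ge.
  have := @sum_chi_periodic R (fun=> 1) j.+1 j.+1 (y i) (ltn0Sn j) yj (fun _ _ => erefl).
  rewrite sumr_const card_ord => h.
  rewrite (eq_bigr (fun q : 'I_(2 * j.+1 * j.+1) =>
    chi (y i - gpt R j.+1 j.+1 q) * 1)) ?h ?mulVf ?pnatr_eq0// => q _.
  by rewrite mulr1.
Unshelve. all: by end_near. Qed.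

(** Along e_i the mean of the translates has derivative the mean of a partial derivative, which is
    0, so it is constant; a general vector is reached one coordinate at a time. *)
Lemma test_fun_translate_mean (I : ('rV[R]_n -> R) -> R) a f :
  Defs.distribution (fun f => ((I f)%:C)%C) ->
  (forall f i, test_fun f -> I (pder [:: i] f) = 0) -> test_fun f ->
  I (fun z => f (z + a)) = I f.
Proof.
move=> dI Id; have shift1 g i (t : R) : test_fun g -> I (fun z => g (z + t *: ebasis R i)) = I g.
  move=> tg.
  have dz (s : R) : is_derive s 1 (fun t => I (fun z => g (z + t *: ebasis R i))) 0.
    have := @dist_shift_derive R n (fun f => ((I f)%:C)%C) g i (@complex.Re R) s.
    rewrite -(pder_shift [:: i] _ (test_fun_smooth tg)) Id; last exact: test_fun_shift.
    apply=> //; [by move=> [x1 x2] [y1 y2]| |exact: cnorm_Re].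
    by move=> c [x1 x2] /=; rewrite mul0r subr0.
  have := is_derive_0_is_cst t 0 dz => ->.
  by congr I; apply/funext => z; rewrite scale0r addr0.
rewrite [a]row_sum_delta; elim: (index_enum _) f => [|i r IH] f tf.
  by congr I; apply/funext => z; rewrite big_nil addr0.
rewrite -[RHS](shift1 f i (a 0 i) tf) -[RHS]IH; last exact: test_fun_shift.
by congr I; apply/funext => z; rewrite big_cons addrA addrAC.
Qed.

End Mean.

(** * Nonuniqueness *)

Lemma poly_eq0_of_horner (K : numDomainType) (q : {poly K}) : (forall t, q.[t] = 0) -> q = 0.
Proof.
move=> h; apply/eqP; apply: contraT => q0.
have := @max_poly_roots _ q [seq i%:R | i <- iota 0 (size q)] q0.
rewrite size_map size_iota ltnn => -> //.
  by apply/allP => _ /mapP[i _ ->]; apply/rootP; exact: h.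
by rewrite map_inj_uniq ?iota_uniq// => i j /eqP; rewrite eqr_nat => /eqP.
Qed.

Section Nonuniqueness.
Variables (R : realType) (d : nat) (A : 'M[R]_d).
Hypothesis uA : A \in unitmx.
Local Notation C := (complex R).
Variable k : 'I_d -> int.

Let v j := (extmx (invmx A) *m freq R k) j 0.

(** [wave cos] and [wave sin] are the real and imaginary parts of the solution e_v(x) step(t). *)
Let wave (phi : R -> R) (z : 'rV[R]_d.+1) : R := phi (phase A k z) * step (z 0 ord_max).

Let smooth_wave phi : smooth1 phi -> smooth (wave phi).
Proof.
move=> sphi; apply: smoothM; first exact: smooth_phase.
exact/smooth_coord/smooth1_step.
Qed.

Let pder_wave phi j : smooth1 phi ->
  pder [:: wid j] (wave phi) = (fun z => v (wid j) * wave (derive1 phi) z).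
Proof.
move=> sphi.
have s1 : smooth (fun z => phi (phase A k z)) by exact: smooth_phase.
have s2 : smooth (fun z : 'rV[R]_d.+1 => step (z 0 ord_max)) by exact/smooth_coord/smooth1_step.
rewrite (pder1M (wid j) s1 s2).
rewrite (pder_phase A k (wid j) sphi).
have -> : pder [:: wid j] (fun z : 'rV[R]_d.+1 => step (z 0 ord_max)) = (fun=> 0).
  have := pder1_ridge (wid j) (delta_mx ord_max 0) (@smooth1_step R).
  under eq_fun do rewrite -colE mxE; move=> ->; apply/funext => z.
  by rewrite mxE wid_neq mul0r.
by apply/funext => z; rewrite /= mulr0 addr0 /wave mulrA.
Qed.

Lemma test_fun_tensor (psi : 'rV[R]_d -> R) (phi : 'rV[R]_1 -> R) :
  test_fun psi -> test_fun phi -> test_fun (tensor psi phi).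
Proof.
move=> /test_funP[spsi [r psir]] /test_funP[sphi [r' phir]]; apply/test_funP; split.
  (* The projections to x and t as matrices, which makes the tensor a product of two affine
     pullbacks. *)
  pose B1 : 'M[R]_(d.+1, d) := \matrix_(i, j) (i == wid j)%:R.
  pose B2 : 'M[R]_(d.+1, 1) := \matrix_(i, j) (i == ord_max)%:R.
  have := smoothM (smooth_affine 0 B1 spsi) (smooth_affine 0 B2 sphi).
  congr smooth; apply/funext => z; rewrite /tensor !add0r; congr (psi _ * phi _).
    apply/rowP => j; rewrite !mxE (bigD1 (wid j))//= mxE eqxx mulr1 big1 ?addr0// => i ij.
    by rewrite mxE (negbTE ij) mulr0.
  apply/rowP => j; rewrite !mxE (bigD1 ord_max)//= mxE eqxx mulr1 big1 ?addr0// => i ij.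
  by rewrite mxE (negbTE ij) mulr0.
exists (`|r| + `|r'|) => z zr.
have [i zi] : exists i, `|r| + `|r'| < `|z 0 i|.
  apply: contrapT => h; move: zr; rewrite ltNge => /negP; apply.
  apply: rV_norm_le => [|i]; first by rewrite addr_ge0.
  by rewrite leNgt; apply/negP => zi; apply: h; exists i.
have r1 : r <= `|r| + `|r'| by apply: le_trans (ler_norm r) _; rewrite lerDl.
have r2 : r' <= `|r| + `|r'| by apply: le_trans (ler_norm r') _; rewrite lerDr.
rewrite /tensor; have [im|[j ij]] := wid_max i.
  rewrite phir ?mulr0//; apply: le_lt_trans r2 _; apply: lt_le_trans (rV_norm_coord _ 0).
  by rewrite mxE /tpart -im.
rewrite psir ?mul0r//; apply: le_lt_trans r1 _; apply: lt_le_trans (rV_norm_coord _ j).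
by rewrite mxE -/(wid j) -ij.
Qed.

Variable p : mpoly.mpoly d.+1 C.
Hypothesis p0 : fiber_poly p (fun i => v (wid i)) = 0.

Lemma not_NS_trivial : ~ NS_trivial A p.
Proof.
move=> NS; have [I [dI Id I1]] := @mean_exists R d.+1.
have sc := smooth_wave (@smooth1_cos R); have ss := smooth_wave (@smooth1_sin R).
pose u (f : 'rV[R]_d.+1 -> R) : C := 1 * ((I (fun z => f z * wave cos z))%:C)%C +
  'i%C * ((I (fun z => f z * wave sin z))%:C)%C.
have du : Defs.distribution u by apply: dist_comb; exact: (dist_mul dI).
have IB (f g : 'rV[R]_d.+1 -> R) a : test_fun f -> test_fun g ->
    I (fun z => f z + a * g z) = I f + a * I g.
  move=> tf tg; apply: (@complexI R); rewrite rmorphD rmorphM /=.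
  by rewrite (distD dI tf (test_funZ a tg)) (distZ dI a tg).
(* Integration by parts against the wave: in the sense of distributions the x_j-derivative of [u] is
   i v_j times [u]. *)
have uj f j : test_fun f -> u (pder [:: wid j] f) = - ('i%C * ((v (wid j))%:C)%C) * u f.
  move=> tf; have sf := test_fun_smooth tf.
  have tfc := test_funM tf sc; have tfs := test_funM tf ss.
  have tjc := test_funM (test_fun_pder [:: wid j] tf) sc.
  have tjs := test_funM (test_fun_pder [:: wid j] tf) ss.
  have hc : I (fun z => pder [:: wid j] f z * wave cos z) =
    v (wid j) * I (fun z => f z * wave sin z).
    have := Id _ (wid j) tfc; rewrite (pder1M (wid j) sf sc) pder_wave; last exact: smooth1_cos.
    rewrite derive1_cos (_ : (fun z => _) = (fun z => pder [:: wid j] f z * wave cos z +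
      (- v (wid j)) * (f z * wave sin z))); last first.
      by apply/funext => z; rewrite /wave; ring.
    by rewrite IB// mulNr => /eqP; rewrite subr_eq0 => /eqP.
  have hs : I (fun z => pder [:: wid j] f z * wave sin z) =
    - v (wid j) * I (fun z => f z * wave cos z).
    have := Id _ (wid j) tfs; rewrite (pder1M (wid j) sf ss) pder_wave; last exact: smooth1_sin.
    rewrite derive1_sin (_ : (fun z => _) = (fun z => pder [:: wid j] f z * wave sin z +
      v (wid j) * (f z * wave cos z))); last first.
      by apply/funext => z; rewrite /wave; ring.
    by rewrite IB// mulNr => /eqP; rewrite addr_eq0 => /eqP.
  rewrite /u hc hs !rmorphM rmorphN /=.
  set a := ((I _)%:C)%C; set b := ((I _)%:C)%C; set w := ((v _)%:C)%C.
  have i2 : 'i%C * 'i%C = -1 :> C by rewrite -expr2 sqr_i.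
  transitivity (- ('i%C * w) * (1 * b) - ('i%C * 'i%C) * w * a); last by ring.
  by rewrite i2; ring.
have upers s f : test_fun f -> u (pder [seq wid j | j <- s] f) =
    \prod_(j <- s) (- ('i%C * ((v (wid j))%:C)%C)) * u f.
  move=> tf; elim: s => [|j s IH]; first by rewrite big_nil mul1r.
  rewrite big_cons -mulrA -IH -uj; last exact: test_fun_pder.
  by [].
have Dpu f : test_fun f -> Dp p u f = 0.
  move=> tf; have SP := @sum_poly_coef C _ (mpoly.msupp p)
    (fun m => mpoly.mcoeff m p *
      \prod_(i < d) ('i%C * ((v (wid i))%:C)%C) ^+ mpoly.fun_of_multinom m (wid i))
    (fun m => mpoly.fun_of_multinom m ord_max)
    (fun l => (-1) ^+ l * u (pder (nseq l ord_max) f)).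
  pose q := fiber_poly p (fun i => v (wid i)).
  (* The fiber polynomial is zero, so p(iv, d/dt) annihilates every time factor. *)
  have SP0 : \sum_(l < size q) q`_l * ((-1) ^+ l * u (pder (nseq l ord_max) f)) = 0.
    by rewrite /q p0 size_poly0 big_ord0.
  apply: etrans (etrans (esym SP) SP0).
  apply: eq_bigr => m _; set fm := mpoly.fun_of_multinom m.
  rewrite mi_seq_split pder_cat.
  have -> : flatten [seq nseq (fm (wid i)) (wid i) | i <- enum 'I_d] =
      [seq wid j | j <- flatten [seq nseq (fm (wid i)) i | i <- enum 'I_d]].
    rewrite map_flatten -map_comp; congr flatten; apply: eq_map => i /=.
    by rewrite map_nseq.
  rewrite upers; last exact: test_fun_pder.
  have -> : \prod_(j <- flatten [seq nseq (fm (wid i)) i | i <- enum 'I_d])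
      (- ('i%C * ((v (wid j))%:C)%C)) =
      \prod_(i < d) (- ('i%C * ((v (wid i))%:C)%C)) ^+ fm (wid i).
    rewrite big_flatten big_map big_enum /=; apply: eq_bigr => i _.
    by elim: (fm (wid i)) => [|n IH] /=; rewrite ?big_nil ?expr0// big_cons IH exprS.
  rewrite -[LHS]mulrA [X in _ * X]mulrA sign_mdeg -/fm; ring.
have uper : periodic_dist A u.
  move=> l phi psi tphi tpsi; have tt := test_fun_tensor tpsi tphi.
  have -> : tensor (fun x => psi (x + row l A)) phi = (fun z => tensor psi phi (z + latv A l)).
    by apply/funext => z; rewrite /tensor xpart_latv tpart_latv.
  have h c : smooth c -> (forall z, c (z + latv A l) = c z) ->
      I (fun z => tensor psi phi (z + latv A l) * c z) = I (fun z => tensor psi phi z * c z).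
    move=> sc' cper; rewrite -[RHS](test_fun_translate_mean (latv A l) dI Id (test_funM tt sc')).
    by congr I; apply/funext => z; rewrite cper.
  have tl z : (z + latv A l) 0 ord_max = z 0 ord_max by exact: tpart_latv.
  rewrite /u !h// => z; rewrite /wave phase_latv// tl; congr (_ * _).
    exact: sinD2piz.
  exact: cosD2piz.
have uneg : vanishes_on_neg_t u.
  move=> f tf fneg; have I0 : I (fun=> 0) = 0.
    by apply: (@complexI R); exact: (dist0 dI).
  have f0 c : (fun z => f z * wave c z) = (fun=> 0).
    apply/funext => z; have [->|fz] := eqVneq (f z) 0; first by rewrite mul0r.
    have : tpart z < 0 by apply: fneg; exact: subset_closure.
    by move=> t0; rewrite /wave step_eq0 ?mulr0//; move: t0; rewrite /tpart; lra.
  by rewrite /u !f0 I0 rmorph0 !mulr0 addr0.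
(* Centred at time 5, [F] is supported where [step] is 1 and the wave has modulus 1. *)
pose y (i : 'I_d.+1) : R := if i == ord_max then 5 else 0.
pose F := prodf (fun i s => chi (y i - s)).
have tF : test_fun F.
  apply: test_fun_prodf => i; split.
    have [sch _] := @test1_chi R.
    have := @smooth1_comp _ _ (-1) (y i) sch; under eq_fun do rewrite mulN1r addrC.
    by [].
  exists (`|y i| + 1) => s hs; apply: chi_eq0.
  have := ler_normB (y i - s) (y i); rewrite [y i - s]addrC addrK normrN; lra.
have sP (phi : R -> R) : smooth1 phi -> smooth (fun z => phi (phase A k z)) by exact: smooth_phase.
have tFc := test_funM tF (sP _ (@smooth1_cos R)); have tFs := test_funM tF (sP _ (@smooth1_sin R)).
have uc := NS u du uper Dpu uneg _ tFc; have us := NS u du uper Dpu uneg _ tFs.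
(* The identity cos^2 + sin^2 = 1 recovers [F] from the real part of one value of [u] and the
   imaginary part of another; both vanish, against I F = 1. *)
have FE : F = (fun z => (F z * cos (phase A k z)) * wave cos z +
                        1 * ((F z * sin (phase A k z)) * wave sin z)).
  apply/funext => z; have st : F z * step (z 0 ord_max) = F z.
    have [h|h] := lerP (3/4) `|y ord_max - z 0 ord_max|.
      by rewrite /F (@prodf_zero _ _ _ _ ord_max) ?mul0r// chi_eq0.
    by rewrite step_eq1 ?mulr1//; move: h; rewrite /y eqxx ltr_norml; lra.
  transitivity (F z * step (z 0 ord_max) * (cos (phase A k z) ^+ 2 + sin (phase A k z) ^+ 2)).
    by rewrite cos2Dsin2 mulr1 st.
  by rewrite /wave; ring.
have : I F = 0.
  rewrite FE IB; [|exact: test_funM|exact: test_funM].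
  move: uc us; rewrite /u => /(congr1 (@complex.Re R)) /= + /(congr1 (@complex.Im R)) /=.
  rewrite !(mul0r, mul1r, mulr0, subr0, addr0, add0r, sub0r) => -> ->.
  by rewrite addr0.
by rewrite I1 => /eqP; rewrite oner_eq0.
Qed.

End Nonuniqueness.

Theorem theorem6p1 (R : realType) (d : nat) (A : 'M[R]_d)
    (hA : row_free A) (p : mpoly.mpoly d.+1 (complex R)) :
  NS_trivial A p <->
  (forall k : 'I_d -> int,
     let v := invmx A *m \col_(i < d) (2 * pi * (k i)%:~R) in
     exists t : complex R, mpoly.meval (ivt v t) p != 0).
Proof.
have uA : A \in unitmx by rewrite -row_free_unit.
have fE k : fiber_poly p (fun i => (extmx (invmx A) *m freq R k) (wid i) 0) =
    fiber_poly p (fun i => (invmx A *m \col_(i < d) (2 * pi * (k i)%:~R)) i 0).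
  by congr fiber_poly; apply/funext => i; exact: freq_wid.
split=> [NS k v|h u du uper Dp0 uneg].
  apply: contrapT => hn; apply: (@not_NS_trivial R d A uA k p _ NS).
  rewrite fE; apply: poly_eq0_of_horner => t; rewrite horner_fiber_poly.
  by apply/eqP; apply: contrapT => /negP ht; apply: hn; exists t.
apply: (unique_solution uA du (periodic_test uA du uper) Dp0 uneg) => k.
have [t ht] := h k; rewrite fE; apply: contraNneq ht => q0.
by rewrite -horner_fiber_poly q0 horner0.
Qed.
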